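(* Let $K$ be a non-empty compact Hausdorff space and let $(e^{tA})_{t\ge 0}$ be a real $C_0$-semigroup on $E=C(K)$ with $\sigma(A)\ne\emptyset$. Suppose that the peripheral spectrum $\sigma_{\mathrm{per}}(A)=\sigma(A)\cap(s(A)+i\mathbb{R})$ is finite and consists of poles of the resolvent. Then the following assertions are equivalent: (i) The semigroup $(e^{tA})_{t\ge 0}$ is individually eventually strongly positive. (ii) The semigroup $(e^{t(A-s(A)I)})_{t\ge 0}$ is bounded, $s(A)$ is a dominant spectral value of $A$, and the associated spectral projection $P$ satisfies $P\gg 0$. (iii) The operators $e^{t(A-s(A)I)}$ converge strongly to some operator $Q\gg 0$ as $t\to\infty$. If assertions (i)–(iii) are fulfilled, then $Q$ is the spectral projection associated with $s(A)$, that is, $Q=P$.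
   Context: $C(K)$ is the space of complex-valued continuous functions on $K$ with the supremum norm. For $f\in C(K)$: $f\ge 0$ means $f(x)\ge 0$ for all $x\in K$; $f>0$ means $f\ge 0$ and $f\ne 0$; $f\gg 0$ means there is $\beta>0$ with $f\ge\beta\mathbf{1}$. A bounded operator $T$ on $C(K)$ satisfies $T\gg 0$ if $Tf\gg 0$ for all $f>0$. A semigroup is real if every $e^{tA}$ maps real-valued functions to real-valued functions. $s(A)=\sup\{\operatorname{Re}\lambda:\lambda\in\sigma(A)\}$. $s(A)$ is a dominant spectral value if $s(A)\in\sigma(A)$ and $\sigma_{\mathrm{per}}(A)=\{s(A)\}$. The spectral projection associated with an isolated spectral value $\lambda_0$ is the residue of $R(\cdot,A)=(\cdot\, I-A)^{-1}$ at $\lambda_0$. The semigroup is individually eventually strongly positive if for every $f>0$ there exists $t_0\ge 0$ such that $e^{tA}f\gg 0$ for all $t\ge t_0$. *)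

(* Defs.v *)
From HB Require Import structures.
From mathcomp Require Import all_boot all_order all_algebra complex.
From mathcomp Require Import all_classical all_reals all_analysis.

Set Implicit Arguments.
Unset Strict Implicit.
Unset Printing Implicit Defensive.

Import Order.TTheory GRing.Theory Num.Theory.
Import numFieldNormedType.Exports.

Local Open Scope classical_set_scope.
Local Open Scope complex_scope.
Local Open Scope ring_scope.

Section sup_norm.
Variable R : realType.
Local Notation C := R[i].

(* The norm of a [normedModType R[i]] takes its values in [R[i]]; it is real,
   so its real part carries all the information and lives in the ordered field
   where suprema exist. *)
Definition rnorm (V : normedModType C) (v : V) : R := complex.Re `|v|.

Lemma rnormE (V : normedModType C) (v : V) : `|v| = (rnorm v)%:C.
Proof.
rewrite /rnorm; have := normr_ge0 v; case: (`|v|) => a b.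
by rewrite lecE /= => /andP[/eqP -> _].
Qed.

Lemma rnorm_ge0 (V : normedModType C) (v : V) : 0 <= rnorm v.
Proof. by rewrite -lecR -rnormE; exact: normr_ge0. Qed.

Lemma rnorm0 (V : normedModType C) : rnorm (0 : V) = 0.
Proof. by rewrite /rnorm normr0. Qed.

Lemma rnorm0_eq0 (V : normedModType C) (v : V) : rnorm v = 0 -> v = 0.
Proof. by move=> v0; apply/normr0_eq0; rewrite rnormE v0. Qed.

Lemma rnormD (V : normedModType C) (u v : V) :
  rnorm (u + v) <= rnorm u + rnorm v.
Proof. by rewrite -lecR rmorphD /= -!rnormE ler_normD. Qed.

Lemma rnormZ (V : normedModType C) (l : C) (v : V) :
  rnorm (l *: v) = rnorm (l : C^o) * rnorm v.
Proof. by apply: complexI; rewrite rmorphM /= -!rnormE normrZ. Qed.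

Lemma rnorm_continuous (V : normedModType C) : continuous (@rnorm V).
Proof.
move=> v; apply/cvgrPdist_lt => e e0.
have eC : 0 < e%:C :> C by rewrite ltcR.
have : nbhs v (ball v e%:C) by exact: nbhsx_ballx.
apply: filterS => u; rewrite -ball_normE /= rnormE ltcR => uv.
have tri (a b : V) : rnorm a <= rnorm b + rnorm (a - b).
  by apply: le_trans (rnormD _ _); rewrite addrC subrK.
apply: le_lt_trans uv; rewrite ler_distl lerBlDr tri andbT.
by rewrite [rnorm (v - u)]/rnorm distrC; exact: tri.
Qed.

Variables (I : Type) (A : set I).

Definition sup_on (g : I -> R) : R := sup [set g i | i in A].

Lemma sup_on_ub (g : I -> R) i : has_ubound [set g i | i in A] -> A i ->
  g i <= sup_on g.
Proof. by move=> ub Ai; apply: ub_le_sup => //; exists i. Qed.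

Lemma sup_on_le (g : I -> R) (b : R) : 0 <= b -> (forall i, A i -> g i <= b) ->
  sup_on g <= b.
Proof.
move=> b0 gb; have [A0|/set0P/negP] := pselect ([set g i | i in A] !=set0).
  by apply: ge_sup => // _ [i Ai <-]; exact: gb.
by rewrite negbK /sup_on => /eqP ->; rewrite sup0.
Qed.

End sup_norm.

(* The proof of compactness is an argument of the type so that the supremum
   norm, which requires it, can be declared as a structure on the type. *)
Definition Cspace (R : realType) (K : topologicalType)
  of compact [set: K] := continuousType K R[i]^o.

Section Cspace.
Variables (R : realType) (K : topologicalType) (cK : compact [set: K]).
Local Notation C := R[i].
Local Notation CK := (Cspace R cK).

HB.instance Definition _ := Choice.copy CK (continuousType K C^o).

Definition Cval (f : CK) : K -> C^o := Continuous.sort f.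

Lemma Cval_continuous (f : CK) : continuous (Cval f).
Proof. exact: (@cts_fun _ _ (f : continuousType K C^o)). Qed.

Lemma CvalP (f g : CK) : Cval f =1 Cval g -> f = g.
Proof. by move=> fg; exact/continuousEP. Qed.

Lemma Cadd_cts (f g : CK) : continuous (fun x => Cval f x + Cval g x).
Proof. by move=> x; apply: cvgD; exact: Cval_continuous. Qed.
Lemma Copp_cts (f : CK) : continuous (fun x => - Cval f x).
Proof. by move=> x; apply: cvgN; exact: Cval_continuous. Qed.
Lemma Cscale_cts (l : C) (f : CK) : continuous (fun x => l *: Cval f x).
Proof. by move=> x; apply: cvgZr; exact: Cval_continuous. Qed.

Definition Czero : CK := cst (0 : C^o).
Definition Cadd (f g : CK) : CK := mkcts (@Cadd_cts f g).
Definition Copp (f : CK) : CK := mkcts (@Copp_cts f).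
Definition Cscale (l : C) (f : CK) : CK := mkcts (@Cscale_cts l f).

Fact CaddA : associative Cadd.
Proof. by move=> f g h; apply: CvalP => x; exact: addrA. Qed.
Fact CaddC : commutative Cadd.
Proof. by move=> f g; apply: CvalP => x; exact: addrC. Qed.
Fact Cadd0 : left_id Czero Cadd.
Proof. by move=> f; apply: CvalP => x; exact: add0r. Qed.
Fact CaddN : left_inverse Czero Copp Cadd.
Proof. by move=> f; apply: CvalP => x; exact: addNr. Qed.
HB.instance Definition _ := GRing.isZmodule.Build CK CaddA CaddC Cadd0 CaddN.

Fact CscaleA (a b : C) (f : CK) : Cscale a (Cscale b f) = Cscale (a * b) f.
Proof. by apply: CvalP => x; exact: scalerA. Qed.
Fact Cscale1 : left_id 1 Cscale.
Proof. by move=> f; apply: CvalP => x; exact: scale1r. Qed.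
Fact CscaleDr : right_distributive Cscale +%R.
Proof. by move=> a f g; apply: CvalP => x; exact: scalerDr. Qed.
Fact CscaleDl (f : CK) : {morph Cscale^~ f : a b / a + b}.
Proof. by move=> a b; apply: CvalP => x; exact: scalerDl. Qed.
HB.instance Definition _ :=
  GRing.Zmodule_isLmodule.Build C CK CscaleA Cscale1 CscaleDr CscaleDl.

Definition Cnorm (f : CK) : C :=
  (sup_on [set: K] (fun x => rnorm (Cval f x)))%:C.

Fact Cnorm_ubound (f : CK) : has_ubound [set rnorm (Cval f x) | x in [set: K]].
Proof.
have /compact_bounded[M [_ fM]] : compact ((rnorm (V := C^o) \o Cval f) @` [set: K]).
  apply: continuous_compact => //; apply: continuous_subspaceT => x.
  by apply: continuous_comp; [exact: Cval_continuous|exact: rnorm_continuous].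
exists (M + 1) => _ [x _ <-].
have M1 : M < M + 1 by rewrite ltrDl ltr01.
by apply: le_trans (ler_norm _) (fM _ M1 _ _); exists x.
Qed.

Fact Cnorm_ge (f : CK) x :
  rnorm (Cval f x) <= sup_on [set: K] (fun x => rnorm (Cval f x)).
Proof.
by apply: (sup_on_ub (g := fun x => rnorm (Cval f x))) => //;
  exact: Cnorm_ubound.
Qed.

Fact Cnorm_ge0 (f : CK) : 0 <= sup_on [set: K] (fun x => rnorm (Cval f x)).
Proof.
have [[x]|] := pselect ([set: K] !=set0).
  by move=> _; exact: le_trans (rnorm_ge0 _) (Cnorm_ge f x).
by move=> /set0P/negP; rewrite negbK /sup_on => /eqP ->; rewrite image_set0 sup0.
Qed.

Fact CnormD (f g : CK) : Cnorm (f + g) <= Cnorm f + Cnorm g.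
Proof.
rewrite /Cnorm -rmorphD lecR; apply: sup_on_le.
  by apply: addr_ge0; exact: Cnorm_ge0.
by move=> x _; apply: le_trans (rnormD _ _) _; apply: lerD; exact: Cnorm_ge.
Qed.

Fact CnormZ (l : C) (f : CK) : Cnorm (l *: f) = `|l| * Cnorm f.
Proof.
have le (k : C) (h : CK) : sup_on [set: K] (fun x => rnorm (Cval (k *: h) x)) <=
    rnorm (k : C^o) * sup_on [set: K] (fun x => rnorm (Cval h x)).
  apply: sup_on_le => [|x _]; first by rewrite mulr_ge0 ?Cnorm_ge0 ?rnorm_ge0.
  rewrite [leLHS](rnormZ k (Cval h x)); apply: ler_wpM2l; first exact: rnorm_ge0.
  exact: Cnorm_ge.
rewrite /Cnorm [X in X * _](rnormE (l : C^o)) -rmorphM /=; congr (_%:C).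
apply/eqP; rewrite eq_le le /=.
have [->|l0] := eqVneq l 0; first by rewrite rnorm0 mul0r; exact: Cnorm_ge0.
have lV : rnorm (l : C^o) * rnorm (l^-1 : C^o) = 1.
  apply: complexI; rewrite rmorphM /= -!rnormE -normrM divff//.
  exact: normr1.
have := le l^-1 (l *: f); rewrite scalerA mulVf// scale1r.
move=> /(ler_wpM2l (rnorm_ge0 (l : C^o))) /le_trans; apply.
by rewrite mulrA lV mul1r.
Qed.

Fact Cnorm0_eq0 (f : CK) : Cnorm f = 0 -> f = 0.
Proof.
move=> /complexI f0; apply: CvalP => x; apply: rnorm0_eq0.
by apply/eqP; rewrite eq_le rnorm_ge0 andbT -f0 Cnorm_ge.
Qed.

HB.instance Definition _ := Lmodule_isNormed.Build C CK CnormD CnormZ Cnorm0_eq0.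

End Cspace.

#[short(type="boundedOp")]
HB.structure Definition BoundedOperator (R : realType) (E : normedModType R[i]) :=
  {f of @GRing.Linear R[i] E E *:%R f & @Continuous E E f}.

Section bounded_operators.
Variables (R : realType) (E : normedModType R[i]).
Local Notation C := R[i].
Local Notation L := (boundedOp E).
Implicit Types S T : L.

Definition bop (f : E -> E) (lf : linear f) (cf : continuous f) : L :=
  HB.pack f (GRing.isLinear.Build C E E *:%R f lf) (isContinuous.Build E E f cf).


Lemma bopP S T : S =1 T -> S = T.
Proof.
case: S T => [f [[[fa fb]] [fs] [fc]]] [g [[[ga gb]] [gs] [gc]]] /= /funext fg.
move: ga gb gs gc; case: _ / fg => ga gb gs gc.
by rewrite (Prop_irrelevance fa ga) (Prop_irrelevance fb gb)
  (Prop_irrelevance fs gs) (Prop_irrelevance fc gc).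
Qed.

HB.instance Definition _ := gen_eqMixin L.
HB.instance Definition _ := gen_choiceMixin L.

Fact bop_add_linear S T : linear (fun f => S f + T f).
Proof. by move=> a f g; rewrite !linearP scalerDr addrACA. Qed.
Fact bop_opp_linear T : linear (fun f => - T f).
Proof. by move=> a f g; rewrite linearP opprD scalerN. Qed.
Fact bop_scale_linear (l : C) T : linear (fun f => l *: T f).
Proof. by move=> a f g; rewrite linearP scalerDr !scalerA mulrC. Qed.
Fact bop_zero_linear : linear (cst 0 : E -> E).
Proof. by move=> a f g; rewrite /cst scaler0 addr0. Qed.

Fact bop_add_cts S T : continuous (fun f => S f + T f).
Proof. by move=> f; apply: cvgD; exact: cts_fun. Qed.
Fact bop_opp_cts T : continuous (fun f => - T f).
Proof. by move=> f; apply: cvgN; exact: cts_fun. Qed.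
Fact bop_scale_cts (l : C) T : continuous (fun f => l *: T f).
Proof. by move=> f; apply: cvgZr; exact: cts_fun. Qed.

Definition bop_zero : L := bop bop_zero_linear (@cst_continuous E E 0).
Definition bop_add S T : L := bop (bop_add_linear S T) (@bop_add_cts S T).
Definition bop_opp T : L := bop (bop_opp_linear T) (@bop_opp_cts T).
Definition bop_scale (l : C) T : L :=
  bop (bop_scale_linear l T) (@bop_scale_cts l T).

Fact bop_addA : associative bop_add.
Proof. by move=> S T U; apply: bopP => f; exact: addrA. Qed.
Fact bop_addC : commutative bop_add.
Proof. by move=> S T; apply: bopP => f; exact: addrC. Qed.
Fact bop_add0 : left_id bop_zero bop_add.
Proof. by move=> T; apply: bopP => f; exact: add0r. Qed.
Fact bop_addN : left_inverse bop_zero bop_opp bop_add.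
Proof. by move=> T; apply: bopP => f; exact: addNr. Qed.
HB.instance Definition _ :=
  GRing.isZmodule.Build L bop_addA bop_addC bop_add0 bop_addN.

Fact bop_scaleA (a b : C) T : bop_scale a (bop_scale b T) = bop_scale (a * b) T.
Proof. by apply: bopP => f; exact: scalerA. Qed.
Fact bop_scale1 : left_id 1 bop_scale.
Proof. by move=> T; apply: bopP => f; exact: scale1r. Qed.
Fact bop_scaleDr : right_distributive bop_scale +%R.
Proof. by move=> a S T; apply: bopP => f; exact: scalerDr. Qed.
Fact bop_scaleDl T : {morph bop_scale^~ T : a b / a + b}.
Proof. by move=> a b; apply: bopP => f; exact: scalerDl. Qed.
HB.instance Definition _ := GRing.Zmodule_isLmodule.Build C L
  bop_scaleA bop_scale1 bop_scaleDr bop_scaleDl.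

Let unit_ball : set E := [set f | `|f| <= 1].

Definition bop_norm T : C := (sup_on unit_ball (fun f => rnorm (T f)))%:C.

Fact bop_norm_ubound T : has_ubound [set rnorm (T f) | f in unit_ball].
Proof.
have /bounded_funP/(_ 1)[M TM] : bounded_near T (nbhs (0 : E)).
  by apply/linear_bounded_continuous; exact: cts_fun.
exists (complex.Re M) => _ [f f1 <-].
by have := TM _ f1; rewrite rnormE lecE => /andP[].
Qed.

Fact bop_norm_ge T f : `|f| <= 1 ->
  rnorm (T f) <= sup_on unit_ball (fun f => rnorm (T f)).
Proof.
by move=> f1; apply: (sup_on_ub (g := fun f => rnorm (T f))) => //;
  exact: bop_norm_ubound.
Qed.

Fact bop_norm_ge0 T : 0 <= sup_on unit_ball (fun f => rnorm (T f)).
Proof.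
by apply: le_trans (rnorm_ge0 (T 0)) (bop_norm_ge _ _); rewrite normr0 ler01.
Qed.

Fact bop_normD S T : bop_norm (S + T) <= bop_norm S + bop_norm T.
Proof.
rewrite /bop_norm -rmorphD lecR; apply: sup_on_le.
  by apply: addr_ge0; exact: bop_norm_ge0.
by move=> f f1; apply: le_trans (rnormD _ _) _; apply: lerD; exact: bop_norm_ge.
Qed.

Fact bop_normZ (l : C) T : bop_norm (l *: T) = `|l| * bop_norm T.
Proof.
have le (k : C) (S : L) : sup_on unit_ball (fun f => rnorm ((k *: S) f)) <=
    rnorm (k : C^o) * sup_on unit_ball (fun f => rnorm (S f)).
  apply: sup_on_le => [|f f1]; first by rewrite mulr_ge0 ?bop_norm_ge0 ?rnorm_ge0.
  rewrite [leLHS](rnormZ k (S f)); apply: ler_wpM2l; first exact: rnorm_ge0.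
  exact: bop_norm_ge.
rewrite /bop_norm [X in X * _](rnormE (l : C^o)) -rmorphM /=; congr (_%:C).
apply/eqP; rewrite eq_le le /=.
have [->|l0] := eqVneq l 0; first by rewrite rnorm0 mul0r; exact: (bop_norm_ge0 (0 *: T)).
have lV : rnorm (l : C^o) * rnorm (l^-1 : C^o) = 1.
  apply: complexI; rewrite rmorphM /= -!rnormE -normrM divff//.
  exact: normr1.
have := le l^-1 (l *: T); rewrite scalerA mulVf// scale1r.
move=> /(ler_wpM2l (rnorm_ge0 (l : C^o))) /le_trans; apply.
by rewrite mulrA lV mul1r.
Qed.

Fact bop_norm0_eq0 T : bop_norm T = 0 -> T = 0.
Proof.
move=> /complexI T0; apply: bopP => f.
have [->|f0] := eqVneq f 0; first by rewrite !linear0.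
have nf0 : `|f| != 0 by rewrite normr_eq0.
have : T (`|f|^-1 *: f) = 0.
  apply: rnorm0_eq0; apply/eqP; rewrite eq_le rnorm_ge0 andbT -T0.
  by apply: bop_norm_ge; rewrite normrZ normfV normr_id mulVf.
by rewrite linearZ => /eqP; rewrite scaler_eq0 invr_eq0 (negPf nf0) => /eqP.
Qed.

HB.instance Definition _ :=
  Lmodule_isNormed.Build C L bop_normD bop_normZ bop_norm0_eq0.

End bounded_operators.

Section laurent.
Variables (R : realType) (V : normedModType R[i]).
Local Notation C := R[i].
Implicit Types (F : C -> V) (z : C) (a : int -> V).

(* [a] lists the coefficients of the expansion of [F] on some punctured disc
   around [z0]; [Negz n] is [- n.+1], so the two series are the regular and the
   principal part. *)
Definition laurent_expansion F (z0 : C) a :=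
  exists2 r : R, 0 < r & forall z : C, 0 < `|z - z0| < r%:C ->
    exists G H : V,
      [/\ F z = G + H,
          [series (z - z0) ^ Posz n *: a (Posz n)]_n @ \oo --> G &
          [series (z - z0) ^ Negz n *: a (Negz n)]_n @ \oo --> H].

Definition is_pole F (z0 : C) := exists (m : nat) (a : int -> V),
  [/\ (0 < m)%N, laurent_expansion F z0 a, a (- m%:Z) != 0 &
      forall n : nat, (m < n)%N -> a (- n%:Z) = 0].

(* Like [lim], this is only meaningful if [F] has a Laurent expansion at [z0],
   in which case the coefficients are unique; the default value is 0. *)
Definition residue F (z0 : C) : V :=
  xget 0 [set c | exists2 a, laurent_expansion F z0 a & a (- 1%:Z) = c].

End laurent.

(* Only the values of [pop_fun] on [pop_dom] are meaningful. *)
Record partial_op (R : realType) (E : normedModType R[i]) := PartialOp {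
  pop_dom : set E;
  pop_fun :> E -> E
}.

Section spectrum.
Variables (R : realType) (E : normedModType R[i]) (A : partial_op E).
Local Notation C := R[i].

Definition is_resolvent (z : C) (S : boundedOp E) :=
  (forall g, pop_dom A (S g) /\ z *: S g - A (S g) = g) /\
  (forall f, pop_dom A f -> S (z *: f - A f) = f).

Definition resolvent_set : set C := [set z | exists S, is_resolvent z S].

Definition spectrum : set C := ~` resolvent_set.

(* The default value 0 is only used for [z] in the spectrum. *)
Definition resolvent (z : C) : boundedOp E := xget 0 (is_resolvent z).

(* The supremum is meant for a spectrum that is nonempty and has bounded real
   parts; the latter always holds for generators of C0-semigroups. *)
Definition spectral_bound : R := sup [set complex.Re z | z in spectrum].

Definition peripheral_spectrum : set C :=
  spectrum `&` [set spectral_bound +i* y | y in [set: R]].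

Definition resolvent_pole (z0 : C) :=
  isolated (spectrum : set C^o) z0 /\ is_pole resolvent z0.

Definition spectral_projection (z0 : C) : boundedOp E := residue resolvent z0.

Definition dominant_spectral_bound :=
  spectrum spectral_bound%:C /\ peripheral_spectrum = [set spectral_bound%:C].

End spectrum.

(* Only the operators [T t] with [0 <= t] are meaningful. *)
Section semigroup.
Variables (R : realType) (E : normedModType R[i]) (T : R -> boundedOp E).
Local Notation C := R[i].

Record C0_semigroup : Prop := {
  C0_semigroup0 : forall f, T 0 f = f;
  C0_semigroupD : forall s t f, 0 <= s -> 0 <= t -> T (s + t) f = T s (T t f);
  C0_semigroup_cvg : forall f, T t f @[t --> 0^'+] --> f
}.

Definition generator_quotient (f : E) (t : R) : E := (t^-1)%:C *: (T t f - f).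

Definition generator : partial_op E := PartialOp
  [set f | cvg (generator_quotient f t @[t --> 0^'+])]
  (fun f => lim (generator_quotient f t @[t --> 0^'+])).

(* This is the semigroup generated by [generator T - s I]. *)
Definition rescale (s : R) (t : R) : boundedOp E := (expR (- (t * s)))%:C *: T t.

Definition bounded_semigroup :=
  exists M : R, forall t, 0 <= t -> `|T t| <= M%:C.

Definition strongly_converges (Q : boundedOp E) :=
  forall f, T t f @[t --> +oo] --> Q f.

End semigroup.

Section positivity.
Variables (R : realType) (K : topologicalType) (cK : compact [set: K]).
Local Notation C := R[i].
Local Notation CK := (Cspace R cK).

(* In [R[i]], [a <= b] means that [b - a] is a nonnegative real number. *)
Definition nonneg_fun (f : CK) := forall x, (0 : C) <= Cval f x.

Definition pos_fun (f : CK) := nonneg_fun f /\ f <> 0.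

Definition strongly_pos_fun (f : CK) :=
  exists2 b : R, 0 < b & forall x, b%:C <= (Cval f x : C).

Definition strongly_pos_op (S : boundedOp CK) :=
  forall f, pos_fun f -> strongly_pos_fun (S f).

Definition real_fun (f : CK) := forall x, complex.Im (Cval f x) = 0.

Definition real_semigroup (T : R -> boundedOp CK) :=
  forall t, 0 <= t -> forall f, real_fun f -> real_fun (T t f).

Definition indiv_ev_strongly_pos (T : R -> boundedOp CK) :=
  forall f, pos_fun f -> exists2 t0 : R, 0 <= t0 &
    forall t, t0 <= t -> strongly_pos_fun (T t f).

End positivity.

(* Main.v *)
Require Import Defs.
From HB Require Import structures.
From mathcomp Require Import all_boot all_order all_algebra complex.
From mathcomp Require Import all_classical all_reals all_analysis.
From mathcomp Require Import ring lra.

(* Let [s] be the spectral bound, [A] the generator, [W] the rescaled semigroup.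

   Eventual strong positivity puts [s] into the spectrum: otherwise the resolvent
   would be positive on the half-line beyond some [s - d], the integrals of
   positive orbits would be dominated by the resolvent, and the semigroup would
   grow at most like [exp (t (s - d))]. At the pole [s] the leading Laurent
   coefficient [c0] commutes with [T t], maps into the eigenspace of [s] and is
   positive, so [u = c0 1] is a fixed vector of [W] and hence strongly positive.
   The orbits of [W] are dominated by those of multiples of [u], so [W] is
   bounded and the pole is simple. An eigenvector for another peripheral
   eigenvalue is periodic under [W]; its real and imaginary parts [g] are
   multiples of [u]: for the least [c] with [g <= c u] the function [c u - g] is
   nonnegative and periodic but not above a positive multiple of [u], so it is
   0. Strong positivity of the projection follows
   from [c0 f = c0 (W t f)].

   If [W] is bounded, [s] is dominant and a simple pole with residue [P], the
   Laplace transform of [t |-> W t (f - P f)] extends continuously to the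
   imaginary axis, and a Tauberian argument with Fejer kernels and the
   Riemann-Lebesgue lemma shows that this orbit tends to 0. Conversely a strong
   limit [Q] fixes its range pointwise, which puts [s] into the spectrum, and no
   other unimodular orbit [exp (i b t) v] converges. *)

Set Implicit Arguments.
Unset Strict Implicit.
Unset Printing Implicit Defensive.

Import Order.TTheory GRing.Theory Num.Theory.
Import numFieldNormedType.Exports.

Local Open Scope classical_set_scope.
Local Open Scope complex_scope.
Local Open Scope ring_scope.

(** * Norms, bounded operators and completeness *)

(** In (i) the time [t0] depends on [f], so no single operator of the semigroup need be positive,
    and neither need the resolvent. The remedy is the cone of functions whose whole forward orbit is
    nonnegative: each positive [f] enters it under some [T t1], resolvents far to the right preserve
    it, and Neumann steps along the real axis carry this to the left. Results about the leading
    coefficient return from [T t1 f] to [f] because it commutes with the semigroup and its range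
    consists of eigenvectors. A pole is given only by its Laurent series, so identities between
    coefficients come from comparing powers of [h] near the pole. Two coefficients are kept since
    [c1] serves twice: at a pole of higher order it would start a Jordan chain, which boundedness
    excludes; at a simple pole [c1 f] is the value at 0 of the extended Laplace transform. Calculus
    rests on right derivatives, the natural notion for generators, and a Dini-type monotonicity
    lemma; vector integrals are primitives built pointwise. *)

Section rnorm_theory.
Variables (R : realType) (V : normedModType R[i]).
Local Notation C := R[i].
Implicit Types u v w : V.

Lemma rnormN v : rnorm (- v) = rnorm v.
Proof. by rewrite /rnorm normrN. Qed.

Lemma rnorm_distC u v : rnorm (u - v) = rnorm (v - u).
Proof. by rewrite /rnorm distrC. Qed.

Lemma rnormB u v : rnorm (u - v) <= rnorm u + rnorm v.
Proof. by apply: le_trans (rnormD _ _) _; rewrite rnormN. Qed.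

Lemma rnorm_triangle u v w : rnorm (u - w) <= rnorm (u - v) + rnorm (v - w).
Proof. by apply: le_trans (rnormD _ _); rewrite addrA subrK. Qed.

Lemma rnorm_le_dist u v : rnorm u <= rnorm v + rnorm (u - v).
Proof. by apply: le_trans (rnormD _ _); rewrite addrC subrK. Qed.

Lemma rnormZR (r : R) v : rnorm (r%:C *: v) = `|r| * rnorm v.
Proof. by rewrite rnormZ; congr (_ * _); rewrite /rnorm normc_def /= expr0n addr0 sqrtr_sqr. Qed.

Lemma rnorm_eq0 v : (forall e : R, 0 < e -> rnorm v <= e) -> v = 0.
Proof.
move=> ve; apply: rnorm0_eq0; apply/eqP; rewrite eq_le rnorm_ge0 andbT.
by apply/ler_addgt0Pr => e e0; rewrite add0r; exact: ve.
Qed.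

(** Positive elements of [R[i]] are real, so real tolerances are enough. *)
Lemma cvg_rnormP (T : Type) (F : set_system T) (f : T -> V) (l : V) : Filter F ->
  f @ F --> l <-> (forall e : R, 0 < e -> \forall x \near F, rnorm (l - f x) <= e).
Proof.
move=> FF; split => [/cvgrPdist_le fl e e0|fl].
  have eC : 0 < e%:C :> C by rewrite ltcR.
  by apply: filterS (fl _ eC) => x; rewrite rnormE lecR.
apply/cvgrPdist_le => -[a b]; rewrite ltcE /= => /andP[/eqP b0 a0].
by apply: filterS (fl _ a0) => x; rewrite rnormE b0 lecR.
Qed.

Lemma cvg_rnorm (T : Type) (F : set_system T) (f : T -> V) (l : V) : Filter F ->
  f @ F --> l -> rnorm (f x) @[x --> F] --> rnorm l.
Proof. by move=> FF fl; apply: cvg_comp fl _; exact: rnorm_continuous. Qed.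

Lemma cvg_near_eq (T : Type) (F : set_system T) (f g : T -> V) (l : V) : Filter F ->
  (\forall x \near F, f x = g x) -> f @ F --> l -> g @ F --> l.
Proof. by move=> FF fg; apply: cvg_trans; exact: near_eq_cvg. Qed.

Lemma rnorm_cvg_unique (T : Type) (F : set_system T) (f : T -> V) (a b : V) :
  ProperFilter F -> f @ F --> a -> f @ F --> b -> a = b.
Proof. by move=> FF fa fb; exact: cvg_unique fa fb. Qed.

Lemma cmod_real (r : R) : rnorm (r%:C : C^o) = `|r|.
Proof. by rewrite /rnorm normc_def /= expr0n addr0 sqrtr_sqr. Qed.

Lemma cmodM (a b : C) : rnorm (a * b : C^o) = rnorm (a : C^o) * rnorm (b : C^o).
Proof. exact: rnormZ. Qed.

Lemma cmod1 : rnorm (1 : C^o) = 1.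
Proof. by have := cmod_real 1; rewrite normr1. Qed.

Lemma cmod_eq0 (a : C) : (rnorm (a : C^o) == 0) = (a == 0).
Proof. by apply/eqP/eqP => [/rnorm0_eq0//|->]; exact: rnorm0. Qed.

Lemma cmod_gt0 (a : C) : (0 < rnorm (a : C^o)) = (a != 0).
Proof. by rewrite lt_neqAle rnorm_ge0 andbT eq_sym cmod_eq0. Qed.

Lemma cmodV (a : C) : rnorm (a^-1 : C^o) = (rnorm (a : C^o))^-1.
Proof.
have [->|a0] := eqVneq a 0; first by rewrite invr0 rnorm0 invr0.
have n0 : rnorm (a : C^o) != 0 by rewrite cmod_eq0.
by apply: (mulfI n0); rewrite -cmodM divff// cmod1 divff.
Qed.

Lemma cmodX (a : C) n : rnorm (a ^+ n : C^o) = rnorm (a : C^o) ^+ n.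
Proof. by elim: n => [|n IH]; rewrite ?expr0 ?cmod1// !exprS cmodM IH. Qed.

Lemma cmod_le (a : C) : rnorm (a : C^o) <= `|complex.Re a| + `|complex.Im a|.
Proof.
case: a => a b /=; rewrite /rnorm normc_def /=.
have -> : `|a| + `|b| = Num.sqrt ((`|a| + `|b|) ^+ 2) by rewrite sqrtr_sqr [RHS]ger0_norm// addr_ge0.
rewrite ler_sqrt ?sqr_ge0// sqrrD !real_normK ?num_real//.
by rewrite addrAC lerDl mulrn_wge0// mulr_ge0.
Qed.

Lemma Re_le_cmod (a : C) : `|complex.Re a| <= rnorm (a : C^o).
Proof.
case: a => a b /=; rewrite /rnorm normc_def /= -[leLHS]sqrtr_sqr ler_sqrt; first by rewrite lerDl sqr_ge0.
by rewrite addr_ge0 ?sqr_ge0.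
Qed.

Lemma Im_le_cmod (a : C) : `|complex.Im a| <= rnorm (a : C^o).
Proof.
case: a => a b /=; rewrite /rnorm normc_def /= -[leLHS]sqrtr_sqr ler_sqrt; first by rewrite lerDr sqr_ge0.
by rewrite addr_ge0 ?sqr_ge0.
Qed.

End rnorm_theory.

Section bounded_operator_theory.
Variables (R : realType) (E : normedModType R[i]).
Local Notation C := R[i].
Implicit Types S T : boundedOp E.

Lemma rnorm_bop S f : rnorm (S f) <= rnorm S * rnorm f.
Proof.
have [->|f0] := eqVneq f 0; first by rewrite linear0 !rnorm0 mulr0.
have nf : 0 < rnorm f by rewrite lt_neqAle rnorm_ge0 andbT eq_sym; apply: contra_neq f0; exact: rnorm0_eq0.
have u1 : `|(rnorm f)^-1%:C *: f| <= 1.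
  by rewrite rnormE rnormZR gtr0_norm ?invr_gt0// mulVf ?gt_eqF.
have := bop_norm_ge S u1; rewrite linearZ rnormZR gtr0_norm ?invr_gt0//.
by rewrite ler_pdivrMl// mulrC => /le_trans; apply.
Qed.

Lemma rnorm_bop_le S c : 0 <= c -> (forall f, rnorm (S f) <= c * rnorm f) -> rnorm S <= c.
Proof.
move=> c0 Sc; have -> : rnorm S = sup_on [set f : E | `|f| <= 1] (fun f => rnorm (S f)) by [].
apply: sup_on_le => // f /=; rewrite rnormE -[1]/(1%:C) lecR => f1.
by apply: le_trans (Sc f) _; rewrite ler_piMr.
Qed.

Lemma bopBE S T f : (S - T) f = S f - T f. Proof. by []. Qed.
Lemma bopZE z S f : (z *: S) f = z *: S f. Proof. by []. Qed.

Lemma bounded_continuous (F : E -> E) (c : R) : linear F ->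
  (forall f, rnorm (F f) <= c * rnorm f) -> continuous F.
Proof.
move=> lF Fc f; apply/cvg_rnormP => e e0.
have c0 : 0 < Num.max c 1 by rewrite lt_max ltr01 orbT.
have : (fun g : E => g) @ f --> f by [].
move=> /cvg_rnormP/(_ (e / Num.max c 1)); rewrite divr_gt0// => /(_ isT).
apply: filterS => g; rewrite ler_pdivlMr// => ge.
have -> : F f - F g = F (f - g) by rewrite (addrC f) -(scaleN1r g) lF scaleN1r addrC.
by apply: le_trans (Fc _) (le_trans _ ge); rewrite mulrC ler_wpM2l ?rnorm_ge0// le_max lexx.
Qed.

Definition bounded_bop (F : E -> E) (c : R) (lF : linear F)
  (Fc : forall f, rnorm (F f) <= c * rnorm f) : boundedOp E :=
  bop lF (bounded_continuous lF Fc).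

Lemma bop_cvg (T : Type) (F : set_system T) {FF : Filter F} S (u : T -> E) (l : E) :
  u @ F --> l -> S (u x) @[x --> F] --> S l.
Proof. by move=> ul; apply: continuous_cvg => //; exact: cts_fun. Qed.

End bounded_operator_theory.
Arguments bop_cvg {R E T F FF} S {u l}.

Section completeness.
Variables (R : realType) (E : completeNormedModType R[i]).
Local Notation C := R[i].

Lemma geometric_step (V : normedModType R[i]) (u : nat -> V) (c q : R) :
  0 <= c -> 0 <= q -> q <= 2^-1 ->
  (forall n, rnorm (u n.+1 - u n) <= c * q ^+ n) ->
  forall n k, rnorm (u (n + k)%N - u n) <= 2 * c * q ^+ n.
Proof.
move=> c0 q0 q1 uc n k.
have qn0 m : 0 <= q ^+ m by rewrite exprn_ge0.
(* The subtracted tail makes the induction work: with [p = q ^+ (n + k)] a step adds [c * p], which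
   is at most [2 * c * (p - q * p)] because [q <= 2^-1]. *)
suff : rnorm (u (n + k)%N - u n) <= 2 * c * (q ^+ n - q ^+ (n + k)).
  move=> /le_trans; apply; rewrite ler_wpM2l// ?mulr_ge0//.
  by rewrite gerBl.
elim: k => [|k IH]; first by rewrite addn0 !subrr rnorm0 mulr0.
apply: le_trans (rnorm_triangle _ (u (n + k)%N) _) _.
apply: le_trans (lerD _ IH) _; first by rewrite addnS; exact: uc.
rewrite addnS exprS.
have := qn0 (n + k)%N; set p := q ^+ (n + k); set r := q ^+ n => p0.
have : 0 <= c * p * (1 - 2 * q) by rewrite !mulr_ge0// subr_ge0; lra.
lra.
Qed.

Lemma fast_cauchy_cvg (u : nat -> E) (c q : R) : 0 <= c -> 0 <= q -> q <= 2^-1 ->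
  (forall n, rnorm (u n.+1 - u n) <= c * q ^+ n) ->
  exists2 l, u @ \oo --> l & forall n, rnorm (l - u n) <= 2 * c * q ^+ n.
Proof.
move=> c0 q0 q1 uc; have step := geometric_step c0 q0 q1 uc.
have uC : cvg (u @ \oo).
  apply/cauchy_cvgP/cauchy_ballP => -[a b]; rewrite ltcE /= => /andP[/eqP -> a0].
  have small : \forall n \near \oo, 4 * c * q ^+ n < a.
    have : (fun n => 4 * c * q ^+ n) @ \oo --> 4 * c * 0.
      apply: cvgM; first exact: cvg_cst.
      by apply: cvg_expr; rewrite ger0_norm//; lra.
    rewrite mulr0 => /cvgrPdist_lt/(_ _ a0); apply: filterS => n.
    by rewrite sub0r normrN ger0_norm// !mulr_ge0// exprn_ge0.
  have [N _ /(_ N (leqnn N)) NP] := small.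
  near_simpl; exists ([set n | (N <= n)%N], [set n | (N <= n)%N]) => /=.
    by split; exists N.
  move=> -[m n] /= [mN nN]; rewrite -ball_normE /= rnormE ltcR.
  apply: le_lt_trans NP.
  apply: le_trans (rnorm_triangle _ (u N) _) _.
  have := step N (m - N)%N; have := step N (n - N)%N; rewrite !subnKC// => A B.
  rewrite (rnorm_distC (u N)); lra.
exists (lim (u @ \oo)) => [//|n].
apply/ler_addgt0Pr => e e0.
have /cvg_rnormP/(_ _ e0) : u @ \oo --> lim (u @ \oo) by [].
move=> [N _ NP]; have /= nN : (N <= n + N)%N by rewrite leq_addl.
apply: le_trans (rnorm_triangle _ (u (n + N)%N) _) _.
by rewrite addrC lerD// ?step// NP.
Unshelve. all: by end_near. Qed.

(** The convergence of the partial sums is part of the conclusion because closed cones preserved by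
    [B] pass to [N] through it. *)
Lemma neumann (B : boundedOp E) : (forall f, rnorm (B f) <= 2^-1 * rnorm f) ->
  exists N : boundedOp E, [/\ forall f, N f - B (N f) = f,
    forall f, N (f - B f) = f,
    forall f, rnorm (N f) <= 2 * rnorm f &
    forall f, (fun n => \sum_(k < n) iter k B f) @ \oo --> N f].
Proof.
move=> B2.
have itB k f : rnorm (iter k B f) <= rnorm f * 2^-1 ^+ k.
  elim: k => [|k IH] /=; first by rewrite expr0 mulr1.
  apply: le_trans (B2 _) _; rewrite exprS mulrCA ler_wpM2l ?invr_ge0//.
pose u f n := \sum_(k < n) iter k B f.
have stepu f n : rnorm (u f n.+1 - u f n) <= rnorm f * 2^-1 ^+ n.
  by rewrite /u big_ord_recr /= addrC addrK.
have ex f : exists l, u f @ \oo --> l /\ rnorm l <= 2 * rnorm f.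
  have [||l ul le] := fast_cauchy_cvg (rnorm_ge0 f) _ _ (stepu f); rewrite ?invr_ge0//.
  by exists l; split=> //; have := le 0%N; rewrite /u big_ord0 subr0 expr0 mulr1.
pose F f := sval (cid (ex f)).
have Fu f : u f @ \oo --> F f by rewrite /F; case: cid => l [].
have Fb f : rnorm (F f) <= 2 * rnorm f by rewrite /F; case: cid => l [].
have itlin k : linear (iter k B).
  by elim: k => [//|k IH] a f g /=; rewrite IH linearP.
have lF : linear F.
  move=> a f g; apply: rnorm_cvg_unique (Fu _) _.
  have -> : u (a *: f + g) = (fun n => a *: u f n + u g n).
    apply/funext => n; rewrite /u scaler_sumr -big_split /=.
    by apply: eq_bigr => k _; rewrite itlin.
  exact: (cvgD (cvgZl_tmp (k := a) (Fu f)) (Fu g)).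
(* Splitting off the first term and pulling [B] out on the left here, on the right in [uS'], yields
   the two one-sided inverses in the limit. *)
have uS f n : u f n.+1 = f + B (u f n).
  rewrite /u big_ord_recl /= linear_sum; congr (_ + _).
have uS' f n : u f n.+1 = f + u (B f) n.
  rewrite /u big_ord_recl /=; congr (_ + _); apply: eq_bigr => k _.
  by rewrite -iterSr.
have eqn f : F f = f + B (F f).
  apply: (@rnorm_cvg_unique _ _ _ \oo (fun n => u f n.+1)); first by rewrite cvg_shiftS; exact: Fu.
  rewrite (eq_cvg _ _ (uS f)); apply: cvgD; first exact: cvg_cst.
  exact: bop_cvg.
have eqn' f : F f = f + F (B f).
  apply: (@rnorm_cvg_unique _ _ _ \oo (fun n => u f n.+1)); first by rewrite cvg_shiftS; exact: Fu.
  by rewrite (eq_cvg _ _ (uS' f)); apply: cvgD; first exact: cvg_cst.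
exists (bounded_bop lF Fb); split => //= f.
- by rewrite {1}eqn addrK.
- have -> : f - B f = -1 *: B f + f by rewrite scaleN1r addrC.
  by rewrite lF scaleN1r {1}(eqn' f) addrC addrK.
Qed.

(* Sokal's gliding hump: one of [f + h] and [f - h] does at least as well as
   [h], so each operator can be made large without moving far. *)
Lemma uniform_boundedness (T : nat -> boundedOp E) :
  (forall f, exists c : R, forall n, rnorm (T n f) <= c) ->
  exists c : R, forall n, rnorm (T n) <= c.
Proof.
move=> pb; apply: contrapT => nb.
have big (c : R) : exists n, c < rnorm (T n).
  apply: contrapT => nc; apply: nb; exists c => n.
  by rewrite leNgt; apply/negP => cn; apply: nc; exists n.
have witness n (c : R) : 0 <= c -> c < rnorm (T n) ->
    exists h : E, rnorm h <= 1 /\ c < rnorm (T n h).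
  move=> c0 cn; apply: contrapT => nh; move: cn; rewrite ltNge => /negP; apply.
  have -> : rnorm (T n) = sup_on [set f : E | `|f| <= 1] (fun f => rnorm (T n f)) by [].
  apply: sup_on_le => // f /=; rewrite rnormE -[1]/(1%:C) lecR => f1.
  by rewrite leNgt; apply/negP => cf; apply: nh; exists f.
have step (k : nat) (f : E) : exists p : nat * E,
    rnorm (p.2 - f) <= 4^-1 ^+ k /\
    4^-1 ^+ k * rnorm (T p.1) * (3 / 4) <= rnorm (T p.1 p.2) /\
    4 ^+ k * k%:R < rnorm (T p.1).
  have [n nk] := big (4 ^+ k * k%:R).
  have Tn0 : 0 < rnorm (T n) by apply: le_lt_trans nk; rewrite mulr_ge0// exprn_ge0.
  have [h [h1 hT]] : exists h : E, rnorm h <= 1 /\ rnorm (T n) * (3 / 4) < rnorm (T n h).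
    apply: witness; first by rewrite mulr_ge0// ltW.
    lra.
  pose d := (4^-1 ^+ k : R)%:C *: h.
  have d1 : rnorm d <= 4^-1 ^+ k.
    rewrite /d rnormZR ger0_norm ?exprn_ge0 ?invr_ge0// ler_piMr// exprn_ge0 ?invr_ge0//.
  have dT : 4^-1 ^+ k * (rnorm (T n) * (3 / 4)) <= rnorm (T n d).
    rewrite /d linearZ rnormZR ger0_norm ?exprn_ge0 ?invr_ge0//.
    by rewrite ler_wpM2l ?exprn_ge0 ?invr_ge0// ltW.
  have [le|/ltW le] := lerP (rnorm (T n d)) (rnorm (T n (f + d))).
    exists (n, f + d) => /=; split; first by rewrite addrC addKr.
    by split => //; rewrite -mulrA; exact: le_trans dT le.
  exists (n, f - d) => /=; split; first by rewrite addrC addKr rnormN.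
  split => //; rewrite -mulrA; apply: le_trans dT _.
  have := rnormB (T n (f + d)) (T n (f - d)); rewrite -linearB.
  have -> : f + d - (f - d) = (2 : R)%:C *: d.
    by rewrite opprB addrC addrA subrK rmorph_nat scaler_nat mulr2n.
  rewrite linearZ rnormZR gtr0_norm//; lra.
pose nx k f := sval (cid (step k f)); have nxP k f := svalP (cid (step k f)).
pose x := fix x k := if k is k'.+1 then (nx k' (x k')).2 else (0 : E).
pose m k := (nx k (x k)).1.
have xS k : rnorm (x k.+1 - x k) <= 1 * 4^-1 ^+ k.
  by rewrite mul1r; have [] := nxP k (x k).
have xT k : 4^-1 ^+ k * rnorm (T (m k)) * (3 / 4) <= rnorm (T (m k) (x k.+1)).
  by have [_ []] := nxP k (x k).
have mT k : 4 ^+ k * k%:R < rnorm (T (m k)).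
  by have [_ []] := nxP k (x k).
have [||l xl le] := fast_cauchy_cvg ler01 _ _ xS; rewrite ?invr_ge0//.
  by rewrite lef_pV2 ?posrE// ler_nat.
have [c cT] := pb l.
(* All later moves shift the point by at most [2 * 4^-1 ^+ k.+1], which costs 1/2 of
   [4^-1 ^+ k * rnorm (T (m k))] out of the 3/4 gained in step [k]. The remaining quarter is at
   least [k / 4]. *)
have key k : k%:R * 4^-1 <= rnorm (T (m k) l).
  have A := rnorm_le_dist (T (m k) (x k.+1)) (T (m k) l).
  have B : rnorm (T (m k) (x k.+1) - T (m k) l) <= rnorm (T (m k)) * (2 * 1 * 4^-1 ^+ k.+1).
    rewrite -linearB; apply: le_trans (rnorm_bop _ _) _.
    by rewrite ler_wpM2l ?rnorm_ge0// rnorm_distC.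
  have D := xT k; have F := mT k.
  have G : k%:R <= 4^-1 ^+ k * rnorm (T (m k)).
    rewrite exprVn ler_pdivlMl ?exprn_gt0//; exact: ltW.
  rewrite exprS in B.
  move: A B D G; set a := 4^-1 ^+ k; set b := rnorm (T (m k)).
  set c1 := rnorm (T (m k) (x k.+1)); set c2 := rnorm (T (m k) l).
  set c3 := rnorm _; lra.
have /(_ (Num.truncn (4 * `|c|)).+1) := key; apply/negP; rewrite -ltNge.
apply: le_lt_trans (cT _) _.
rewrite ltr_pdivlMr//; apply: le_lt_trans (truncnS_gt _); rewrite mulrC ler_wpM2l//.
exact: ler_norm.
Qed.

End completeness.

(** * Completeness of [C(K)] in the supremum norm *)

Section Cspace_complete.
Variables (R : realType) (K : topologicalType) (cK : compact [set: K]).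
Local Notation C := R[i].
Local Notation CK := (Cspace R cK).

Lemma rnorm_Cval (f : CK) x : rnorm (Cval f x) <= rnorm f.
Proof. exact: Cnorm_ge. Qed.

Lemma rnorm_le_Cval (f : CK) c : 0 <= c -> (forall x, rnorm (Cval f x) <= c) -> rnorm f <= c.
Proof.
move=> c0 fc; have -> : rnorm f = sup_on [set: K] (fun x => rnorm (Cval f x)) by [].
by apply: sup_on_le.
Qed.

Lemma CvalD (f g : CK) x : Cval (f + g) x = Cval f x + Cval g x. Proof. by []. Qed.
Lemma CvalN (f : CK) x : Cval (- f) x = - Cval f x. Proof. by []. Qed.
Lemma CvalB (f g : CK) x : Cval (f - g) x = Cval f x - Cval g x. Proof. by []. Qed.
Lemma CvalZ z (f : CK) x : Cval (z *: f) x = z * Cval f x. Proof. by []. Qed.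
Lemma Cval0 x : Cval (0 : CK) x = 0. Proof. by []. Qed.

(** Real and imaginary parts converge pointwise by completeness of [R]. The Cauchy estimate does not
    depend on the point, so the convergence is uniform and the limit is continuous. *)
Lemma Cspace_cvg (F : set_system CK) : ProperFilter F -> cauchy F -> cvg F.
Proof.
move=> FF /cauchy_ballP Fc.
have close (e : R) : 0 < e -> exists2 f0 : CK, True & \forall f \near F, rnorm (f0 - f) <= e.
  move=> e0; have eC : 0 < e%:C :> C by rewrite ltcR.
  have := Fc _ eC; rewrite near_simpl => -[[A B] /= [FA FB] AB].
  have [f0 Af0] := filter_ex FA.
  exists f0 => //; apply: filterS FB => g Bg.
  by have := AB (f0, g) (conj Af0 Bg); rewrite -ball_normE /= rnormE ltcR => /ltW.
have ex (part : C -> R) : (forall a : C, `|part a| <= rnorm (a : C^o)) ->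
    (forall a b, part (a - b) = part a - part b) ->
    exists l : K -> R, forall e : R, 0 < e ->
      \forall f \near F, forall x, `|l x - part (Cval f x)| <= e.
  move=> part1 partB.
  have near_part (e : R) : 0 < e -> exists f0 : CK,
      \forall f \near F, forall x, `|part (Cval f0 x) - part (Cval f x)| <= e.
    move=> e0; have [f0 _ f0F] := close _ e0; exists f0; apply: filterS f0F => f fe x.
    by rewrite -partB; apply: le_trans (part1 _) (le_trans _ fe); exact: (rnorm_Cval (f0 - f) x).
  have cvx x : cvg (part (Cval f x) @[f --> F]).
    apply/cauchy_cvgP/cauchy_exP => e e0.
    have [f0 f0F] := near_part (e / 2) (divr_gt0 e0 (ltr0Sn _ 1)).
    exists (part (Cval f0 x)); apply: filterS f0F => f /(_ x) fe.
    by rewrite /ball /=; apply: le_lt_trans fe _; lra.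
  exists (fun x => lim (part (Cval f x) @[f --> F])) => e e0.
  have [f0 f0F] := near_part (e / 2) (divr_gt0 e0 (ltr0Sn _ 1)).
  have lf0 x : `|lim (part (Cval f x) @[f --> F]) - part (Cval f0 x)| <= e / 2.
    apply/ler_addgt0Pr => d d0.
    have /cvgrPdist_le/(_ _ d0) lx : part (Cval f x) @[f --> F] --> lim (part (Cval f x) @[f --> F]).
      exact: cvx.
    have [f [fd fe]] := filter_ex (filterI lx f0F).
    apply: le_trans (ler_distD (part (Cval f x)) _ _) _; rewrite addrC lerD//.
    by rewrite distrC.
  apply: filterS f0F => f fe x.
  apply: le_trans (ler_distD (part (Cval f0 x)) _ _) _.
  by have := lf0 x; have := fe x; lra.
have [l1 l1F] := ex (@complex.Re R) (@Re_le_cmod R) (fun a b => raddfB (@complex.Re R) a b).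
have [l2 l2F] := ex (@complex.Im R) (@Im_le_cmod R) (fun a b => raddfB (@complex.Im R) a b).
pose L x : C := l1 x +i* l2 x.
have LF (e : R) : 0 < e -> \forall f \near F, forall x, rnorm (L x - Cval f x : C^o) <= e.
  move=> e0; have e2 : 0 < e / 2 by rewrite divr_gt0.
  apply: filterS2 (l1F _ e2) (l2F _ e2) => f f1 f2 x.
  apply: le_trans (cmod_le _) _; rewrite !raddfB /=.
  by have := f1 x; have := f2 x; lra.
have Lc : continuous (L : K -> C^o).
  move=> x; apply/cvg_rnormP => e e0; have e3 : 0 < e / 3 by rewrite divr_gt0.
  have [f fL] := filter_ex (LF _ e3).
  have /cvg_rnormP/(_ _ e3) := @Cval_continuous _ _ _ f x.
  apply: filterS => y fxy.
  apply: le_trans (rnorm_triangle (_ : C^o) (Cval f x) _) _.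
  have A := rnorm_triangle (Cval f x) (Cval f y) (L y : C^o).
  have B := fL x; have D := fL y; rewrite rnorm_distC in D.
  by apply: le_trans (lerD B A) _; move: fxy D; lra.
apply/cvg_ex; exists (mkcts Lc : CK); apply/cvg_rnormP => e e0.
apply: filterS (LF _ e0) => f fe; apply: rnorm_le_Cval; first exact: ltW.
exact: fe.
Qed.

HB.instance Definition _ := Uniform_isComplete.Build CK Cspace_cvg.

End Cspace_complete.

(** * Right derivatives and mean value inequalities *)

Section right_derivative.
Variable R : realType.
Local Notation C := R[i].

Lemma near_right0P (P : R -> Prop) :
  (\forall h \near 0^'+, P h) <-> exists2 d : R, 0 < d & forall h, 0 < h < d -> P h.
Proof.
split=> [[d /= d0 dP]|[d d0 dP]].
  exists d => // h /andP[h0 hd]; apply: dP => //=.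
  by rewrite /ball /= sub0r normrN gtr0_norm.
exists d => //= h /=; rewrite /ball /= sub0r normrN => hd h0.
by apply: dP; rewrite h0 -(gtr0_norm h0).
Qed.

(** For a slope [e > 0], the set of times where [phi t <= phi a + e * (t - a)] contains its supremum
    by continuity, and the right-hand bound carries it past any supremum short of [b]. Then [e]
    tends to 0. *)
Lemma dini_le (phi : R -> R) (a b : R) : a <= b ->
  (forall t, a < t <= b -> {for t, continuous phi}) ->
  (forall t, a <= t < b -> forall e, 0 < e ->
     \forall h \near 0^'+, phi (t + h) <= phi t + e * h) ->
  phi b <= phi a.
Proof.
move=> ab phic phid; apply/ler_addgt0Pr => e' e'0.
pose e := e' / (b - a + 1).
have ba1 : 0 < b - a + 1 by lra.
have e0 : 0 < e by rewrite divr_gt0.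
suff : phi b <= phi a + e * (b - a).
  move=> /le_trans; apply; rewrite lerD2l /e mulrAC ler_pdivrMr// ler_wpM2l ?ltW//; lra.
pose S := [set t | a <= t <= b /\ phi t <= phi a + e * (t - a)].
have Sa : S a by split; [rewrite lexx ab|rewrite subrr mulr0 addr0].
have Sub : has_ubound S by exists b => t [/andP[]].
have supS : has_sup S by split => //; exists a.
pose c := sup S.
have ac : a <= c by exact: ub_le_sup.
have cb : c <= b by apply: ge_sup; [exists a|move=> t [/andP[]]].
have Sc : S c.
  split; first by rewrite ac cb.
  rewrite leNgt; apply/negP => cgt.
  have ca : a < c.
    rewrite lt_neqAle ac andbT; apply: contraTneq cgt => <-.
    by rewrite subrr mulr0 addr0 ltxx.
  pose g t := phi t - (phi a + e * (t - a)).
  have gc : g t @[t --> c] --> g c.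
    apply: cvgB; first by apply: phic; rewrite ca cb.
    apply: cvgD; first exact: cvg_cst.
    by apply: cvgM; [exact: cvg_cst|apply: cvgB; [exact: cvg_id|exact: cvg_cst]].
  have gc0 : 0 < g c by rewrite subr_gt0.
  have /cvgrPdist_lt/(_ _ gc0) := gc; move=> [d /= d0 dP].
  have [t St tc] := sup_adherent d0 supS.
  have tc' : t <= c by exact: ub_le_sup.
  have := dP t; rewrite /ball /= ger0_norm ?subr_ge0// => /(_ _).
  have -> : c - t < d by rewrite -/c in tc; lra.
  move=> /(_ isT) /(le_lt_trans (ler_norm _)).
  by case: St => _; rewrite /g; lra.
have [bc|cb'] := leP b c.
  by have -> : b = c by [lra]; case: Sc.
have /near_right0P[d d0 dP] := phid c (introT andP (conj ac cb')) e e0.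
pose h := Num.min (d / 2) (b - c).
have h0 : 0 < h by rewrite lt_min divr_gt0//= subr_gt0.
have hd : h < d by rewrite gt_min; apply/orP; left; lra.
have hb : h <= b - c by rewrite ge_min lexx orbT.
have := dP h (introT andP (conj h0 hd)) => ch.
have : S (c + h).
  split; first by apply/andP; split; lra.
  case: Sc => _; lra.
move=> /(ub_le_sup Sub); rewrite -/c; lra.
Qed.

Lemma mean_value_le (V : normedModType C) (u : R -> V) (g : R -> R) (a b : R) :
  a <= b ->
  (forall t, a < t <= b -> {for t, continuous u}) ->
  (forall t, a < t <= b -> {for t, continuous g}) ->
  (forall t, a <= t < b -> forall e, 0 < e -> \forall h \near 0^'+,
     rnorm (u (t + h) - u t) <= g (t + h) - g t + e * h) ->
  rnorm (u b - u a) <= g b - g a.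
Proof.
move=> ab uc gc ug.
pose phi t := rnorm (u t - u a) - g t.
suff : phi b <= phi a by rewrite /phi subrr rnorm0; lra.
apply: dini_le => // t tab.
  apply: cvgB; last exact: gc.
  apply: cvg_rnorm; apply: cvgB; [exact: uc|exact: cvg_cst].
move=> e e0; apply: filterS (ug t tab e e0) => h uh; rewrite /phi.
have := rnorm_triangle (u (t + h)) (u t) (u a); lra.
Qed.

(** One-sided because a generator is a limit at [0^'+]; together with continuity, right derivatives
    already give mean value inequalities. The division-free form is the one that these inequalities
    consume. *)
Definition rderiv (V : normedModType C) (u : R -> V) (t : R) (v : V) :=
  forall e : R, 0 < e ->
  \forall h \near 0^'+, rnorm (u (t + h) - u t - h%:C *: v) <= e * h.

Lemma mean_value_const (V : normedModType C) (u u' : R -> V) (c a b : R) :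
  a <= b ->
  (forall t, a < t <= b -> {for t, continuous u}) ->
  (forall t, a <= t < b -> rderiv u t (u' t)) ->
  (forall t, a <= t < b -> rnorm (u' t) <= c) ->
  rnorm (u b - u a) <= c * (b - a).
Proof.
move=> ab uc uu' u'c; have -> : c * (b - a) = c * b - c * a by ring.
apply: (mean_value_le (g := fun t => c * t)) => //.
  by move=> t _; apply: cvgM; [exact: cvg_cst|exact: cvg_id].
move=> t tab e e0; apply: filterS2 (nbhs_right_gt 0) (uu' t tab e e0) => h h0 uh.
have -> : c * (t + h) - c * t = c * h by ring.
apply: le_trans (rnorm_le_dist _ (h%:C *: u' t)) _; apply: lerD => //.
by rewrite rnormZR gtr0_norm// mulrC ler_wpM2r ?u'c// ltW.
Qed.

Lemma rderiv0_const (V : normedModType C) (u : R -> V) (a b : R) : a <= b ->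
  (forall t, a < t <= b -> {for t, continuous u}) ->
  (forall t, a <= t < b -> rderiv u t 0) -> u b = u a.
Proof.
move=> ab uc u0; apply/eqP; rewrite -subr_eq0; apply/eqP/rnorm_eq0 => e e0.
apply: le_trans (ltW e0).
have := mean_value_const (u' := fun=> 0) (c := 0) ab uc u0.
by rewrite mul0r; apply => t _; rewrite rnorm0.
Qed.

Section rules.
Variable V : normedModType C.
Implicit Types (u : R -> V) (t : R).

Lemma rderivP u t v :
  rderiv u t v <-> (h^-1)%:C *: (u (t + h) - u t) @[h --> 0^'+] --> v.
Proof.
have eqn h : 0 < h -> rnorm (v - (h^-1)%:C *: (u (t + h) - u t)) =
    h^-1 * rnorm (u (t + h) - u t - h%:C *: v).
  move=> h0; rewrite rnorm_distC -[X in rnorm (_ - X)]scale1r.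
  have -> : (1 : C) = h^-1%:C * h%:C by rewrite -rmorphM mulVf ?gt_eqF.
  by rewrite -scalerA -scalerBr rnormZR gtr0_norm// invr_gt0.
split=> [uv|/cvg_rnormP uv e e0].
  apply/cvg_rnormP => e e0; apply: filterS2 (nbhs_right_gt 0) (uv e e0) => h h0 uh.
  by rewrite eqn// ler_pdivrMl// mulrC.
apply: filterS2 (nbhs_right_gt 0) (uv e e0) => h h0.
by rewrite eqn// ler_pdivrMl// mulrC.
Qed.

Lemma rderiv_ext u (v : R -> V) t w : u =1 v -> rderiv u t w -> rderiv v t w.
Proof. by move=> /funext ->. Qed.

Lemma rderiv_cst (v : V) t : rderiv (fun=> v) t 0.
Proof.
move=> e e0; apply: filterS (nbhs_right_gt 0) => h h0.
by rewrite subrr scaler0 subr0 rnorm0 mulr_ge0// ltW.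
Qed.

Lemma rderivD u (v : R -> V) t (u' v' : V) : rderiv u t u' -> rderiv v t v' ->
  rderiv (fun s => u s + v s) t (u' + v').
Proof.
move=> uu vv e e0; have e2 : 0 < e / 2 by rewrite divr_gt0.
apply: filterS2 (uu _ e2) (vv _ e2) => h A B.
have -> : u (t + h) + v (t + h) - (u t + v t) - h%:C *: (u' + v') =
  (u (t + h) - u t - h%:C *: u') + (v (t + h) - v t - h%:C *: v').
  by rewrite scalerDr !opprD (addrACA (u (t + h))) [LHS]addrACA.
by apply: le_trans (rnormD _ _) _; lra.
Qed.

Lemma rderiv_bound u t v : rderiv u t v -> exists2 d : R, 0 < d &
  forall h, 0 < h < d -> rnorm (u (t + h) - u t) <= (rnorm v + 1) * h.
Proof.
move=> /(_ 1 ltr01)/near_right0P[d d0 uv]; exists d => // h hd; have := uv h hd.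
move: hd => /andP[h0 _].
have := rnorm_le_dist (u (t + h) - u t) (h%:C *: v); rewrite rnormZR gtr0_norm//; lra.
Qed.

Lemma rderiv_right_cvg u t v : rderiv u t v -> u (t + h) @[h --> 0^'+] --> u t.
Proof.
move=> /rderiv_bound[d d0 uv]; apply/cvg_rnormP => e e0.
have v1 : 0 < rnorm v + 1 by have := rnorm_ge0 v; lra.
apply/near_right0P; exists (Num.min d (e / (rnorm v + 1))).
  by rewrite lt_min d0 divr_gt0.
move=> h /andP[h0]; rewrite lt_min => /andP[hd he].
rewrite rnorm_distC; apply: le_trans (uv h _) _; first by rewrite h0 hd.
by rewrite mulrC -ler_pdivlMr// ltW.
Qed.

Lemma mean_value_dist u (u' : R -> V) (v : V) (c a b : R) : a <= b ->
  (forall t, a < t <= b -> {for t, continuous u}) ->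
  (forall t, a <= t < b -> rderiv u t (u' t)) ->
  (forall t, a <= t < b -> rnorm (u' t - v) <= c) ->
  rnorm (u b - u a - (b - a)%:C *: v) <= c * (b - a).
Proof.
move=> ab uc uu u'c.
have -> : u b - u a - (b - a)%:C *: v = u b + b%:C *: - v - (u a + a%:C *: - v).
  by rewrite !scalerN rmorphB scalerBl !opprD !opprK addrACA.
apply: (@mean_value_const _ (fun t => u t + t%:C *: - v) (fun t => u' t - v)) => // [t tab|t tab].
  apply: cvgD; first exact: uc.
  apply: (@cvgZr_tmp _ _ _ _ _ (fun t : R => (t%:C : C)) t%:C).
  apply/cvg_rnormP => e e0; exists e => //= s st; rewrite -rmorphB cmod_real.
  exact: ltW.
apply: rderivD; first exact: uu.
move=> e e0; apply: filterS (nbhs_right_gt 0) => h h0.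
by rewrite -scalerBl -rmorphB /= [t + h]addrC addrK subrr rnorm0 mulr_ge0// ltW.
Qed.

End rules.

Section rules_scale.
Variable V : normedModType C.
Implicit Types (u : R -> V) (t : R).

Lemma rderivZ (c : R -> C^o) u t (c' : C) (u' : V) : rderiv c t c' -> rderiv u t u' ->
  rderiv (fun s => c s *: u s) t (c' *: u t + c t *: u').
Proof.
move=> cc uu; have cR := rderiv_right_cvg cc; move: cc uu => /rderivP cc /rderivP uu.
apply/rderivP.
have -> : (fun h => (h^-1)%:C *: (c (t + h) *: u (t + h) - c t *: u t)) =
  (fun h => ((h^-1)%:C * ((c (t + h) : C) - (c t : C))) *: u t +
            c (t + h) *: ((h^-1)%:C *: (u (t + h) - u t))).
  apply/funext => h; rewrite -[in RHS]scalerA.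
  rewrite [X in _ = _ + X]scalerA [X in _ = _ + X *: _]mulrC -[X in _ = _ + X]scalerA.
  rewrite -scalerDr; congr (_ *: _).
  by rewrite scalerBl scalerBr [RHS]addrC addrA subrK.
apply: cvgD; first exact: (cvgZr_tmp (a := u t) cc).
exact: (cvgZ cR uu).
Qed.

Lemma rderivZl (z : C) u t (u' : V) : rderiv u t u' -> rderiv (fun s => z *: u s) t (z *: u').
Proof.
move=> uu; have := rderivZ (rderiv_cst (z : C^o) t) uu.
by rewrite scale0r add0r.
Qed.

Lemma rderiv_shift u t c v : rderiv u (t + c) v -> rderiv (fun s => u (s + c)) t v.
Proof. by move=> uv e /uv; apply: filterS => h; rewrite (addrAC t). Qed.

Lemma rderiv_bop (W : normedModType C) (S : V -> W) (c : R) u t v :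
  (forall f g, S (f - g) = S f - S g) -> (forall z f, S (z *: f) = z *: S f) ->
  (forall f, rnorm (S f) <= c * rnorm f) ->
  rderiv u t v -> rderiv (fun s => S (u s)) t (S v).
Proof.
move=> SB SZ Sc uv e e0.
have c1 : 0 < `|c| + 1 by have := normr_ge0 c; lra.
have : 0 < e / (`|c| + 1) by rewrite divr_gt0.
move=> /uv; apply: filterS => h; rewrite -SZ -!SB mulrAC ler_pdivlMr// => uh.
apply: le_trans (Sc _) (le_trans _ uh); rewrite mulrC ler_wpM2l ?rnorm_ge0//.
by have := ler_norm c; lra.
Qed.

End rules_scale.
End right_derivative.

Section scalar_primitive.
Variable R : realType.
Local Notation C := R[i].

Lemma derive_right (f : R -> R) (t df : R) : is_derive t 1 f df ->
  forall e, 0 < e -> \forall h \near 0^'+, `|f (t + h) - f t - h * df| <= e * h.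
Proof.
move=> fdf e e0.
have /cvgrPdist_le/(_ _ e0) : h^-1 *: (f (h *: 1 + t) - f t) @[h --> 0^'] --> df.
  by rewrite -(@derive_val _ _ _ _ _ _ _ fdf); have [] := fdf.
move=> [d /= d0 dP]; exists d => //= h; rewrite /ball /= => hd h0.
have := dP h hd (lt0r_neq0 h0).
rewrite (_ : h *: 1 + t = t + h); last by rewrite /GRing.scale /= mulr1 addrC.
have -> : df - h^-1 *: (f (t + h) - f t) = - (h^-1 * (f (t + h) - f t - h * df)).
  by rewrite /GRing.scale /=; field; exact: lt0r_neq0.
by rewrite normrN normrM gtr0_norm ?invr_gt0// ler_pdivrMl// (mulrC h e).
Qed.

Lemma max_continuous (a : R) : continuous (Num.max a).
Proof.
move=> t; apply/cvgrPdist_le => e e0; exists e => //= s; rewrite /ball /= => se.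
apply: le_trans (ltW se); rewrite ler_norml.
have := ler_norm (t - s); have := ler_norm (s - t); rewrite distrC.
by move=> A B; apply/andP; case: (leP a t); case: (leP a s); split; lra.
Qed.

Lemma real_primitive (f : R -> R) (a : R) : continuous f ->
  exists F : R -> R, [/\ continuous F, F a = 0 & forall t, a <= t -> forall e, 0 < e ->
    \forall h \near 0^'+, `|F (t + h) - F t - h * f t| <= e * h].
Proof.
move=> fc; pose G x := (\int[lebesgue_measure]_(t in [set` `[a - 1, x]]) f t)%R.
have Gd t : a <= t -> is_derive t 1 G (f t).
  move=> at_; have fi : lebesgue_measure.-integrable `[a - 1, t + 1] (EFin \o f).
    apply: continuous_compact_integrable; first exact: segment_compact.
    exact: continuous_subspaceT.
  have tt : t < t + 1 by rewrite ltrDl.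
  have at1 : a - 1 < t by lra.
  have [Gt Gt'] := continuous_FTC1_closed tt fi at1 (fc t).
  by split; [exact: Gt|rewrite -derive1E; exact: Gt'].
exists (fun t => G (Num.max a t) - G a); split.
- move=> t; apply: cvgB; last exact: cvg_cst.
  apply: (@cvg_comp _ _ _ (Num.max a) G _ (nbhs (Num.max a t))).
    exact: max_continuous.
  apply: differentiable_continuous; apply/derivable1_diffP.
  by have [] := Gd (Num.max a t) _; rewrite ?le_max ?lexx.
- by rewrite maxxx subrr.
- move=> t at_ e e0; apply: filterS2 (nbhs_right_gt 0) (derive_right (Gd t at_) e0) => h h0.
  have ath : a <= t + h by lra.
  by rewrite !max_r// opprB addrA subrK.
Qed.

Lemma scalar_primitive (f : R -> C^o) (a : R) : continuous f ->
  exists F : R -> C^o, [/\ continuous F, F a = 0 & forall t, a <= t -> rderiv F t (f t)].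
Proof.
move=> fc.
have fpart (part : C -> R) : (forall a : C, `|part a| <= rnorm (a : C^o)) ->
    (forall a b, part (a - b) = part a - part b) -> continuous (fun t => part (f t)).
  move=> part1 partB t; apply/cvgrPdist_le => e e0.
  have /cvg_rnormP/(_ _ e0) := fc t; apply: filterS => s.
  by rewrite -partB; apply: le_trans; exact: part1.
have [F1 [F1c F1a F1d]] := real_primitive a (fpart _ (@Re_le_cmod R) (fun a b => raddfB (@complex.Re R) a b)).
have [F2 [F2c F2a F2d]] := real_primitive a (fpart _ (@Im_le_cmod R) (fun a b => raddfB (@complex.Im R) a b)).
exists (fun t => F1 t +i* F2 t); split; last 1 first.
- move=> t at_ e e0; have e2 : 0 < e / 2 by rewrite divr_gt0.
  apply: filterS2 (F1d t at_ _ e2) (F2d t at_ _ e2) => h A B.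
  apply: le_trans (cmod_le _) _.
  move: A B; case: (f t) => p q /=; rewrite !mul0r subr0 addr0; lra.
- move=> t; apply/cvg_rnormP => e e0; have e2 : 0 < e / 2 by rewrite divr_gt0.
  have /cvgrPdist_le/(_ _ e2) A := F1c t; have /cvgrPdist_le/(_ _ e2) B := F2c t.
  apply: filterS2 A B => s A B; apply: le_trans (cmod_le _) _ => /=; lra.
- by rewrite F1a F2a.
Qed.

End scalar_primitive.

Section complex_exponential.
Variable R : realType.
Local Notation C := R[i].

Definition cexp (z : C) : C :=
  (expR (complex.Re z))%:C * (cos (complex.Im z) +i* sin (complex.Im z)).

Lemma cexp0 : cexp 0 = 1.
Proof. by rewrite /cexp /= expR0 cos0 sin0 mul1r. Qed.

Lemma cexpD z w : cexp (z + w) = cexp z * cexp w.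
Proof.
case: z => a b; case: w => c d; rewrite /cexp /= expRD cosD sinD.
by apply/eqP; rewrite eq_complex /=; apply/andP; split; apply/eqP; ring.
Qed.

Lemma cexp_real (r : R) : cexp r%:C = (expR r)%:C.
Proof. by rewrite /cexp /= cos0 sin0 mulr1. Qed.

Lemma cmod_cexp z : rnorm (cexp z : C^o) = expR (complex.Re z).
Proof.
rewrite /cexp cmodM cmod_real ger0_norm ?expR_ge0// /rnorm normc_def /=.
by rewrite cos2Dsin2 sqrtr1 mulr1.
Qed.

Lemma cexp_rderiv (z : C) t : rderiv (fun s => cexp (s%:C * z) : C^o) t (z * cexp (t%:C * z)).
Proof.
suff at0 : rderiv (fun s => cexp (s%:C * z) : C^o) 0 z.
  have /rderivP A := at0; apply/rderivP.
  have -> : (fun h => (h^-1)%:C *: ((cexp ((t + h)%:C * z) : C^o) - cexp (t%:C * z))) =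
      (fun h => ((h^-1)%:C *: ((cexp ((0 + h)%:C * z) : C^o) - cexp (0%:C * z))) *: (cexp (t%:C * z) : C^o)).
    apply/funext => h; rewrite mul0r cexp0 add0r rmorphD /= mulrDl cexpD /GRing.scale /=.
    by ring.
  exact: (cvgZr_tmp (a := cexp (t%:C * z) : C^o) A).
case: z => a b e e0; have e2 : 0 < e / 2 by rewrite divr_gt0.
have d1 : is_derive (0 : R) 1 (fun s => expR (s * a) * cos (s * b)) a.
  apply: is_derive_eq; rewrite !mul0r expR0 cos0 sin0 /GRing.scale /=; ring.
have d2 : is_derive (0 : R) 1 (fun s => expR (s * a) * sin (s * b)) b.
  apply: is_derive_eq; rewrite !mul0r expR0 cos0 sin0 /GRing.scale /=; ring.
apply: filterS2 (derive_right d1 e2) (derive_right d2 e2) => h.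
rewrite add0r !mul0r expR0 cos0 sin0 => A B; apply: le_trans (cmod_le _) _.
move: A B; rewrite /cexp /= !mul0r !subr0 !addr0 expR0 cos0 sin0 !mulr1 ?mulr0 ?subr0 ?addr0; lra.
Qed.

End complex_exponential.

(** * Integration of vector-valued functions *)

Section vint.
Variables (R : realType) (K : topologicalType) (cK : compact [set: K]).
Local Notation C := R[i].
Local Notation CK := (Cspace R cK).
Implicit Types (u : R -> CK) (a b t : R).

Lemma Cval_cvg (T : Type) (F : set_system T) {FF : Filter F} (f : T -> CK) (l : CK) x :
  f @ F --> l -> Cval (f y) x @[y --> F] --> Cval l x.
Proof.
move=> /cvg_rnormP fl; apply/cvg_rnormP => e /fl; apply: filterS => y.
by apply: le_trans; exact: (rnorm_Cval (l - f y) x).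
Qed.

Lemma rderiv_Cval u t (v : CK) x : rderiv u t v -> rderiv (fun s => Cval (u s) x) t (Cval v x).
Proof.
move=> uv e /uv; apply: filterS => h; apply: le_trans.
exact: (rnorm_Cval (u (t + h) - u t - h%:C *: v) x).
Qed.

Lemma right_uniform u t (e : R) : continuous u -> 0 < e ->
  exists2 d : R, 0 < d & forall s, `|s - t| < d -> rnorm (u s - u t) <= e.
Proof.
move=> uc e0; have /cvg_rnormP/(_ _ e0)[d /= d0 dP] := uc t.
by exists d => // s st; rewrite rnorm_distC; apply: dP; rewrite /ball /= distrC.
Qed.

(** The primitive is assembled from scalar primitives [V x], one for each point. The mean value
    bounds [Vlip] have constants independent of [x], so they become bounds in the supremum norm. *)
Lemma primitive_ex u a : continuous u ->
  exists U : R -> CK, [/\ continuous U, U a = 0 & forall t, a <= t -> rderiv U t (u t)].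
Proof.
move=> uc.
have ucx x : continuous (fun t => Cval (u t) x) by move=> t; apply: Cval_cvg; exact: uc.
pose V x := sval (cid (scalar_primitive a (ucx x))).
have [Vc Va Vd] : [/\ forall x, continuous (V x), forall x, V x a = 0 &
    forall x t, a <= t -> rderiv (V x) t (Cval (u t) x)].
  by split=> x; rewrite /V; case: cid => W [].
have Vlip x b c (k : R) (w : C^o) : a <= b -> b <= c ->
    (forall t, b <= t < c -> rnorm (Cval (u t) x - w) <= k) ->
    rnorm (V x c - V x b - (c - b)%:C *: w) <= k * (c - b).
  move=> ab bc uk; apply: (mean_value_dist (u' := fun t => Cval (u t) x)) => // [t _|t /andP[bt _]].
    exact: Vc.
  by apply: Vd; exact: le_trans bt.
have Uc t : continuous (fun x => V x (Num.max a t) : C^o).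
  move=> x; set m := Num.max a t; have am : a <= m by rewrite le_max lexx.
  apply/cvg_rnormP => e e0; pose d := e / (m - a + 1).
  have ma : 0 < m - a + 1 by lra.
  have d0 : 0 < d by rewrite divr_gt0.
  have d2 : 0 < d / 2 by rewrite divr_gt0.
  have d4 : 0 < d / 4 by rewrite divr_gt0.
  (* Compactness of the time interval yields one neighbourhood of [x] that serves all times;
     integrating a difference of at most [d = e / (m - a + 1)] over it gives at most [e]. *)
  have : \forall y \near x, `[a, m] `<=` [set s | rnorm (Cval (u s) x - Cval (u s) y) <= d].
    have := @segment_compact R a m; rewrite compact_near_coveringP => /(_ K (nbhs x)).
    apply => s _.
    have [r r0 rP] := right_uniform s uc d4.
    have /cvg_rnormP/(_ _ d2) := @Cval_continuous _ _ _ (u s) x.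
    move=> A; exists (ball s r, [set y | rnorm (Cval (u s) x - Cval (u s) y) <= d / 2]) => /=.
      by split => //; exists r.
    move=> [s' y] /= [/ball_sym ss' xy].
    have ss := rP s' ss'.
    have B := le_trans (rnorm_Cval (u s' - u s) x) ss.
    have D := le_trans (rnorm_Cval (u s' - u s) y) ss.
    apply: le_trans (rnorm_triangle (_ : C^o) (Cval (u s) x) _) _.
    have E := rnorm_triangle (Cval (u s) x) (Cval (u s) y) (Cval (u s') y).
    apply: le_trans (lerD B E) _; rewrite [rnorm (Cval (u s) y - _)]rnorm_distC.
    move: xy D; rewrite CvalB; lra.
  apply: filterS => y xy.
  have := @mean_value_const _ _ (fun t => V x t - V y t) (fun t => Cval (u t) x - Cval (u t) y) d a m am.
  rewrite !Va subrr subr0 => H; apply: (le_trans (H _ _ _)).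
  - by move=> s _; apply: cvgB; exact: Vc.
  - move=> s /andP[as_ _]; rewrite -scaleN1r; apply: rderivD; first exact: Vd.
    by apply: (rderiv_ext (u := fun s => -1 *: V y s)) => [r|]; [rewrite scaleN1r|apply: rderivZl; exact: Vd].
  - by move=> s /andP[as_ sm]; apply: xy; rewrite /= in_itv /= as_ ltW.
  rewrite /d mulrAC ler_pdivrMr// ler_wpM2l ?ltW//; lra.
pose U t : CK := mkcts (Uc t).
have Ulip b c k (w : CK) : a <= b -> b <= c ->
    (forall t, b <= t < c -> rnorm (u t - w) <= k) -> 0 <= k ->
    rnorm (U c - U b - (c - b)%:C *: w) <= k * (c - b).
  move=> ab bc uk k0; apply: rnorm_le_Cval => [|x]; first by rewrite mulr_ge0// subr_ge0.
  rewrite [Cval _ x](_ : _ = V x (Num.max a c) - V x (Num.max a b) - (c - b)%:C * Cval w x)//.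
  rewrite !max_r//; last exact: le_trans bc.
  apply: Vlip => // t tbc; apply: le_trans (uk t tbc); exact: (rnorm_Cval (u t - w)).
exists U; split.
- move=> t; have [r r0 rP] := right_uniform t uc ltr01.
  pose M := rnorm (u t) + 1; have M0 : 0 < M by have := rnorm_ge0 (u t); rewrite /M; lra.
  have UM b c : `|b - t| < r -> `|c - t| < r -> b <= c -> rnorm (U c - U b) <= M * (c - b).
    move=> bt ct bc.
    have Um s : U s = U (Num.max a s).
      apply: CvalP => x; change (V x (Num.max a s) = V x (Num.max a (Num.max a s))).
      by congr (V x _); rewrite [RHS]max_r// le_max lexx.
    have [ca|ac] := leP c a.
      rewrite (Um c) (Um b) !max_l//; last exact: le_trans ca.
      by rewrite subrr rnorm0 mulr_ge0// ?subr_ge0// ltW.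
    have b'c : Num.max a b <= c by rewrite ge_max ltW.
    have := @Ulip (Num.max a b) c M 0 _ b'c; rewrite scaler0 subr0 -Um => H.
    apply: (le_trans (H _ _ _)); rewrite ?le_max ?lexx//.
    + move=> s /andP[]; rewrite ge_max subr0 => /andP[as_ bs] sc.
      have := rP s; have -> : `|s - t| < r.
        move: bt ct; rewrite !ltr_norml => /andP[? ?] /andP[? ?]; apply/andP; split; lra.
      by move=> /(_ isT); have := rnorm_le_dist (u s) (u t); rewrite /M; lra.
    + exact: ltW.
    + by rewrite ler_wpM2l ?(ltW M0)// lerD2l lerN2 le_max lexx orbT.
  apply/cvg_rnormP => e e0; exists (Num.min r (e / M)) => /=.
    by rewrite lt_min r0 divr_gt0.
  move=> s; rewrite /ball /= lt_min => /andP[st se].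
  have tt : `|t - t| < r by rewrite subrr normr0.
  have := UM s t; have := UM t s; rewrite (distrC s) => A B.
  have [ts|/ltW ts] := leP t s.
    rewrite rnorm_distC; apply: le_trans (A tt st ts) _.
    by rewrite mulrC -ler_pdivlMr// ltW//; apply: le_lt_trans se; rewrite distrC ler_norm.
  apply: le_trans (B st tt ts) _.
  by rewrite mulrC -ler_pdivlMr// ltW//; apply: le_lt_trans se; rewrite ler_norm.
- by apply: CvalP => x; change (V x (Num.max a a) = 0); rewrite maxxx Va.
- move=> t at_ e e0; have [r r0 rP] := right_uniform t uc e0.
  apply/near_right0P; exists r => // h /andP[h0 hr].
  have := @Ulip t (t + h) e (u t) at_; rewrite [t + h - t]addrC addKr; apply => //.
  + lra.
  + by move=> s /andP[ts sh]; apply: rP; rewrite ger0_norm; lra.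
  + exact: ltW.
Qed.

Definition is_primitive a u (U : R -> CK) :=
  [/\ continuous U, U a = 0 & forall t, a <= t -> rderiv U t (u t)].

(** A chosen primitive, determined only for [a <= b]; hence this hypothesis in the rules that
    follow. *)
Definition vint a b u : CK := xget (fun=> 0) (is_primitive a u) b.

Lemma vintP a u : continuous u -> [/\ continuous (fun b => vint a b u),
  vint a a u = 0 & forall t, a <= t -> rderiv (fun b => vint a b u) t (u t)].
Proof.
move=> uc; have [U UP] := primitive_ex a uc.
exact: (@xgetI _ (fun=> 0) (is_primitive a u) U UP).
Qed.

(** Two primitives differ by a function with right derivative 0. Most rules of integration below are
    instances with an explicit primitive. *)
Lemma vintE a b u (U : R -> CK) : a <= b -> continuous u ->
  (forall t, a < t <= b -> {for t, continuous U}) ->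
  (forall t, a <= t < b -> rderiv U t (u t)) -> vint a b u = U b - U a.
Proof.
move=> ab uc Uc Uu; have [Ic I0 Id] := vintP a uc.
have := @rderiv0_const _ _ (fun t => vint a t u - U t) a b ab.
rewrite I0 sub0r => H; rewrite -[LHS](subrK (U b)) H; first by rewrite addrC.
- by move=> t tab; apply: cvgB; [exact: Ic|exact: Uc].
- move=> t /andP[at_ tb]; rewrite -(subrr (u t)); apply: rderivD; first exact: Id.
  rewrite -scaleN1r; apply: (rderiv_ext (u := fun s => -1 *: U s)) => [r|]; first by rewrite scaleN1r.
  by apply: rderivZl; apply: Uu; rewrite at_ tb.
Qed.

Lemma vint_dist a b u (w : CK) (k : R) : a <= b -> continuous u ->
  (forall t, a <= t < b -> rnorm (u t - w) <= k) ->
  rnorm (vint a b u - (b - a)%:C *: w) <= k * (b - a).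
Proof.
move=> ab uc uk; have [Ic I0 Id] := vintP a uc.
rewrite -[vint a b u]subr0 -I0.
apply: (mean_value_dist (u' := u)) => // [t _|t /andP[at_ _]]; first exact: Ic.
exact: Id.
Qed.

Lemma rnorm_vint a b u (k : R) : a <= b -> continuous u ->
  (forall t, a <= t < b -> rnorm (u t) <= k) -> rnorm (vint a b u) <= k * (b - a).
Proof.
move=> ab uc uk; have := @vint_dist a b u 0 k ab uc; rewrite scaler0 subr0; apply.
by move=> t /uk; rewrite subr0.
Qed.

Lemma vintD a b u (v : R -> CK) : a <= b -> continuous u -> continuous v ->
  vint a b (fun t => u t + v t) = vint a b u + vint a b v.
Proof.
move=> ab uc vc; have [Ic I0 Id] := vintP a uc; have [Jc J0 Jd] := vintP a vc.
rewrite (@vintE a b _ (fun t => vint a t u + vint a t v)) ?I0 ?J0 ?addr0 ?subr0//.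
- by move=> t; apply: cvgD; [exact: uc|exact: vc].
- by move=> t _; apply: cvgD; [exact: Ic|exact: Jc].
- by move=> t /andP[at_ _]; apply: rderivD; [exact: Id|exact: Jd].
Qed.

Lemma vintZ a b u (z : C) : a <= b -> continuous u ->
  vint a b (fun t => z *: u t) = z *: vint a b u.
Proof.
move=> ab uc; have [Ic I0 Id] := vintP a uc.
rewrite (@vintE a b _ (fun t => z *: vint a t u)) ?I0 ?scaler0 ?subr0//.
- by move=> t; apply: cvgZl_tmp; exact: uc.
- by move=> t _; apply: cvgZl_tmp; exact: Ic.
- by move=> t /andP[at_ _]; apply: rderivZl; exact: Id.
Qed.

Lemma vint_bop a b u (S : boundedOp CK) : a <= b -> continuous u ->
  vint a b (fun t => S (u t)) = S (vint a b u).
Proof.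
move=> ab uc; have [Ic I0 Id] := vintP a uc.
rewrite (@vintE a b _ (fun t => S (vint a t u))) ?I0 ?linear0 ?subr0 ?addr0//.
- by move=> t; apply: bop_cvg; exact: uc.
- by move=> t _; apply: bop_cvg; exact: Ic.
- move=> t /andP[at_ _]; apply: (rderiv_bop (c := rnorm S)); last exact: Id.
  + by move=> f g; rewrite linearB.
  + by move=> z f; rewrite linearZ.
  + exact: rnorm_bop.
Qed.

Lemma vint_cat a b c u : a <= b -> b <= c -> continuous u ->
  vint a c u = vint a b u + vint b c u.
Proof.
move=> ab bc uc; have [Ic I0 Id] := vintP a uc.
have -> : vint b c u = vint a c u - vint a b u.
  apply: (@vintE b c u (fun t => vint a t u)) => //.
    by move=> t _; exact: Ic.
  by move=> t /andP[bt _]; apply: Id; exact: le_trans bt.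
by rewrite addrC subrK.
Qed.

Lemma vint_shift a b c u : a <= b -> continuous u ->
  vint a b (fun t => u (t + c)) = vint (a + c) (b + c) u.
Proof.
move=> ab uc; have [Ic I0 Id] := vintP (a + c) uc.
have shc (V : topologicalType) (g : R -> V) : continuous g -> continuous (fun t => g (t + c)).
  move=> gc t; apply: (@cvg_comp _ _ _ (fun t => t + c) g _ (nbhs (t + c))); last exact: gc.
  by apply: cvgD; [exact: cvg_id|exact: cvg_cst].
rewrite (@vintE a b _ (fun t => vint (a + c) (t + c) u)) ?I0 ?subr0//.
- exact: shc.
- by move=> t _; apply: shc.
- by move=> t /andP[at_ _]; apply: rderiv_shift; apply: Id; rewrite lerD2r.
Qed.

Lemma eq_vint a b u (v : R -> CK) : a <= b -> continuous u -> continuous v ->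
  (forall t, a <= t < b -> u t = v t) -> vint a b u = vint a b v.
Proof.
move=> ab uc vc uv; have [Jc J0 Jd] := vintP a vc.
rewrite (@vintE a b u (fun t => vint a t v)) ?J0 ?subr0//.
  by move=> t _; exact: Jc.
by move=> t tab; rewrite uv//; apply: Jd; case/andP: tab.
Qed.

Lemma vint_nonneg a b u : a <= b -> continuous u ->
  (forall t, a <= t < b -> nonneg_fun (u t)) -> nonneg_fun (vint a b u).
Proof.
move=> ab uc u0 x; have [Ic I0 Id] := vintP a uc.
(* A nonnegative element of [R[i]] has imaginary part 0, so the monotonicity argument is run for the
   real part and for both signs of the imaginary part. *)
have ge (part : C -> R) : (forall z : C, `|part z| <= rnorm (z : C^o)) ->
    (forall z w : C, part (z - w) = part z - part w) ->
    (forall (r : R) (z : C), part (r%:C * z) = r * part z) ->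
    (forall t, a <= t < b -> 0 <= part (Cval (u t) x)) -> 0 <= part (Cval (vint a b u) x).
  move=> part1 partB partZ pu.
  have p0 : part 0 = 0 by have := partB 0 0; rewrite !subrr.
  rewrite -oppr_le0.
  have -> : 0 = - part (Cval (vint a a u) x) by rewrite I0 [X in part X](_ : _ = 0)// p0 oppr0.
  apply: (@dini_le _ (fun t => - part (Cval (vint a t u) x))) => //.
  - move=> t _; apply: cvgN; apply/cvgrPdist_le => e e0.
    have : Cval (vint a s u) x @[s --> t] --> Cval (vint a t u) x.
      by apply: Cval_cvg; exact: Ic.
    move=> /cvg_rnormP/(_ _ e0); apply: filterS => s.
    by rewrite -partB; apply: le_trans; exact: part1.
  - move=> t tab e e0; have at_ : a <= t by case/andP: tab.
    have := rderiv_Cval x (Id t at_); move=> /(_ e e0).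
    apply: filterS2 (nbhs_right_gt 0) => h h0 /(le_trans (part1 _)).
    rewrite !partB partZ ler_norml => /andP[A _].
    have := mulr_ge0 (ltW h0) (pu t tab); lra.
rewrite lecE /=; apply/andP; split.
  rewrite eq_le; apply/andP; split; last first.
    apply: (ge (@complex.Im R)).
    - exact: Im_le_cmod.
    - by move=> p q; rewrite raddfB.
    - by move=> r [p q] /=; rewrite mul0r addr0.
    - by move=> t /u0/(_ x); rewrite lecE => /andP[/eqP ->].
  rewrite -oppr_ge0; apply: (ge (fun z => - complex.Im z)).
  - by move=> z; rewrite normrN; exact: Im_le_cmod.
  - by move=> p q; rewrite raddfB opprB opprK addrC.
  - by move=> r [p q] /=; rewrite mul0r addr0 mulrN.
  - by move=> t /u0/(_ x); rewrite lecE => /andP[/eqP -> _]; rewrite oppr0.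
apply: (ge (@complex.Re R)).
- exact: Re_le_cmod.
- by move=> p q; rewrite raddfB.
- by move=> r [p q] /=; rewrite mul0r subr0.
- by move=> t /u0/(_ x); rewrite lecE => /andP[].
Qed.

End vint.

(** * Semigroups and their generators *)

Section generator.
Variables (R : realType) (E : normedModType R[i]).
Local Notation C := R[i].
Implicit Types (T : R -> boundedOp E) (f g : E).

(** The graph of the generator, which replaces the partial operator and its domain by one
    relation. *)
Definition gen T f g := generator_quotient T f t @[t --> 0^'+] --> g.

Lemma genP T f g : gen T f g <-> pop_dom (generator T) f /\ generator T f = g.
Proof.
split=> [fg|[/= fc <-]]; last exact: fc.
split; first by apply/cvg_ex; exists g.
by apply: cvg_lim => //; exact: norm_hausdorff.
Qed.

Lemma gen_dom T f : pop_dom (generator T) f -> gen T f (generator T f).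
Proof. by move=> fd; apply/genP. Qed.

Lemma resolventP T z (S : boundedOp E) : is_resolvent (generator T) z S <->
  (forall g, gen T (S g) (z *: S g - g)) /\ (forall f g, gen T f g -> S (z *: f - g) = f).
Proof.
split=> [[S1 S2]|[S1 S2]].
  split=> [g|f g /genP[fd <-]]; last exact: S2.
  by apply/genP; have [gd E1] := S1 g; split=> //; rewrite -[X in _ = _ - X]E1 opprB addrC subrK.
split=> [g|f fd]; last by apply: S2; exact: gen_dom.
by have /genP[gd ->] := S1 g; split=> //; rewrite opprB addrC subrK.
Qed.

Lemma genD T f g f' g' : gen T f g -> gen T f' g' -> gen T (f + f') (g + g').
Proof.
move=> fg fg'; apply: cvg_near_eq (cvgD fg fg').
by apply: nearW => t; rewrite /generator_quotient /= (linearD (T t)) opprD addrACA scalerDr.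
Qed.

Lemma genZ T z f g : gen T f g -> gen T (z *: f) (z *: g).
Proof.
move=> fg; apply: cvg_near_eq (cvgZl_tmp (k := z) fg).
by apply: nearW => t; rewrite /generator_quotient /= (linearZ_LR (T t)) -scalerBr !scalerA mulrC.
Qed.

Lemma resolvent_unique T z (S S' : boundedOp E) :
  is_resolvent (generator T) z S -> is_resolvent (generator T) z S' -> S = S'.
Proof.
move=> /resolventP[S1 _] /resolventP[_ S2]; apply: bopP => g.
by rewrite -[LHS](S2 _ _ (S1 g)) opprB addrC subrK.
Qed.

End generator.

Section semigroup.
Variables (R : realType) (K : topologicalType) (cK : compact [set: K]).
Local Notation C := R[i].
Local Notation CK := (Cspace R cK).
Implicit Types (T : R -> boundedOp CK) (f g : CK) (t : R).

Lemma sg_orbit_right T f : C0_semigroup T -> forall e : R, 0 < e ->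
  exists2 d : R, 0 < d & forall t, 0 <= t < d -> rnorm (T t f - f) <= e.
Proof.
move=> [T0 _ Tc] e e0; have /cvg_rnormP/(_ e e0)/near_right0P[d d0 dP] := Tc f.
exists d => // t /andP[]; rewrite le_eqVlt => /predU1P[<- _|t0 td].
  by rewrite T0 subrr rnorm0 ltW.
by rewrite rnorm_distC; apply: dP; rewrite t0 td.
Qed.

(** Otherwise there are times [t n <= n.+1%:R^-1] with [rnorm (T (t n)) > n]. Every orbit is bounded
    along them, being right continuous at 0, and uniform boundedness gives a contradiction. *)
Lemma sg_bounded_near0 T : C0_semigroup T ->
  exists d M : R, [/\ 0 < d, 1 <= M & forall t, 0 <= t <= d -> rnorm (T t) <= M].
Proof.
move=> hT; apply: contrapT => nb.
have ex (n : nat) : exists t, 0 <= t <= n.+1%:R^-1 /\ n%:R < rnorm (T t).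
  apply: contrapT => nt; apply: nb; exists n.+1%:R^-1, (Num.max 1 n%:R).
  rewrite invr_gt0 ltr0n le_max lexx; split => // t tn.
  rewrite le_max; apply/orP; right; rewrite leNgt; apply/negP => nT.
  by apply: nt; exists t.
pose t n := sval (cid (ex n)); have tP n := svalP (cid (ex n)).
have [|c cT] := @uniform_boundedness _ CK (fun n => T (t n)).
  move=> f; have [d d0 dP] := sg_orbit_right f hT ltr01.
  pose N := (Num.truncn d^-1).+1.
  exists (\sum_(k < N) rnorm (T (t k) f) + (rnorm f + 1)) => n.
  have s0 : 0 <= \sum_(k < N) rnorm (T (t k) f) by apply: sumr_ge0 => k _; exact: rnorm_ge0.
  have f0 := rnorm_ge0 f.
  have [nN|Nn] := ltnP n N.
    rewrite (bigD1 (Ordinal nN)) //= -addrA lerDl addr_ge0//; last lra.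
    by apply: sumr_ge0 => k _; exact: rnorm_ge0.
  have := rnorm_le_dist (T (t n) f) f; have := dP (t n).
  have [/andP[-> tn] _] := tP n.
  have -> : t n < d.
    apply: le_lt_trans tn _; rewrite invf_plt ?posrE//.
    by apply: lt_le_trans (truncnS_gt _) _; rewrite ler_nat; exact: leq_trans Nn _.
  move=> /(_ isT); lra.
have [_] := tP (Num.truncn c).+1; apply/negP; rewrite -leNgt.
by apply: le_trans (cT _) _; apply/ltW; exact: truncnS_gt.
Qed.

Lemma rnorm_sgD T s t : C0_semigroup T -> 0 <= s -> 0 <= t ->
  rnorm (T (s + t)) <= rnorm (T s) * rnorm (T t).
Proof.
move=> [_ TD _] s0 t0; apply: rnorm_bop_le => [|f]; first by rewrite mulr_ge0 ?rnorm_ge0.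
rewrite TD//; apply: le_trans (rnorm_bop _ _) _; rewrite -mulrA ler_wpM2l ?rnorm_ge0//.
exact: rnorm_bop.
Qed.

Lemma sg_growth T : C0_semigroup T ->
  exists M w : R, [/\ 1 <= M, 0 <= w & forall t, 0 <= t -> rnorm (T t) <= M * expR (w * t)].
Proof.
move=> hT; have [d [M [d0 M1 MP]]] := sg_bounded_near0 hT.
have M0 : 0 < M by lra.
have Mn (n : nat) r : 0 <= r <= d -> rnorm (T (n%:R * d + r)) <= M * M ^+ n.
  move=> rd; elim: n => [|n IH]; first by rewrite mul0r add0r mulr1 MP.
  have -> : n.+1%:R * d + r = d + (n%:R * d + r) by rewrite -addn1 natrD; ring.
  apply: le_trans (rnorm_sgD hT _ _) _; first exact: ltW.
    by case/andP: rd => r0 _; rewrite addr_ge0// mulr_ge0// ltW.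
  by rewrite exprS mulrCA ler_pM ?rnorm_ge0// MP// lexx (ltW d0).
have lM : 0 <= ln M by exact: ln_ge0.
exists M, (ln M / d); split=> //; first by rewrite divr_ge0// ltW.
move=> t t0; pose n := Num.truncn (t / d).
have /andP[n1 n2] : n%:R <= t / d < n.+1%:R by apply: truncn_itv; rewrite divr_ge0// ltW.
have -> : t = n%:R * d + (t - n%:R * d) by ring.
apply: le_trans (Mn n _ _) _.
  move: n1 n2; rewrite ler_pdivlMr// ltr_pdivrMr// -addn1 natrD; lra.
rewrite ler_wpM2l ?(ltW M0)// (addrC (n%:R * d)) subrK.
have -> : M ^+ n = expR (n%:R * ln M) by rewrite expRM_natl lnK.
rewrite ler_expR; have -> : ln M / d * t = t / d * ln M by ring.
by rewrite ler_wpM2r.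
Qed.

Lemma sg_locally_bounded T b : C0_semigroup T ->
  exists2 M : R, 0 < M & forall t, 0 <= t <= b -> rnorm (T t) <= M.
Proof.
move=> hT; have [M [w [M1 w0 MP]]] := sg_growth hT.
exists (M * expR (w * b)); first by rewrite mulr_gt0 ?expR_gt0//; lra.
move=> t /andP[t0 tb]; apply: le_trans (MP t t0) _.
have M0 : 0 <= M by lra.
by rewrite ler_wpM2l// ler_expR ler_wpM2l.
Qed.

(** [T] is meaningful only for nonnegative times, whereas integrands have to be continuous on the
    whole line: the orbit is extended by a constant. *)
Definition sgorbit T f (t : R) : CK := T (Num.max 0 t) f.

Lemma sgorbitE T f t : 0 <= t -> sgorbit T f t = T t f.
Proof. by move=> t0; rewrite /sgorbit max_r. Qed.

Lemma sgorbit_modulus T f M t s : C0_semigroup T -> 0 <= t <= s -> rnorm (T t) <= M ->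
  rnorm (T s f - T t f) <= M * rnorm (T (s - t) f - f).
Proof.
move=> [_ TD _] /andP[t0 ts] TM.
have -> : T s f = T t (T (s - t) f) by rewrite -TD ?subr_ge0// addrC subrK.
rewrite -linearB; apply: le_trans (rnorm_bop _ _) _.
by rewrite ler_wpM2r ?rnorm_ge0.
Qed.

Lemma sgorbit_continuous T f : C0_semigroup T -> continuous (sgorbit T f).
Proof.
move=> hT t; apply/cvg_rnormP => e e0.
have [M M0 MP] := sg_locally_bounded (`|t| + 1) hT.
have [d d0 dP] := sg_orbit_right f hT (divr_gt0 e0 M0).
have key a b : 0 <= a <= b -> b - a < d -> a <= `|t| + 1 -> rnorm (T b f - T a f) <= e.
  move=> ab bad at1; have aM : rnorm (T a) <= M by apply: MP; case/andP: ab => -> _.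
  apply: le_trans (sgorbit_modulus _ hT ab aM) _; rewrite mulrC -ler_pdivlMr//.
  by apply: dP; case/andP: ab => _ ?; rewrite subr_ge0 bad andbT.
exists (Num.min 1 d) => /=; first by rewrite lt_min ltr01.
move=> s; rewrite /ball /= lt_min => /andP[st1 std]; rewrite /sgorbit.
have [st|/ltW ts] := leP s t.
  apply: key; first by rewrite le_max lexx ge_max le_max lexx /= le_max st orbT.
  - apply: le_lt_trans std; have := ler_norm (t - s); have := normr_ge0 (t - s).
    by case: (leP 0 t); case: (leP 0 s); lra.
  - have := ler_norm t; have := normr_ge0 t; case: (leP 0 s); lra.
rewrite rnorm_distC; apply: key; first by rewrite le_max lexx ge_max le_max lexx /= le_max ts orbT.
- apply: le_lt_trans std; rewrite distrC; have := ler_norm (s - t); have := normr_ge0 (s - t).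
  by case: (leP 0 t); case: (leP 0 s); lra.
- have := ler_norm t; have := normr_ge0 t; case: (leP 0 t); lra.
Qed.

Lemma gen_rderiv T f g t : C0_semigroup T -> 0 <= t -> gen T f g ->
  rderiv (sgorbit T f) t (T t g).
Proof.
move=> [T0 TD _] t0 fg; apply/rderivP.
apply: cvg_near_eq (bop_cvg (T t) fg).
near=> h; have h0 : 0 < h by near: h; exact: nbhs_right_gt.
rewrite /generator_quotient linearZ linearB /= !sgorbitE//; last by rewrite addr_ge0// ltW.
by rewrite TD// ltW.
Unshelve. all: by end_near. Qed.

Lemma gen_orbit T f g t : C0_semigroup T -> 0 <= t -> gen T f g -> gen T (T t f) (T t g).
Proof.
move=> [T0 TD _] t0 fg.
apply: cvg_near_eq (bop_cvg (T t) fg).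
near=> h; have h0 : 0 <= h by apply/ltW; near: h; exact: nbhs_right_gt.
by rewrite /generator_quotient linearZ linearB /= -!TD// [t + h]addrC.
Unshelve. all: by end_near. Qed.

Lemma gen_fixed T f t : C0_semigroup T -> gen T f 0 -> 0 <= t -> T t f = f.
Proof.
move=> hT f0 t0; have [T0 _ _] := hT.
rewrite -[RHS]T0 -(sgorbitE T f t0) -(sgorbitE T f (lexx 0)).
apply: rderiv0_const => // [s _|s /andP[s0 _]]; first exact: sgorbit_continuous.
by rewrite -(linear0 (T s)); exact: gen_rderiv.
Qed.

(** [T h] translates the interval of integration by [h], so the difference quotient of the integral
    is that of the primitive at [t] minus that at 0. *)
Lemma gen_integral T f t : C0_semigroup T -> 0 <= t ->
  gen T (vint 0 t (sgorbit T f)) (T t f - f).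
Proof.
move=> hT t0; have [T0 TD _] := hT; have oc : continuous (sgorbit T f) by exact: sgorbit_continuous.
have [Ic I0 Id] := vintP 0 oc.
have /rderivP A := Id t t0; have /rderivP B := Id 0 (lexx 0).
have D := cvgB A B; rewrite !sgorbitE// T0 in D; apply: cvg_near_eq (D _).
near=> h; have h0 : 0 <= h by apply/ltW; near: h; exact: nbhs_right_gt.
transitivity ((h^-1)%:C *: (vint 0 (t + h) (sgorbit T f) - vint 0 t (sgorbit T f)) -
  (h^-1)%:C *: (vint 0 (0 + h) (sgorbit T f) - vint 0 0 (sgorbit T f))) => [//|].
rewrite /generator_quotient -vint_bop// -scalerBr I0 subr0 add0r.
congr (_ *: _).
rewrite (@eq_vint _ _ _ 0 t (fun s => T h (sgorbit T f s)) (fun s => sgorbit T f (s + h))) //; first last.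
- move=> s /andP[s0 _]; rewrite !sgorbitE//; last exact: addr_ge0.
  by rewrite -TD// addrC.
- move=> s; apply: (@cvg_comp _ _ _ (fun s => s + h) _ _ (nbhs (s + h))); last exact: oc.
  by apply: cvgD; [exact: cvg_id|exact: cvg_cst].
- by move=> s; apply: bop_cvg; exact: oc.
rewrite vint_shift// add0r.
have th : h <= t + h by rewrite lerDr.
by rewrite [vint 0 (t + h) _](vint_cat h0 th oc) addrAC (addrC (vint 0 h _)) addrK.
Unshelve. all: by end_near. Qed.

End semigroup.

(** * Rescaling, resolvents and cones *)

Section sgshift.
Variables (R : realType) (K : topologicalType) (cK : compact [set: K]).
Local Notation C := R[i].
Local Notation CK := (Cspace R cK).
Implicit Types (T : R -> boundedOp CK) (f g : CK) (t : R) (z w : C).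

(** The semigroup of [A - z]. Complex [z] is required for peripheral eigenvalues and on the
    imaginary axis; [rescale] is the real case. *)
Definition sgshift T z t : boundedOp CK := cexp (t%:C * - z) *: T t.

Lemma sgshiftE T z t f : sgshift T z t f = cexp (t%:C * - z) *: T t f. Proof. by []. Qed.

Lemma rescaleE T (s : R) : rescale T s = sgshift T s%:C.
Proof. by apply/funext => t; rewrite /sgshift -rmorphN -rmorphM cexp_real mulrN. Qed.

Lemma sgshiftA T z w : sgshift (sgshift T z) w = sgshift T (z + w).
Proof.
apply/funext => t; apply: bopP => f; rewrite !sgshiftE scalerA -cexpD.
by rewrite -mulrDr opprD addrC.
Qed.

Lemma sgshift0 T : sgshift T 0 = T.
Proof.
by apply/funext => t; apply: bopP => f; rewrite sgshiftE oppr0 mulr0 cexp0 scale1r.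
Qed.

Lemma sgshift_sg T z : C0_semigroup T -> C0_semigroup (sgshift T z).
Proof.
move=> [T0 TD Tc]; split=> [f|s t f s0 t0|f].
- by rewrite sgshiftE mul0r cexp0 scale1r.
- rewrite !sgshiftE TD// linearZ_LR scalerA rmorphD mulrDl cexpD.
  by congr (_ *: _); exact: mulrC.
- have A := rderiv_right_cvg (cexp_rderiv (- z) 0).
  have : (cexp (0%:C * - z) : C^o) *: f = f by rewrite mul0r cexp0 scale1r.
  move=> {2}<-; apply: cvgZ (Tc f).
  by move: A; under eq_fun do rewrite add0r.
Qed.
Arguments sgshift_sg {T} z.

Lemma gen0P T f g : C0_semigroup T -> gen T f g <-> rderiv (fun t => T t f) 0 g.
Proof.
move=> [T0 _ _]; rewrite rderivP /gen T0.
by under [in X in _ <-> X]eq_fun do rewrite add0r.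
Qed.

Lemma gen_shift T z f g : C0_semigroup T -> gen T f g -> gen (sgshift T z) f (g - z *: f).
Proof.
move=> hT /gen0P => /(_ hT) fg; apply/(gen0P _ _ (sgshift_sg z hT)).
have := rderivZ (cexp_rderiv (- z) 0) fg; have [-> _ _] := hT.
by rewrite mul0r cexp0 mulr1 scale1r scaleNr addrC.
Qed.
Arguments gen_shift {T} z {f g}.

Lemma gen_unshift T z f g : C0_semigroup T -> gen (sgshift T z) f g -> gen T f (g + z *: f).
Proof.
move=> hT /(gen_shift (- z) (sgshift_sg z hT)).
by rewrite sgshiftA subrr sgshift0 scaleNr opprK.
Qed.

Lemma resolvent_shift T z w S : C0_semigroup T ->
  is_resolvent (generator T) z S -> is_resolvent (generator (sgshift T w)) (z - w) S.
Proof.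
move=> hT /resolventP[S1 S2]; apply/resolventP; split=> [g|f g fg].
  by have := gen_shift w hT (S1 g); rewrite scalerBl addrAC.
have := S2 _ _ (gen_unshift hT fg).
by rewrite opprD addrA addrAC -scalerBl.
Qed.
Arguments resolvent_shift {T z} w {S}.

Lemma gen_eigen T z f t : C0_semigroup T -> gen T f (z *: f) -> 0 <= t ->
  T t f = cexp (t%:C * z) *: f.
Proof.
move=> hT /(gen_shift z hT); rewrite subrr => f0 t0.
have := gen_fixed (sgshift_sg z hT) f0 t0; rewrite sgshiftE => {2}<-.
by rewrite scalerA -cexpD mulrN addrC addNr cexp0 scale1r.
Qed.

End sgshift.
Arguments gen_shift {R K cK T} z {f g}.
Arguments sgshift_sg {R K cK T} z.
Arguments resolvent_shift {R K cK T z} w {S}.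

(** * Existence of resolvents and the cones they preserve *)

Section hille_yosida.
Variables (R : realType) (K : topologicalType) (cK : compact [set: K]).
Local Notation C := R[i].
Local Notation CK := (Cspace R cK).
Implicit Types (T : R -> boundedOp CK) (f g : CK) (t : R) (z w : C).

Definition closed_cone (G : set CK) := [/\ G 0, forall f g, G f -> G g -> G (f + g),
  forall (r : R) f, 0 <= r -> G f -> G (r%:C *: f) &
  forall (u : nat -> CK) l, (forall n, G (u n)) -> u @ \oo --> l -> G l].

Definition preserves (G : set CK) (S : boundedOp CK) := forall f, G f -> G (S f).

Lemma neumann_preserves (G : set CK) (B N : boundedOp CK) : closed_cone G ->
  preserves G B -> (forall f, (fun n => \sum_(k < n) iter k B f) @ \oo --> N f) ->
  preserves G N.
Proof.
move=> [G0 GD _ Gc] GB NB f Gf; apply: Gc (NB f) => n.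
elim/big_ind: _ => // k _; elim: (k : nat) => [//|j IH]; exact: GB.
Qed.

Lemma nonneg_approx (l : CK) :
  (forall e : R, 0 < e -> exists2 u, nonneg_fun u & rnorm (l - u) <= e) -> nonneg_fun l.
Proof.
move=> H x; have {}H (e : R) : 0 < e ->
    - e <= complex.Re (Cval l x) /\ `|complex.Im (Cval l x)| <= e.
  move=> /H[u /(_ x) u0 /(le_trans (rnorm_Cval _ x))]; rewrite CvalB.
  move=> lu; have := le_trans (Re_le_cmod _) lu; have := le_trans (Im_le_cmod _) lu.
  move: u0; case: (Cval u x) => a b; case: (Cval l x) => c d.
  rewrite lecE /= => /andP[/eqP -> a0]; rewrite subr0 => dd.
  by rewrite ler_norml => /andP[A _]; split => //; lra.
rewrite lecE /=; apply/andP; split.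
  by rewrite -normr_le0; apply/ler_addgt0Pr => e /H[_]; rewrite add0r.
by apply/ler_addgt0Pr => e /H[A _]; rewrite -lerBlDr sub0r.
Qed.

Lemma nonneg_cone : closed_cone [set f : CK | nonneg_fun f].
Proof.
split=> [x|f g f0 g0 x|r f r0 f0 x|u l u0 ul].
- by [].
- by rewrite CvalD addr_ge0.
- by rewrite CvalZ mulr_ge0// ler0c.
apply: nonneg_approx => e e0; have /cvg_rnormP/(_ e e0)[n _ /(_ n (leqnn n)) un] := ul.
by exists (u n); [exact: u0|exact: un].
Qed.

(* The functions whose orbit is nonnegative from the start: an eventually positive
   orbit enters this cone, on which the semigroup behaves like a positive one. *)
Definition poscone T : set CK := [set g | forall t, 0 <= t -> nonneg_fun (T t g)].

Lemma poscone_cone T : closed_cone (poscone T).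
Proof.
have [G0 GD GZ Gc] := nonneg_cone.
split=> [t _|f g f0 g0 t t0|r f r0 f0 t t0|u l u0 ul t t0].
- by rewrite linear0; exact: G0.
- by rewrite linearD; apply: GD; [exact: f0|exact: g0].
- by rewrite linearZ_LR; apply: GZ => //; exact: f0.
- apply: (Gc (fun n => T t (u n))) => [n|]; first exact: u0.
  exact: bop_cvg.
Qed.

Lemma poscone_shift T (r : R) : poscone (sgshift T r%:C) = poscone T.
Proof.
have sub T' r' : poscone T' `<=` poscone (sgshift T' r'%:C).
  move=> g g0 t t0; rewrite sgshiftE -rmorphN -rmorphM cexp_real.
  by have [_ _ GZ _] := nonneg_cone; apply: GZ; [exact: expR_ge0|exact: g0].
apply/seteqP; split=> [g|]; last exact: sub.
by move=> /(sub _ (- r)); rewrite sgshiftA rmorphN subrr sgshift0.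
Qed.

(** The Laplace integral at 0 is summed over blocks of length [tau]: [S] integrates one block after
    applying [N], the Neumann inverse of [1 - T tau]. Both factors preserve the cone. *)
Lemma hille_yosida0 T (tau : R) : C0_semigroup T -> 0 <= tau ->
  (forall f, rnorm (T tau f) <= 2^-1 * rnorm f) ->
  exists2 S : boundedOp CK, is_resolvent (generator T) 0 S & preserves (poscone T) S.
Proof.
move=> hT tau0 T2; have [T0 TD _] := hT.
have oc f : continuous (sgorbit T f) by exact: sgorbit_continuous.
have [N [N1 N2 _ Nlim]] := neumann T2.
have [M M0 MP] := sg_locally_bounded tau hT.
pose V f := vint 0 tau (sgorbit T f).
have lV : linear (fun f => V (N f)).
  move=> a f g; rewrite /V -vintZ// -vintD//; last by move=> t; apply: cvgZl_tmp; exact: oc.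
  by congr (vint _ _ _); apply/funext => t; rewrite /sgorbit !linearP.
have bV f : rnorm (V (N f)) <= M * tau * rnorm N * rnorm f.
  have := @rnorm_vint _ _ _ 0 tau (sgorbit T (N f)) (M * rnorm (N f)) tau0 (oc _).
  rewrite subr0 => H; apply: (le_trans (H _)) => [t /andP[t0 tt]|].
    rewrite sgorbitE//; apply: le_trans (rnorm_bop _ _) _.
    by rewrite ler_wpM2r ?rnorm_ge0// MP// t0 ltW.
  rewrite -mulrA -[leRHS]mulrA -[leRHS]mulrA ler_wpM2l ?(ltW M0)//.
  by rewrite mulrC ler_wpM2l// rnorm_bop.
pose S := bounded_bop lV bV.
have S1 g : gen T (S g) (0 *: S g - g).
  have := gen_integral (f := N g) hT tau0.
  by rewrite scale0r sub0r; have -> : - g = T tau (N g) - N g by rewrite -{1}(N1 g) opprB.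
exists S.
  apply/resolventP; split=> // f g fg; rewrite scale0r sub0r linearN.
  have : gen T (S g + f) 0.
    by have := genD (S1 g) fg; rewrite scale0r sub0r addNr.
  (* A vector annihilated by the generator is fixed by [T tau], which halves norms, so it is 0. *)
  set h := S g + f => h0; have Th : T tau h = h by exact: gen_fixed.
  have hh : h = 0.
    apply: rnorm0_eq0; have := T2 h; rewrite Th; have := rnorm_ge0 h; lra.
  by apply/eqP; rewrite eq_sym -subr_eq0 opprK addrC; apply/eqP.
have NP : preserves (poscone T) N.
  apply: (neumann_preserves (poscone_cone T) _ Nlim) => g g0 t t0.
  by rewrite -TD//; apply: g0; exact: addr_ge0.
move=> g /NP g0 t t0; rewrite [S g]/(V (N g)) -vint_bop//.
apply: vint_nonneg => // [s|s /andP[s0 _]]; first by apply: bop_cvg; exact: oc.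
by rewrite sgorbitE// -TD//; apply: g0; exact: addr_ge0.
Qed.

Lemma hille_yosida T (M a : R) z : C0_semigroup T ->
  (forall t, 0 <= t -> rnorm (T t) <= M * expR (a * t)) -> a < complex.Re z ->
  exists2 S : boundedOp CK, is_resolvent (generator T) z S &
    complex.Im z = 0 -> preserves (poscone T) S.
Proof.
move=> hT TM az; pose b := complex.Re z - a; have b0 : 0 < b by rewrite subr_gt0.
(* Chosen so that [b * tau = 2 * |M|]: the shifted semigroup at time [tau] then has norm at most
   [M / expR (2 * |M|)], which is below 1/2 because [expR y >= 1 + y]. *)
pose tau := 2 * `|M| / b; have tau0 : 0 <= tau by rewrite divr_ge0 ?mulr_ge0// ltW.
have [f|S S0 SP] := hille_yosida0 (sgshift_sg z hT) tau0.
  rewrite sgshiftE rnormZ cmod_cexp.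
  have -> : complex.Re (tau%:C * - z) = - (tau * complex.Re z).
    by case: (z) => p q /=; rewrite mul0r subr0 mulrN.
  apply: le_trans (ler_wpM2l (expR_ge0 _) (rnorm_bop _ _)) _.
  rewrite mulrA ler_wpM2r ?rnorm_ge0//.
  apply: le_trans (ler_wpM2l (expR_ge0 _) (TM _ tau0)) _.
  have M1 : M <= `|M| by exact: ler_norm.
  have E1 : expR (- (tau * complex.Re z)) * expR (a * tau) = (expR (2 * `|M|))^-1.
    rewrite -expRD -expRN; congr expR; rewrite /tau /b; field.
    by rewrite subr_eq0 gt_eqF.
  rewrite mulrCA E1 ler_pdivrMr ?expR_gt0//.
  have := expR_ge1Dx (2 * `|M|); lra.
exists S; first by have := resolvent_shift (- z) (sgshift_sg z hT) S0; rewrite sgshiftA subrr sgshift0 sub0r opprK.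
move=> z0; have zE : z = (complex.Re z)%:C by rewrite [LHS]complexE z0 mulr0 addr0.
by move: SP; rewrite zE poscone_shift.
Qed.

(** Neumann series in [(z - w) *: S]. When [z - w] is a nonnegative real its terms preserve every
    closed cone that [S] preserves, so positivity of the resolvent travels to the left along the
    real axis. *)
Lemma resolvent_perturb T z w (S : boundedOp CK) : is_resolvent (generator T) z S ->
  rnorm (z - w : C^o) * rnorm S <= 2^-1 ->
  exists S' : boundedOp CK, [/\ is_resolvent (generator T) w S',
    forall f, rnorm (S' f) <= 2 * rnorm S * rnorm f &
    forall G, closed_cone G -> (exists2 r : R, 0 <= r & z - w = r%:C) ->
      preserves G S -> preserves G S'].
Proof.
move=> /resolventP[S1 S2] zw.
have B2 f : rnorm (((z - w) *: S) f) <= 2^-1 * rnorm f.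
  rewrite bopZE rnormZ; apply: le_trans (ler_wpM2r (rnorm_ge0 f) zw).
  by rewrite -mulrA ler_wpM2l ?rnorm_ge0// rnorm_bop.
have [N [N1 N2 Nb Nlim]] := neumann B2.
have lS : linear (fun f => S (N f)) by move=> a f g; rewrite !linearP.
have bS f : rnorm (S (N f)) <= 2 * rnorm S * rnorm f.
  apply: le_trans (rnorm_bop _ _) _; rewrite -mulrA mulrCA.
  by rewrite ler_wpM2l ?rnorm_ge0//; exact: Nb.
exists (bounded_bop lS bS); split=> //.
- apply/resolventP; split=> [g|f g fg] /=.
    have -> : w *: S (N g) - g = z *: S (N g) - N g; last exact: S1.
    rewrite -[X in _ - X](N1 g) bopZE scalerBl opprB addrA.
    by rewrite (addrC (w *: _)) subrK.
  have := N2 (z *: f - g); rewrite bopZE (S2 _ _ fg).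
  rewrite scalerBl opprB addrC addrA subrK => ->.
  exact: S2.
- move=> G cG [r r0 rE] GS f Gf; have [_ _ GZ _] := cG; apply: (GS (N f)).
  apply: (neumann_preserves cG _ Nlim) => // h Gh.
  by rewrite bopZE rE; apply: GZ => //; exact: GS.
Qed.

End hille_yosida.

(** * Eventual positivity and the spectral bound *)

Section eventual_positivity.
Variables (R : realType) (K : topologicalType) (cK : compact [set: K]).
Local Notation C := R[i].
Local Notation CK := (Cspace R cK).
Implicit Types (T : R -> boundedOp CK) (f g : CK) (t : R) (z : C).

Lemma sg_uniformly_bounded T :
  (forall f, exists c : R, forall t, 0 <= t -> rnorm (T t f) <= c) ->
  exists2 M : R, 0 < M & forall t, 0 <= t -> rnorm (T t) <= M.
Proof.
move=> pb; apply: contrapT => nb.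
have ex (n : nat) : exists t, 0 <= t /\ n%:R < rnorm (T t).
  apply: contrapT => nt; apply: nb; exists (n%:R + 1); first by rewrite ltr_wpDl.
  move=> t t0; rewrite leNgt; apply/negP => nT.
  by apply: nt; exists t; split=> //; apply: lt_trans nT; rewrite ltrDl.
pose t n := sval (cid (ex n)); have tP n := svalP (cid (ex n)).
have [|c cT] := @uniform_boundedness _ CK (fun n => T (t n)).
  by move=> f; have [c cT] := pb f; exists c => n; apply: cT; have [] := tP n.
have [_] := tP (Num.truncn c).+1; apply/negP; rewrite -leNgt.
by apply: le_trans (cT _) _; apply/ltW; exact: truncnS_gt.
Qed.

Lemma orbit_bounded T f (c t0 : R) : C0_semigroup T ->
  (forall t, t0 <= t -> 0 <= t -> rnorm (T t f) <= c) ->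
  exists c' : R, forall t, 0 <= t -> rnorm (T t f) <= c'.
Proof.
move=> hT cT; have [M M0 MP] := sg_locally_bounded t0 hT.
exists (Num.max c (M * rnorm f)) => t t_ge0; rewrite le_max.
have [tt|/ltW tt] := leP t0 t; first by rewrite cT.
apply/orP; right; apply: le_trans (rnorm_bop _ _) _.
by rewrite ler_wpM2r ?rnorm_ge0// MP// t_ge0.
Qed.

Lemma eq_Cval f g : (forall x, Cval f x = Cval g x) -> f = g.
Proof. exact: CvalP. Qed.

Lemma real_part_ex f : exists g h, [/\ real_fun g, real_fun h & f = g + 'i *: h].
Proof.
have cont (part : C -> R) : (forall a : C, `|part a| <= rnorm (a : C^o)) ->
    (forall a b : C, part (a - b) = part a - part b) ->
    continuous (fun x => (part (Cval f x))%:C : C^o).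
  move=> part1 partB x; apply/cvg_rnormP => e e0.
  have /cvg_rnormP/(_ e e0) := @Cval_continuous _ _ _ f x; apply: filterS => y.
  by apply: le_trans; rewrite -rmorphB cmod_real -partB.
have Rc := cont _ (@Re_le_cmod R) (fun a b => raddfB (@complex.Re R) a b).
have Ic := cont _ (@Im_le_cmod R) (fun a b => raddfB (@complex.Im R) a b).
exists (mkcts Rc : CK), (mkcts Ic : CK); split=> //.
by apply: eq_Cval => x; rewrite [LHS]complexE.
Qed.

Lemma Cval_pm_le f g x : (0 : C) <= Cval f x + Cval g x -> (0 : C) <= Cval f x - Cval g x ->
  rnorm (Cval g x) <= rnorm (Cval f x).
Proof.
case: (Cval f x) => a b; case: (Cval g x) => c d.
rewrite !lecE /= => /andP[/eqP A B] /andP[/eqP A' B'].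
have d0 : d = 0 by lra.
have b0 : b = 0 by lra.
by rewrite d0 b0 !cmod_real ler_norml; apply/andP; split; have := ler_norm a; lra.
Qed.

Definition Cone_fun : CK := cst (1 : C^o).

Lemma Cone_funE x : Cval Cone_fun x = 1. Proof. by []. Qed.

Lemma strongly_pos_nonneg f : strongly_pos_fun f -> nonneg_fun f.
Proof. by move=> [b b0 fb] x; apply: le_trans (fb x); rewrite ler0c ltW. Qed.

Lemma strongly_pos_pos f : [set: K] !=set0 -> strongly_pos_fun f -> pos_fun f.
Proof.
move=> [x _] fp; split; first exact: strongly_pos_nonneg.
by have [b b0 /(_ x)] := fp => + f0; rewrite f0 Cval0 lecR leNgt b0.
Qed.

Lemma strongly_pos_cmp f (w : CK) : strongly_pos_fun w -> real_fun f ->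
  exists2 c : R, 0 <= c & strongly_pos_fun (c%:C *: w + f) /\ strongly_pos_fun (c%:C *: w - f).
Proof.
move=> [b b0 wb] f0; exists ((rnorm f + 1) / b).
  by rewrite divr_ge0 ?(ltW b0)// addr_ge0 ?rnorm_ge0.
have key (g : CK) : real_fun g -> rnorm g = rnorm f ->
    strongly_pos_fun (((rnorm f + 1) / b)%:C *: w + g).
  move=> g0 gf; exists 1 => // x; rewrite CvalD CvalZ.
  have := wb x; have := g0 x; have := Re_le_cmod (Cval g x); have := rnorm_Cval g x.
  rewrite gf; case: (Cval g x) => p q; case: (Cval w x) => r s /= A B ->.
  rewrite !lecE /= => /andP[/eqP -> br]; rewrite !mul0r !subr0 mulr0 !addr0 eqxx /=.
  have n0 := rnorm_ge0 f.
  have : (rnorm f + 1) / b * b <= (rnorm f + 1) / b * r by rewrite ler_wpM2l// divr_ge0 ?(ltW b0)//; lra.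
  by rewrite divfK ?gt_eqF//; move: B; rewrite ler_norml => /andP[]; lra.
split; first exact: key.
apply: key; last by rewrite rnormN.
by move=> x; rewrite CvalN raddfN /= f0 oppr0.
Qed.

(** For real [f] some [a%:C *: w + f] and [a%:C *: w - f] are strongly positive, so from some time
    on the orbit of [f] is dominated by that of [a%:C *: w]. That time depends on [f]; local bounds
    cover what precedes it and uniform boundedness removes the dependence. *)
Lemma dominated_bounded T (w : CK) (c : R) : [set: K] !=set0 -> C0_semigroup T ->
  indiv_ev_strongly_pos T -> strongly_pos_fun w ->
  (forall t, 0 <= t -> rnorm (T t w) <= c) ->
  exists2 M : R, 0 < M & forall t, 0 <= t -> rnorm (T t) <= M.
Proof.
move=> K0 hT evp wp Tw; apply: sg_uniformly_bounded.
have realb f : real_fun f -> exists c : R, forall t, 0 <= t -> rnorm (T t f) <= c.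
  move=> fr; have [a a0 [ap am]] := strongly_pos_cmp wp fr.
  have [t1 t10 t1P] := evp _ (strongly_pos_pos K0 ap).
  have [t2 t20 t2P] := evp _ (strongly_pos_pos K0 am).
  apply: (@orbit_bounded _ _ (a * c) (Num.max t1 t2) hT) => t.
  rewrite ge_max => /andP[tt1 tt2] t0.
  have /strongly_pos_nonneg := t1P t tt1; have /strongly_pos_nonneg := t2P t tt2.
  rewrite linearB linearD !linearZ_LR => A B.
  have c0 : 0 <= c by exact: le_trans (rnorm_ge0 _) (Tw t t0).
  apply: rnorm_le_Cval; first exact: mulr_ge0.
  move=> x; apply: le_trans (Cval_pm_le (f := a%:C *: T t w) (B x) (A x)) _.
  apply: le_trans (rnorm_Cval _ _) _.
  by rewrite rnormZR ger0_norm// ler_wpM2l// Tw.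
move=> f; have [g [h [gr hr ->]]] := real_part_ex f.
have [c1 c1P] := realb g gr; have [c2 c2P] := realb h hr.
exists (c1 + rnorm ('i : C^o) * c2) => t t0; rewrite linearD linearZ_LR.
apply: le_trans (rnormD _ _) _; apply: lerD; first exact: c1P.
by rewrite rnormZ ler_wpM2l ?rnorm_ge0// c2P.
Qed.

Lemma ev_pos_shift T (r : R) : indiv_ev_strongly_pos T ->
  indiv_ev_strongly_pos (sgshift T r%:C).
Proof.
move=> evp f /evp[t0 t00 t0P]; exists t0 => // t /t0P[b b0 bP].
exists (expR (- (t * r)) * b); first by rewrite mulr_gt0 ?expR_gt0.
move=> x; rewrite sgshiftE CvalZ -rmorphN -rmorphM cexp_real mulrN rmorphM /=.
by apply: ler_pM => //; rewrite ler0c ?expR_ge0// ltW.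
Qed.

(** Continuation downwards from the growth bound. Let [r0] be the infimum of the points from which
    on the resolvents preserve the cone; if [r0] exceeded [a], a Neumann step from a point [r1] just
    above [r0] would reach below [r0]. *)
Lemma resolvent_poscone T (a : R) : C0_semigroup T ->
  (forall r : R, a <= r -> resolvent_set (generator T) r%:C) ->
  exists2 S : boundedOp CK, is_resolvent (generator T) a%:C S & preserves (poscone T) S.
Proof.
move=> hT aR.
pose B := [set r : R | a <= r /\ forall r' S, r <= r' ->
  is_resolvent (generator T) r'%:C S -> preserves (poscone T) S].
suff Ba : B a by have [S SP] := aR a (lexx a); exists S => //; exact: Ba.2 (lexx a) SP.
have [M [w [M1 w0 MP]]] := sg_growth hT.
have Bw : B (Num.max a (w + 1)).
  split=> [|r' S]; first by rewrite le_max lexx.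
  rewrite ge_max => /andP[_ wr] SP.
  have [|S' S'P S'c] := @hille_yosida _ _ _ T M w r'%:C hT MP; first by rewrite /=; lra.
  by rewrite (resolvent_unique SP S'P); exact: S'c.
have Blb : has_lbound B by exists a => r [].
have B0 : B !=set0 by exists (Num.max a (w + 1)).
pose r0 := inf B.
have ar0 : a <= r0 by apply: lb_le_inf => // r [].
have [S0 S0P] := aR r0 ar0.
pose c := rnorm S0; have c0 : 0 <= c by exact: rnorm_ge0.
(* Two perturbations have to fit: from [r0] to [r1] over a distance below [d], which at most doubles
   the norm of the resolvent, and from [r1] down to [r0 - d] over at most [2 * d], where
   [2 * d * (2 * (c + 1)) = 2^-1]. *)
pose d := (8 * (c + 1))^-1; have d0 : 0 < d by rewrite invr_gt0; lra.
have dc : d * (c + 1) = 8^-1 by rewrite /d; field; rewrite gt_eqF//; lra.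
have [r1 [ar1 r1P] r1d] := inf_adherent d0 (conj B0 Blb).
have r01 : r0 <= r1 by apply: ge_inf.
have S1ex : exists2 S1, is_resolvent (generator T) r1%:C S1 & rnorm S1 <= 2 * c.
  have [|S1 [S1P S1b _]] := @resolvent_perturb _ _ _ T r0%:C r1%:C S0 S0P.
    rewrite -rmorphB cmod_real ler0_norm ?subr_le0// opprB -/c.
    have : (r1 - r0) * c <= d * (c + 1).
      by apply: ler_pM; rewrite ?subr_ge0//; rewrite -/r0 in r1d; lra.
    by rewrite dc; lra.
  by exists S1 => //; apply: rnorm_bop_le => [|f]; [rewrite mulr_ge0|exact: S1b].
have [S1 S1P S1c] := S1ex.
have Bd : B (Num.max a (r0 - d)).
  split=> [|r' S]; first by rewrite le_max lexx.
  rewrite ge_max => /andP[ar' dr'] SP.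
  have [r1r'|/ltW r'r1] := leP r1 r'; first exact: r1P SP.
  have [|S' [S'P _ S'c]] := @resolvent_perturb _ _ _ T r1%:C r'%:C S1 S1P.
    rewrite -rmorphB cmod_real ger0_norm ?subr_ge0//.
    have : (r1 - r') * rnorm S1 <= (2 * d) * (2 * (c + 1)).
      apply: ler_pM; rewrite ?subr_ge0 ?rnorm_ge0//; first by rewrite -/r0 in r1d; lra.
      by apply: le_trans S1c _; lra.
    move=> /le_trans; apply; have -> : 2 * d * (2 * (c + 1)) = 4 * (d * (c + 1)) by ring.
    rewrite dc; lra.
  rewrite (resolvent_unique SP S'P); apply: S'c; first exact: poscone_cone.
    by exists (r1 - r'); rewrite ?subr_ge0// rmorphB.
  exact: r1P S1P.
have [|] := leP a (r0 - d) => [ad|ad]; first by move: (ge_inf Blb Bd); rewrite -/r0 max_r//; lra.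
by move: Bd; rewrite max_l// ltW.
Qed.

(* The integrals of a positive orbit increase and are dominated by the
   resolvent, so orbits of averages are bounded. *)
Lemma nonneg_axis_resolvent_bounded T : [set: K] !=set0 -> C0_semigroup T ->
  indiv_ev_strongly_pos T ->
  (forall r : R, 0 <= r -> resolvent_set (generator T) r%:C) ->
  exists2 M : R, 0 < M & forall t, 0 <= t -> rnorm (T t) <= M.
Proof.
move=> K0 hT evp rR; have [T0 TD _] := hT.
have [S /resolventP[S1 S2] SP] := resolvent_poscone hT rR.
have onep : strongly_pos_fun Cone_fun by exists 1 => // x; rewrite Cone_funE.
have [t1 t10 t1P] := evp _ (strongly_pos_pos K0 onep).
pose g := T t1 Cone_fun.
have gT t : 0 <= t -> poscone T (T t g).
  move=> t0 s s0; rewrite -!TD ?addr_ge0//; apply: strongly_pos_nonneg; apply: t1P.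
  by rewrite lerDr addr_ge0.
have gc : poscone T g by have := gT 0 (lexx 0); rewrite T0.
have oc : continuous (sgorbit T g) by exact: sgorbit_continuous.
pose V t := vint 0 t (sgorbit T g).
have V0 t : 0 <= t -> nonneg_fun (V t).
  move=> t0; apply: vint_nonneg => // s /andP[s0 _].
  by rewrite sgorbitE//; exact: gc.
(* [V t = S g - S (T t g)] with [V t] and [S (T t g)] nonnegative, hence [0 <= V t <= S g]
   pointwise. *)
have Vb t : 0 <= t -> rnorm (V t) <= rnorm (S g).
  move=> t0; have := S2 _ _ (gen_integral (f := g) hT t0).
  rewrite scale0r sub0r opprB linearB -/(V t) => VE.
  apply: rnorm_le_Cval => [|x]; first exact: rnorm_ge0.
  apply: le_trans (rnorm_Cval _ x).
  have := V0 t t0 x; have : (0 : C) <= Cval (S (T t g)) x.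
    by have := SP _ (gT t t0) 0 (lexx 0); rewrite T0; exact.
  rewrite -VE CvalB; case: (Cval (S g) x) => a b; case: (Cval (S (T t g)) x) => p q.
  rewrite !lecE /= => /andP[/eqP A B] /andP[/eqP A' B'].
  have q0 : q = 0 by lra.
  have b0 : b = 0 by lra.
  have {}B : 0 <= p := B; have {}B' : 0 <= a - p := B'.
  have -> : (a +i* b) - (p +i* q) = (a - p)%:C by rewrite q0 b0 rmorphB.
  by rewrite b0 !cmod_real !ger0_norm; lra.
have [b b0 gb] : strongly_pos_fun g by apply: t1P.
have b2 : 0 < b / 2 by rewrite divr_gt0.
have [d d0 dP] := sg_orbit_right g hT b2.
(* Up to time [h] the orbit stays within [b / 2] of [g >= b], so [V h] is strongly positive and can
   play the dominating function. *)
pose h := d / 2; have h0 : 0 < h by rewrite divr_gt0.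
have wp : strongly_pos_fun (V h).
  exists (h * (b / 2)); first by rewrite mulr_gt0.
  move=> x; have := @vint_dist _ _ _ 0 h (sgorbit T g) g (b / 2) (ltW h0) oc.
  rewrite subr0 -/(V h) => H.
  have {}H : rnorm (V h - h%:C *: g) <= b / 2 * h.
    apply: H => s /andP[s0 sh]; rewrite sgorbitE//; apply: dP; rewrite s0 /=.
    by rewrite /h in sh; lra.
  have := le_trans (Re_le_cmod _) (le_trans (rnorm_Cval _ x) H).
  have := gb x; have := V0 h (ltW h0) x.
  rewrite CvalB CvalZ; case: (Cval (V h) x) => p q; case: (Cval g x) => r s.
  rewrite !lecE /= => /andP[/eqP -> p0] /andP[/eqP -> br]; rewrite eqxx /=.
  rewrite !mul0r subr0 ler_norml => /andP[A _].
  have : h * b <= h * r by rewrite ler_wpM2l// ltW.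
  lra.
apply: (dominated_bounded (c := rnorm (S g) + rnorm (S g)) K0 hT evp wp) => t t0.
have -> : T t (V h) = V (t + h) - V t.
  have th : t <= t + h by rewrite lerDl ltW.
  rewrite /V (vint_cat t0 th oc) addrC addKr -vint_bop ?(ltW h0)//.
  have := @vint_shift _ _ _ 0 h t (sgorbit T g) (ltW h0) oc.
  rewrite add0r [h + t]addrC => <-; apply: eq_vint; first exact: ltW.
  - by move=> s; apply: bop_cvg; exact: oc.
  - move=> s; apply: (@cvg_comp _ _ _ (fun s => s + t) _ _ (nbhs (s + t))); last exact: oc.
    by apply: cvgD; [exact: cvg_id|exact: cvg_cst].
  - move=> s /andP[s0 _]; rewrite !sgorbitE// ?addr_ge0//.
    by rewrite -TD// addrC.
apply: le_trans (rnormB _ _) _; apply: lerD; apply: Vb => //.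
by rewrite addr_ge0// ltW.
Qed.

Lemma spectrum_ubound T (M a : R) : C0_semigroup T ->
  (forall t, 0 <= t -> rnorm (T t) <= M * expR (a * t)) ->
  ubound [set complex.Re z | z in spectrum (generator T)] a.
Proof.
move=> hT TM _ [z zA <-]; rewrite leNgt; apply/negP => az; apply: zA.
by have [S SP _] := hille_yosida hT TM az; exists S.
Qed.

Lemma right_half_line_resolvent T (l : R) : C0_semigroup T ->
  spectral_bound (generator T) < l -> resolvent_set (generator T) l%:C.
Proof.
move=> hT sl; apply: contrapT => lA; have [M [w [_ _ MP]]] := sg_growth hT.
have hub : has_ubound [set complex.Re z | z in spectrum (generator T)].
  by exists w; exact: spectrum_ubound MP.
have H : [set complex.Re z | z in spectrum (generator T)] l by exists l%:C.
by have := ub_le_sup hub H; rewrite leNgt sl.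
Qed.

Lemma spectral_bound_in_spectrum T : [set: K] !=set0 -> C0_semigroup T ->
  indiv_ev_strongly_pos T -> spectrum (generator T) !=set0 ->
  spectrum (generator T) (spectral_bound (generator T))%:C.
Proof.
move=> K0 hT evp sp0; set A := generator T; set s := spectral_bound A.
have ne : [set complex.Re z | z in spectrum A] !=set0 by case: sp0 => z zA; exists (complex.Re z), z.
apply: contrapT => /contrapT [S SP].
pose c := rnorm S; have c0 : 0 <= c by exact: rnorm_ge0.
pose d := (2 * (c + 1))^-1; have d0 : 0 < d by rewrite invr_gt0; lra.
have rR (r : R) : s - d <= r -> resolvent_set A r%:C.
  move=> dr; have [sr|rs] := ltP s r; first exact: right_half_line_resolvent.
  have [|S' [S'P _ _]] := @resolvent_perturb _ _ _ T s%:C r%:C S SP; last by exists S'.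
  rewrite -rmorphB cmod_real ger0_norm ?subr_ge0//.
  have : (s - r) * c <= d * (c + 1) by apply: ler_pM; rewrite ?subr_ge0//; lra.
  by have -> : d * (c + 1) = 2^-1 by rewrite /d; field; rewrite gt_eqF//; lra.
have hT' := sgshift_sg (s - d)%:C hT.
have [|M' M'0 M'P] := nonneg_axis_resolvent_bounded K0 hT' (ev_pos_shift (s - d) evp).
  move=> r r0; have [|S' S'P] := rR (s - d + r); first by rewrite lerDl.
  exists S'; have := resolvent_shift (s - d)%:C hT S'P.
  by rewrite -rmorphB (addrC (s - d + r)) addKr.
have : s <= s - d.
  apply: ge_sup => //; apply: (spectrum_ubound (M := M') hT) => t t0.
  have := M'P t t0; rewrite /sgshift rnormZ cmod_cexp.
  have -> : complex.Re (t%:C * - (s - d)%:C) = - ((s - d) * t) by rewrite /= mul0r subr0 mulrN mulrC.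
  by rewrite expRN mulrC ler_pdivrMr ?expR_gt0.
lra.
Qed.

End eventual_positivity.

(** * Uniqueness of residues and poles of the resolvent *)

Section laurent_uniqueness.
Variables (R : realType) (V : normedModType R[i]).
Local Notation C := R[i].

Lemma cvg_rnorm_bounded (u : nat -> V) (l : V) : u @ \oo --> l ->
  exists2 c : R, 0 <= c & forall n, rnorm (u n) <= c.
Proof.
move=> /cvg_rnormP/(_ 1 ltr01)[N _ NP].
have s0 : 0 <= \sum_(k < N) rnorm (u k) by apply: sumr_ge0 => k _; exact: rnorm_ge0.
have l0 := rnorm_ge0 l.
exists (\sum_(k < N) rnorm (u k) + (rnorm l + 1)); first by lra.
move=> n; have [nN|Nn] := ltnP n N.
  rewrite (bigD1 (Ordinal nN)) //= -addrA lerDl addr_ge0//; last lra.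
  by apply: sumr_ge0 => k _; exact: rnorm_ge0.
have := NP n Nn; have := rnorm_le_dist (u n) l; rewrite rnorm_distC; lra.
Qed.

Lemma cvg_series_bounded (u : nat -> V) (l : V) : series u @ \oo --> l ->
  exists2 c : R, 0 <= c & forall n, rnorm (u n) <= c.
Proof. by move=> ul; apply: (@cvg_rnorm_bounded u 0); apply: cvg_series_cvg_0; exact: cvgP ul. Qed.

Lemma rnorm_lim_le (u : nat -> V) (l v : V) (c : R) n : u @ \oo --> l ->
  (forall k, rnorm (u (n + k)%N - v) <= c) -> rnorm (l - v) <= c.
Proof.
move=> /cvg_rnormP ul uc; apply/ler_addgt0Pr => e e0.
have [N _ NP] := ul e e0; have := NP (n + N)%N (leq_addl _ _).
have := uc N; have := rnorm_triangle l (u (n + N)%N) v; lra.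
Qed.

Lemma root_of_unity_ex (N : nat) : (0 < N)%N -> exists w : C,
  [/\ rnorm (w : C^o) = 1, w ^+ N = 1 & forall m, (0 < m < N)%N -> w ^+ m != 1].
Proof.
move=> N0; pose x : R := pi *+ 2 / N%:R.
have N0' : N%:R != 0 :> R by rewrite pnatr_eq0 -lt0n.
have cexpn m : cexp (0 +i* x) ^+ m = cexp (0 +i* (m%:R * x)).
  elim: m => [|m IH]; first by rewrite expr0 mul0r cexp0.
  rewrite exprS IH -cexpD; congr cexp; apply/eqP.
  by rewrite eq_complex /= addr0 eqxx -natr1 mulrDl mul1r addrC eqxx.
exists (cexp (0 +i* x)); split.
- by rewrite cmod_cexp expR0.
- by rewrite cexpn /x mulrCA divff// mulr1 /cexp /= expR0 mul1r cos2pi sin2pi.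
- move=> m /andP[m0 mN]; rewrite cexpn /cexp /= expR0 mul1r.
  (* With the half angle [y], [cos (y + y) = 1] would force [sin y = 0], although [0 < y < pi]. *)
  apply/eqP => -[+ _]; pose y := m%:R * x / 2.
  have -> : m%:R * x = y + y by rewrite /y; field.
  rewrite cosD -!expr2 => c1.
  have y0 : 0 < sin y.
    have x0 : 0 < x by rewrite divr_gt0 ?ltr0n// pmulrn_rgt0// pi_gt0.
    apply: sin_gt0_pi; apply/andP; split; first by rewrite /y divr_gt0// mulr_gt0// ltr0n.
    rewrite /y /x.
    have -> : m%:R * (pi *+ 2 / N%:R) / 2 = (pi : R) * (m%:R / N%:R).
      by rewrite -mulr_natr; field.
    by rewrite gtr_pMr ?pi_gt0// ltr_pdivrMr ?ltr0n// mul1r ltr_nat.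
  have := cos2Dsin2 y; have : 0 < sin y ^+ 2 by rewrite exprn_gt0.
  lra.
Qed.

Lemma sum_root_of_unity (w : C) (N m : nat) : w ^+ N = 1 -> w ^+ m != 1 ->
  \sum_(j < N) w ^+ j ^+ m = 0.
Proof.
move=> wN wm.
have : (w ^+ m) ^+ N - 1 = (w ^+ m - 1) * \sum_(j < N) (w ^+ m) ^+ j by rewrite subrX1.
rewrite -exprM mulnC exprM wN expr1n subrr => /esym/eqP.
rewrite mulf_eq0 subr_eq0 (negPf wm) /= => /eqP S0; rewrite -[RHS]S0.
by apply: eq_bigr => j _; rewrite -!exprM mulnC.
Qed.

Lemma cvg_big_sum (N : nat) (u : nat -> nat -> V) (l : nat -> V) :
  (forall j, (j < N)%N -> u j @ \oo --> l j) ->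
  (fun n => \sum_(j < N) u j n) @ \oo --> \sum_(j < N) l j.
Proof.
elim: N => [|N IH] ul.
  by rewrite big_ord0; under eq_fun do rewrite big_ord0; exact: cvg_cst.
rewrite big_ord_recr /=; under eq_fun do rewrite big_ord_recr.
by apply: cvgD; [apply: IH => j jN; apply: ul; exact: ltnW|exact: ul].
Qed.

(* Averaging over the [N]-th roots of unity on a circle of radius [rho] kills
   all coefficients but the one of index -1 and those of index at least [N - 1]
   in absolute value, which decay geometrically. *)
Lemma laurent_zero_residue (a b : nat -> V) (r : R) : 0 < r ->
  (forall z : C, 0 < rnorm (z : C^o) < r -> exists G : V,
    [series z ^+ n *: a n]_n @ \oo --> G /\ [series z ^- n.+1 *: b n]_n @ \oo --> - G) ->
  b 0%N = 0.
Proof.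
move=> r0 ab.
have real_bound (s : R) : 0 < s < r -> exists2 c : R, 0 <= c &
    forall n, rnorm (a n) * s ^+ n <= c /\ rnorm (b n) * s ^- n.+1 <= c.
  move=> /andP[s0 sr]; have [|G [aG bG]] := ab s%:C.
    by rewrite cmod_real gtr0_norm// s0.
  have [c1 c10 c1P] := cvg_series_bounded aG; have [c2 c20 c2P] := cvg_series_bounded bG.
  exists (c1 + c2) => [|n]; first exact: addr_ge0.
  have := c1P n; have := c2P n; rewrite !rnormZ cmodV !cmodX cmod_real gtr0_norm//.
  rewrite [X in X <= c2]mulrC [X in X <= c1]mulrC; lra.
(* The averaging circle of radius [r / 4] lies a factor 2 inside the radius where the terms of [a]
   are bounded and a factor 2 outside the one used for [b]; both families of terms then decay like
   [2^-1 ^+ n] on it. *)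
have [|ca ca0 caP] := real_bound (r / 2); first by apply/andP; split; lra.
have [|cb cb0 cbP] := real_bound (r / 8); first by apply/andP; split; lra.
have [rho rho0 rhoE] : exists2 rho, 0 < rho & rho = r / 4 by exists (r / 4); rewrite ?divr_gt0.
pose c := ca + cb; have c0 : 0 <= c by rewrite addr_ge0.
have aP n : rnorm (a n) * rho ^+ n <= c * 2^-1 ^+ n.
  have [H _] := caP n; have -> : rho = r / 2 * 2^-1 by rewrite rhoE; field.
  rewrite [X in _ * X]exprMn mulrA; rewrite ler_wpM2r ?exprn_ge0 ?invr_ge0//.
  by apply: le_trans H _; rewrite lerDl.
have bP n : rnorm (b n) * rho ^- n.+1 <= c * 2^-1 ^+ n.
  have [_ H] := cbP n; have -> : rho = r / 8 * 2 by rewrite rhoE; field.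
  rewrite [X in _ * X^-1]exprMn invfM mulrA.
  apply: (@le_trans _ _ (c * 2 ^- n.+1)).
    by rewrite ler_wpM2r ?invr_ge0 ?exprn_ge0//; apply: le_trans H _; rewrite lerDr.
  by rewrite -exprVn ler_wpM2l// exprS ler_piMl ?exprn_ge0 ?invr_ge0//; lra.
have key (N : nat) : rnorm (b 0%N) <= 4 * (rho * c) * 2^-1 ^+ N.
  have [w [w1 wN wm]] := root_of_unity_ex (ltn0Sn N).
  pose z j : C := rho%:C * w ^+ j.
  have zn j : rnorm (z j : C^o) = rho by rewrite cmodM cmodX w1 expr1n mulr1 cmod_real gtr0_norm.
  pose S j n := \sum_(0 <= k < n) z j ^+ k *: a k + \sum_(0 <= k < n) z j ^- k.+1 *: b k.
  have S0 j : S j @ \oo --> (0 : V).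
    have [|G [aG bG]] := ab (z j); first by rewrite zn rho0 rhoE; lra.
    by rewrite -(subrr G); exact: cvgD aG bG.
  (* The factor [z j] moves the exponents up by one, so that [b 0] is multiplied by the power 0,
     whose average over the roots does not vanish. *)
  pose B n := \sum_(j < N.+1) z j *: S j n.
  have B0 : B @ \oo --> (0 : V).
    have := @cvg_big_sum N.+1 (fun j n => z j *: S j n) (fun j => z j *: 0).
    rewrite [X in _ --> X]big1 => [|j _]; last by rewrite scaler0.
    by apply=> j _; apply: cvgZl_tmp; exact: S0.
  pose U n := \sum_(0 <= k < n) (\sum_(j < N.+1) z j ^+ k.+1) *: a k.
  pose W n := \sum_(0 <= k < n) (\sum_(j < N.+1) z j ^- k) *: b k.
  have z0 j : z j != 0 by rewrite -cmod_gt0 zn.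
  have BE n : B n = U n + W n.
    rewrite /B /U /W; under eq_bigr do rewrite scalerDr !scaler_sumr.
    rewrite big_split /=; congr (_ + _); rewrite exchange_big /=; apply: eq_bigr => k _.
      by rewrite scaler_suml; apply: eq_bigr => j _; rewrite scalerA -exprS.
    rewrite scaler_suml; apply: eq_bigr => j _; rewrite scalerA exprS invfM mulrA divff ?mul1r//.
  have sumz0 k : (0 < k < N.+1)%N -> \sum_(j < N.+1) z j ^+ k = 0.
    move=> kN; under eq_bigr do rewrite exprMn.
    by rewrite -mulr_sumr sum_root_of_unity ?mulr0//; exact: wm.
  have sumz0' k : (0 < k < N.+1)%N -> \sum_(j < N.+1) z j ^- k = 0.
    move=> kN; under eq_bigr do rewrite -exprVn invfM exprMn -exprVn.
    rewrite -mulr_sumr sum_root_of_unity ?mulr0// ?exprVn ?wN ?invr1//.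
    by apply: contra_neq (wm k kN) => wk; rewrite -[LHS]invrK wk invr1.
  have summ (F : nat -> C) (e : R) : (forall j, rnorm (F j : C^o) = e) ->
      rnorm (\sum_(j < N.+1) F j : C^o) <= N.+1%:R * e.
    move=> Fe; elim: (N.+1) => [|n IH]; first by rewrite big_ord0 rnorm0 mul0r.
    rewrite big_ord_recr -natr1 mulrDl mul1r; apply: le_trans (rnormD _ _) _.
    by rewrite Fe lerD2r.
  pose D := N.+1%:R * (rho * c); have D0 : 0 <= D by rewrite !mulr_ge0// ltW.
  have Us n : rnorm (U n.+1 - U n) <= D * 2^-1 ^+ n.
    rewrite /U big_nat_recr//= [X in rnorm X]addrC addKr rnormZ.
    have zX j : rnorm (z j ^+ n.+1 : C^o) = rho ^+ n.+1 by rewrite cmodX zn.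
    apply: (le_trans (ler_wpM2r (rnorm_ge0 (a n)) (summ (fun j => z j ^+ n.+1) _ zX))).
    rewrite /D exprS -!mulrA ler_wpM2l// (ler_wpM2l (ltW rho0))//.
    by rewrite mulrC.
  have Ws n : rnorm (W n.+1 - W n) <= D * 2^-1 ^+ n.
    rewrite /W big_nat_recr//= [X in rnorm X]addrC addKr rnormZ.
    have zX j : rnorm (z j ^- n : C^o) = rho ^- n by rewrite cmodV cmodX zn.
    apply: (le_trans (ler_wpM2r (rnorm_ge0 (b n)) (summ (fun j => z j ^- n) _ zX))).
    have -> : rho ^- n = rho * rho ^- n.+1 by rewrite exprS invfM mulrA divff ?mul1r// gt_eqF.
    by rewrite /D -!mulrA ler_wpM2l// (ler_wpM2l (ltW rho0))// mulrC.
  (* In [U] the exponents [k.+1] with [k < N] average to 0, in [W] the exponents [k] with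
     [0 < k < N.+1]: up to the tails only [b 0] is left. *)
  have UN : U N = 0.
    rewrite /U big1_seq// => k; rewrite mem_index_iota => /andP[_ /andP[_ kN]].
    by rewrite sumz0 ?scale0r.
  have WN : W N.+1 = N.+1%:R *: b 0%N.
    rewrite /W big_nat_recl//= [X in _ + X]big1_seq ?addr0 => [|k].
      rewrite (eq_bigr (fun=> 1)) ?sumr_const ?card_ord// => j _.
      by rewrite invr1.
    rewrite mem_index_iota => /andP[_ /andP[_ kN]].
    by rewrite sumz0' ?scale0r.
  have half : (2^-1 : R) <= 2^-1 by [].
  have half0 : 0 <= 2^-1 :> R by rewrite invr_ge0.
  have := @rnorm_lim_le B 0 (N.+1%:R *: b 0%N) (4 * D * 2^-1 ^+ N) N.+1 B0.
  rewrite sub0r rnormN => H.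
  have {}H : rnorm (N.+1%:R *: b 0%N) <= 4 * D * 2^-1 ^+ N.
    apply: H => k; rewrite BE.
    have := geometric_step D0 half0 half Us N k.+1; rewrite UN subr0 addnS -addSn.
    have := geometric_step D0 half0 half Ws N.+1 k; rewrite WN.
    have : 2^-1 ^+ N.+1 <= 2^-1 ^+ N :> R by rewrite exprS ler_piMl ?exprn_ge0//; lra.
    move=> /(ler_wpM2l D0).
    have := rnormD (U (N.+1 + k)%N) (W (N.+1 + k)%N - N.+1%:R *: b 0%N).
    rewrite addrA; lra.
  have Nreal : (N.+1%:R : C) = (N.+1%:R : R)%:C by rewrite rmorph_nat.
  move: H; rewrite Nreal rnormZR ger0_norm// /D => H.
  rewrite -(@ler_pM2l _ N.+1%:R) ?ltr0n//; apply: le_trans H _.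
  by rewrite le_eqVlt; apply/orP; left; apply/eqP; ring.
apply: rnorm_eq0 => e e0.
have : (fun n => 4 * (rho * c) * 2^-1 ^+ n) @ \oo --> 4 * (rho * c) * 0.
  by apply: cvgM; [exact: cvg_cst|apply: cvg_expr; rewrite ger0_norm ?invr_ge0//; lra].
rewrite mulr0 => /cvgrPdist_le/(_ e e0)[N _ /(_ N (leqnn N))].
rewrite sub0r normrN => /(le_trans (ler_norm _)).
exact: le_trans (key N).
Qed.

Lemma laurent_residue_unique (F : C -> V) (z0 : C) (a b : int -> V) :
  laurent_expansion F z0 a -> laurent_expansion F z0 b -> a (- 1%:Z) = b (- 1%:Z).
Proof.
move=> [r1 r10 aP] [r2 r20 bP]; apply/eqP; rewrite -subr_eq0; apply/eqP.
apply: (@laurent_zero_residue (fun n => a (Posz n) - b (Posz n))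
  (fun n => a (Negz n) - b (Negz n)) (Num.min r1 r2)); first by rewrite lt_min r10.
move=> z /andP[z_gt0]; rewrite lt_min => /andP[zr1 zr2].
have zE : z = z0 + z - z0 by rewrite addrC addKr.
have zabs : `|z0 + z - z0| = (rnorm (z : C^o))%:C by rewrite -zE -(rnormE (z : C^o)).
have [|G1 [H1 [E1 aG aH]]] := aP (z0 + z); first by rewrite zabs !ltcR z_gt0.
have [|G2 [H2 [E2 bG bH]]] := bP (z0 + z); first by rewrite zabs !ltcR z_gt0.
rewrite -zE in aG aH bG bH.
have cvgser (u v : nat -> V) l l' : series u @ \oo --> l -> series v @ \oo --> l' ->
    series (fun n => u n - v n) @ \oo --> l - l'.
  by move=> ul vl; apply: cvg_near_eq (cvgB ul vl); apply: nearW => n; rewrite /series /= sumrB.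
exists (G1 - G2); split.
  by apply: cvg_near_eq (cvgser _ _ _ _ aG bG); apply: nearW => n; apply: eq_bigr => k _; rewrite /= scalerBr.
(* Both expansions sum to the same value of [F], so the difference of the regular parts cancels that
   of the principal parts. *)
have -> : - (G1 - G2) = H1 - H2.
  by apply/esym/eqP; rewrite -addr_eq0 addrC addrACA -opprD -E1 -E2 subrr.
by apply: cvg_near_eq (cvgser _ _ _ _ aH bH); apply: nearW => n; apply: eq_bigr => k _; rewrite /= scalerBr.
Qed.

Lemma residueE (F : C -> V) (z0 : C) (a : int -> V) :
  laurent_expansion F z0 a -> residue F z0 = a (- 1%:Z).
Proof.
move=> aP; rewrite /residue.
have : [set c | exists2 b, laurent_expansion F z0 b & b (- 1%:Z) = c] (a (- 1%:Z)) by exists a.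
by move=> /(xgetI 0)[b bP <-]; exact: laurent_residue_unique bP aP.
Qed.

(** Multiplication by [h ^+ m] leaves a power series. Its terms are bounded at radius [r / 2], so
    for [rnorm h < r / 4] they decay with ratio below 1/2 and the remainder after two terms is of
    second order. *)
Lemma pole_expansion (F : C -> V) (z0 : C) (m : nat) (a : int -> V) :
  laurent_expansion F z0 a -> (forall n : nat, (m < n)%N -> a (- n%:Z) = 0) ->
  exists r c : R, [/\ 0 < r, 0 <= c & forall h : C, 0 < rnorm (h : C^o) < r ->
    rnorm (h ^+ m *: F (z0 + h) - a (- m%:Z) - h *: a (1 - m%:Z)) <= c * rnorm (h : C^o) ^+ 2].
Proof.
move=> [r r0 aP] am0; pose b (j : nat) := a (j%:Z - m%:Z).
have bser h : 0 < rnorm (h : C^o) < r ->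
    [series h ^+ n *: b n]_n @ \oo --> h ^+ m *: F (z0 + h).
  move=> hr; have h0 : h != 0 by rewrite -cmod_gt0; case/andP: hr.
  have hE : h = z0 + h - z0 by rewrite addrC addKr.
  have [|G [H [-> aG aH]]] := aP (z0 + h).
    by rewrite -hE -[0]/(0%:C) (rnormE (h : C^o)) !ltcR.
  rewrite -hE in aG aH.
  have HE : h ^+ m *: H = \sum_(0 <= j < m) h ^+ j *: b j.
    have -> : H = \sum_(0 <= k < m) h ^- k.+1 *: a (Negz k).
      apply: (rnorm_cvg_unique _ aH); apply: cvg_near_eq (cvg_cst _).
      exists m => // n /= mn; rewrite /series /= (big_cat_nat _ mn)//= [X in _ + X]big1_seq ?addr0//.
      move=> k; rewrite mem_index_iota => /andP[_ /andP[mk _]].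
      by rewrite (am0 k.+1) ?scaler0.
    rewrite scaler_sumr big_nat_rev /=; apply: eq_big_nat => j /andP[_ jm].
    rewrite add0n scalerA; congr (_ *: _).
      rewrite subnSK// -exprB ?leq_subr ?unitfE// subKn//; exact: ltnW.
    rewrite /b NegzE; congr a; rewrite subnSK// -subzn ?opprB//; exact: ltnW.
  rewrite scalerDr addrC HE -(cvg_shiftn m) /=.
  apply: cvg_near_eq (cvgD (cvg_cst (\sum_(0 <= j < m) h ^+ j *: b j)) (cvgZl_tmp (k := h ^+ m) aG)).
  apply: nearW => n; rewrite /series /=.
  rewrite [RHS](@big_cat_nat _ _ _ m)//= ?leq_addl//; congr (_ + _).
  rewrite -[X in \sum_(X <= _ < _) _]add0n big_addn addnK.
  transitivity (h ^+ m *: \sum_(0 <= k < n) h ^+ k *: a (Posz k)) => [//|].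
  rewrite scaler_sumr.
  apply: eq_bigr => k _.
  by rewrite scalerA -exprD addnC /b PoszD addrK.
have r2 : 0 < r / 2 < r by apply/andP; split; lra.
have [|c c0 cP] := cvg_series_bounded (bser (r / 2)%:C _).
  by rewrite cmod_real gtr0_norm//; case/andP: r2.
exists (r / 4), (2 * c * (r / 2) ^- 2); split; first by rewrite divr_gt0.
  by rewrite !mulr_ge0// invr_ge0 exprn_ge0// divr_ge0// ltW.
move=> h /andP[h0 hr]; pose q := rnorm (h : C^o) / (r / 2).
have rp : 0 < r / 2 by case/andP: r2.
have q0 : 0 <= q by rewrite divr_ge0 ?ltW.
have q1 : q <= 2^-1 by rewrite ler_pdivrMr//; lra.
have hser : [series h ^+ n *: b n]_n @ \oo --> h ^+ m *: F (z0 + h).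
  by apply: bser; rewrite h0 /=; lra.
pose u n := \sum_(0 <= k < n) h ^+ k *: b k.
have us n : rnorm (u n.+1 - u n) <= c * q ^+ n.
  rewrite /u big_nat_recr//= [X in rnorm X]addrC addKr rnormZ cmodX /q exprMn exprVn.
  have := cP n; rewrite rnormZ cmodX cmod_real gtr0_norm// => cn.
  rewrite mulrCA ler_wpM2l ?exprn_ge0 ?(ltW h0)//.
  by rewrite ler_pdivlMr ?exprn_gt0// mulrC.
have := rnorm_lim_le (n := 2) hser (geometric_step c0 q0 q1 us 2).
rewrite [u 2]big_nat_recr//= big_nat1 expr0 scale1r expr1.
rewrite /b sub0r opprD addrA => /le_trans; apply.
by rewrite le_eqVlt; apply/orP; left; apply/eqP; rewrite /q; field; rewrite gt_eqF.
Qed.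

End laurent_uniqueness.

(** * Laurent coefficients of the resolvent at a pole *)

Section pole.
Variables (R : realType) (K : topologicalType) (cK : compact [set: K]).
Local Notation C := R[i].
Local Notation CK := (Cspace R cK).
Implicit Types (T : R -> boundedOp CK) (f g : CK) (z : C).

Lemma resolventE T z : resolvent_set (generator T) z ->
  is_resolvent (generator T) z (resolvent (generator T) z).
Proof. by move=> [S SP]; exact: (xgetI 0 SP). Qed.

(** This stands in for comparing the two lowest coefficients in the resolvent equation near the
    pole. *)
Lemma affine_zero (V : normedModType C) (X Y : V) (c d : R) : 0 < d ->
  (forall h : R, 0 < h < d -> rnorm (X + h%:C *: Y) <= c * h ^+ 2) -> X = 0 /\ Y = 0.
Proof.
move=> d0 XY; pose c' := `|c| + 1.
have c'0 : 0 < c' by rewrite ltr_wpDl.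
have {}XY (h : R) : 0 < h < d -> rnorm (X + h%:C *: Y) <= c' * h ^+ 2.
  move=> /XY /le_trans; apply; rewrite ler_wpM2r ?sqr_ge0// /c'.
  by have := ler_norm c; lra.
have X0 : X = 0.
  apply: rnorm_eq0 => e e0; have n0 := rnorm_ge0 Y.
  pose q := rnorm Y + c'; have q0 : 0 < q by rewrite ltr_wpDl.
  pose h := Num.min (Num.min (d / 2) 1) (e / q).
  have h0 : 0 < h by rewrite !lt_min !divr_gt0// ltr01.
  have hd : h < d by rewrite !gt_min; apply/orP; left; apply/orP; left; lra.
  have h1 : h <= 1 by rewrite !ge_min lexx orbT.
  have he : h * q <= e by rewrite -ler_pdivlMr// ge_min lexx orbT.
  have := XY h; rewrite h0 hd => /(_ isT) A.
  have := rnorm_le_dist X (- (h%:C *: Y)); rewrite rnormN opprK rnormZR gtr0_norm//.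
  have : h ^+ 2 <= h by rewrite expr2 ler_piMr// ltW.
  move=> /(ler_wpM2l (ltW c'0)); move: he; rewrite /q; lra.
split => //; apply: rnorm_eq0 => e e0.
pose h := Num.min (d / 2) (e / c').
have h0 : 0 < h by rewrite !lt_min !divr_gt0.
have hd : h < d by rewrite gt_min; apply/orP; left; lra.
have he : c' * h <= e by rewrite mulrC -ler_pdivlMr// ge_min lexx orbT.
have := XY h; rewrite h0 hd X0 add0r rnormZR gtr0_norm// => /(_ isT).
by rewrite expr2 mulrA mulrC ler_pM2r// => /le_trans; apply.
Qed.

(* [z0] is a pole of order at most [m] of the resolvent, and [c0], [c1] are the
   Laurent coefficients of index [-m] and [1 - m]. *)
Definition pole_data T (z0 : C) (m : nat) (c0 c1 : boundedOp CK) (r c : R) :=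
  [/\ 0 < r, 0 <= c & forall h : C, 0 < rnorm (h : C^o) < r ->
    is_resolvent (generator T) (z0 + h) (resolvent (generator T) (z0 + h)) /\
    rnorm (h ^+ m *: resolvent (generator T) (z0 + h) - c0 - h *: c1) <= c * rnorm (h : C^o) ^+ 2].

Lemma pole_dataP T (z0 : C) : resolvent_pole (generator T) z0 ->
  exists m c0 c1 r c, [/\ (0 < m)%N, c0 <> 0, pole_data T z0 m c0 c1 r c &
    m = 1%N -> spectral_projection (generator T) z0 = c0].
Proof.
move=> [[_ [V Vz0 VA]] [m [a [m0 aP am am0]]]].
have [r1 [c [r10 c0 H]]] := pole_expansion aP am0.
have [r2 r20 r2P] : exists2 r2 : R, 0 < r2 & forall h : C, rnorm (h : C^o) < r2 -> V (z0 + h).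
  have /nbhs_ballP[[p q]] := Vz0; rewrite /= ltcE /= => /andP[/eqP -> p0] pV.
  exists p => // h hp; apply: pV; rewrite -ball_normE /= opprD addrA subrr sub0r normrN.
  by rewrite (rnormE (h : C^o)) ltcR.
exists m, (a (- m%:Z)), (a (1 - m%:Z)), (Num.min r1 r2), c; split=> //.
- exact/eqP.
- split=> //; first by rewrite lt_min r10.
  move=> h /andP[h0]; rewrite lt_min => /andP[hr1 hr2].
  split; last by apply: H; rewrite h0.
  apply: resolventE; apply: contrapT => zA.
  have : (V `&` (spectrum (generator T) : set C^o)) (z0 + h) by split; [exact: r2P|].
  rewrite VA /= => /eqP; rewrite -subr_eq0 addrC addKr => /eqP h00.
  by move: h0; rewrite h00 rnorm0 ltxx.
- by move=> m1; rewrite /spectral_projection (residueE aP) m1.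
Qed.

(** Coefficients of [h ^+ 0] and [h ^+ 1] in [(z0 + h - A) (h ^+ m *: Rh f) = h ^+ m *: f]; the
    right-hand side contributes to the second one only if [m = 1]. As [A] is unbounded, the
    comparison is made after applying the bounded resolvent [S] at a fixed point [mu], where the two
    equations read [X = 0] and [Y = 0]. *)
Lemma pole_data_gen T (z0 : C) m c0 c1 r c f : (0 < m)%N -> pole_data T z0 m c0 c1 r c ->
  gen T (c0 f) (z0 *: c0 f) /\
  gen T (c1 f) (z0 *: c1 f + c0 f - (if m == 1%N then f else 0)).
Proof.
move=> m0 [r0 c_ge0 H]; pose d := if m == 1%N then f else 0.
pose h1 : C := (r / 2)%:C; pose mu := z0 + h1.
have [|/resolventP[S1 S2] _] := H h1.
  by rewrite cmod_real gtr0_norm ?divr_gt0//; apply/andP; split; lra.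
rewrite -/mu in S1 S2; set S := resolvent _ mu in S1 S2.
pose X := c0 f - S (h1 *: c0 f).
pose Y := c1 f - S (h1 *: c1 f - c0 f + d).
suff [/eqP X0 /eqP Y0] : X = 0 /\ Y = 0.
  rewrite !subr_eq0 in X0 Y0; split.
    have := S1 (h1 *: c0 f); rewrite -(eqP X0) -scalerBl /mu addrK//.
  have := S1 (h1 *: c1 f - c0 f + d); rewrite -(eqP Y0).
  congr (gen _ _ _); apply: eq_Cval => x.
  have id (p q a b l : C) : (p + q) * a - (q * a - b + l) = p * a + b - l by ring.
  exact: id.
pose nf := rnorm f.
pose B := c * nf + rnorm S * (rnorm (c1 f) + (r / 2 + 1) * (c * nf) + nf).
apply: (@affine_zero _ X Y B (Num.min r 1)); first by rewrite lt_min r0 ltr01.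
move=> h /andP[h0]; rewrite lt_min => /andP[hr h1'].
have [|/resolventP[H1 _] H2] := H h%:C; first by rewrite cmod_real gtr0_norm// h0.
set Rh := resolvent _ _ in H1 H2; pose u := h%:C ^+ m *: Rh f.
have uE : u = S ((h1 - h%:C) *: u + h%:C ^+ m *: f).
  rewrite -[LHS](S2 _ _ (genZ (z := h%:C ^+ m) (H1 f))); congr (S _).
  apply: eq_Cval => x.
  have id (p q k s l n : C) : (p + q) * (k * s) - k * ((p + l) * s - n) =
    (q - l) * (k * s) + k * n by ring.
  exact: id.
pose e := u - c0 f - h%:C *: c1 f.
have eb : rnorm e <= c * nf * h ^+ 2.
  have := rnorm_bop (h%:C ^+ m *: Rh - c0 - h%:C *: c1) f.
  rewrite !bopBE !bopZE -/u -/e => /le_trans; apply.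
  rewrite mulrAC ler_wpM2r ?rnorm_ge0//.
  by apply: le_trans H2 _; rewrite cmod_real gtr0_norm.
pose d' := h%:C ^+ m *: f - h%:C *: d.
have d'b : rnorm d' <= nf * h ^+ 2.
  rewrite /d' /d; case: eqP => [->|m1].
    by rewrite expr1 subrr rnorm0 mulr_ge0 ?rnorm_ge0// sqr_ge0.
  rewrite scaler0 subr0 rnormZ cmodX cmod_real gtr0_norm// mulrC ler_wpM2l ?rnorm_ge0//.
  apply: ler_wiXn2l; rewrite ?ltW//.
  by case: (m) m0 m1 => [//|[//|]].
have XYE : X + h%:C *: Y = S ((h1 - h%:C) *: e - h%:C ^+ 2 *: c1 f + d') - e.
  have -> : (h1 - h%:C) *: e - h%:C ^+ 2 *: c1 f + d' =
      ((h1 - h%:C) *: u + h%:C ^+ m *: f) -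
      (h1 *: c0 f + h%:C *: (h1 *: c1 f - c0 f + d)).
    apply: eq_Cval => x.
    have id (a b p q s k l n : C) : (a - b) * (p - q - b * s) - b ^+ 2 * s + (k * n - b * l) =
      (a - b) * p + k * n - (a * q + b * (a * s - q + l)) by ring.
    exact: id.
  have SB (p q k : CK) : S (p - (q + h%:C *: k)) = S p - (S q + h%:C *: S k).
    by rewrite linearB linearD linearZ_LR.
  rewrite SB -uE.
  apply: eq_Cval => x.
  have id (p q k s l n : C) : (p - q) + k * (s - l) = n - (q + k * l) - (n - p - k * s) by ring.
  exact: id.
rewrite XYE; apply: le_trans (rnormB _ _) _.
have r2 : rnorm (h1 - h%:C : C^o) <= r / 2 + 1.
  apply: le_trans (rnormB _ _) _; rewrite !cmod_real !gtr0_norm ?divr_gt0//; lra.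
have : rnorm ((h1 - h%:C) *: e - h%:C ^+ 2 *: c1 f + d') <=
    (rnorm (c1 f) + (r / 2 + 1) * (c * nf) + nf) * h ^+ 2.
  apply: le_trans (rnormD _ _) _; rewrite [leRHS]mulrDl; apply: lerD => //.
  apply: le_trans (rnormB _ _) _; rewrite mulrDl addrC; apply: lerD.
    by rewrite rnormZ cmodX cmod_real gtr0_norm// mulrC.
  by rewrite rnormZ -mulrA; apply: ler_pM; rewrite ?rnorm_ge0.
move=> /(ler_wpM2l (rnorm_ge0 S)) /(le_trans (rnorm_bop _ _)).
by rewrite /B; move: eb; lra.
Qed.

End pole.

(** * Fejer kernels and a Tauberian theorem *)

Section oscillation.
Variable R : realType.
Local Notation C := R[i].

Definition ecis (x : R) : C := cexp (0 +i* x).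

Lemma ecisD x y : ecis (x + y) = ecis x * ecis y.
Proof.
by rewrite /ecis -cexpD; congr cexp; apply/eqP; rewrite eq_complex /= addr0 !eqxx.
Qed.

Lemma ecis0 : ecis 0 = 1. Proof. exact: cexp0. Qed.

Lemma cmod_ecis x : rnorm (ecis x : C^o) = 1.
Proof. by rewrite cmod_cexp expR0. Qed.

Lemma ecisNK x : ecis x * ecis (- x) = 1.
Proof. by rewrite -ecisD subrr ecis0. Qed.

Lemma ecis_pi : ecis pi = -1.
Proof.
rewrite /ecis /cexp /= expR0 mul1r cospi sinpi; apply/eqP.
by rewrite eq_complex /= oppr0 !eqxx.
Qed.

Lemma ecis_cos x : ecis x + ecis (- x) = (2 * cos x)%:C.
Proof.
rewrite /ecis /cexp /= expR0 !mul1r cosN sinN; apply/eqP.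
by rewrite eq_complex /= subrr eqxx andbT; apply/eqP; ring.
Qed.

Lemma ecis_lip x y : rnorm (ecis x - ecis y : C^o) <= `|x - y|.
Proof.
wlog xy : x y / y <= x => [H|].
  by have [/H//|/ltW/H] := leP y x; rewrite distrC rnorm_distC.
have eE (t : R) : ecis t = cexp (t%:C * (0 +i* 1)).
  by rewrite /ecis; congr cexp; apply/eqP; rewrite eq_complex /= !mul0r mulr0 mulr1 addr0 subr0 !eqxx.
have ed t : rderiv (fun t : R => ecis t : C^o) t ((0 +i* 1) * ecis t).
  rewrite (eE t); apply: rderiv_ext (cexp_rderiv _ _) => r; exact/esym/eE.
have ec : continuous (fun t : R => ecis t : C^o).
  suff [dc ds] : continuous (@cos R) /\ continuous (@sin R).
    move=> t; apply/cvg_rnormP => e e0; have e2 : 0 < e / 2 by rewrite divr_gt0.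
    have /cvgrPdist_le/(_ _ e2) A := dc t; have /cvgrPdist_le/(_ _ e2) B := ds t.
    apply: filterS2 A B => s A B; rewrite /ecis /cexp /= expR0 !mul1r.
    by apply: le_trans (cmod_le _) _ => /=; lra.
  by split=> t; [exact: continuous_cos|exact: continuous_sin].
have := @mean_value_const _ _ (fun t : R => ecis t : C^o) (fun t => (0 +i* 1) * ecis t) 1 y x xy.
rewrite mul1r ger0_norm ?subr_ge0//; apply=> [t _|t _|t _].
- exact: ec.
- exact: ed.
- by rewrite cmodM cmod_ecis mulr1 /rnorm normc_def /= expr0n expr1n add0r sqrtr1.
Qed.

Lemma ecis_continuous (s : R) : continuous (fun t : R => ecis (t * s) : C^o).
Proof.
move=> t; apply/cvg_rnormP => e e0.
have s1 : 0 < `|s| + 1 by rewrite ltr_wpDl.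
exists (e / (`|s| + 1)) => /=; first by rewrite divr_gt0.
move=> r; rewrite /ball /= ltr_pdivlMr// => tr; apply: le_trans (ecis_lip _ _) _.
rewrite -mulrBl normrM; apply: le_trans (ltW tr).
by rewrite ler_wpM2l// lerDl.
Qed.

(** The Fourier transform of the triangle [1 - |x|] on [[-1, 1]], nonnegative and of order [s ^- 2]
    at infinity; [fejer_weight] is its integrand folded onto [[0, 1]]. *)
Definition fejer (s : R) : R := if s == 0 then 1 else 2 * (1 - cos s) / s ^+ 2.

Definition fejer_weight (s x : R) : C^o := (1 - x)%:C * (ecis (x * s) + ecis (- (x * s))).

Lemma rderiv_real (f : R -> R) (t df : R) : is_derive t 1 f df ->
  rderiv (fun s => (f s)%:C : C^o) t df%:C.
Proof.
move=> fdf e e0; apply: filterS (derive_right fdf e0) => h.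
rewrite [X in rnorm X](_ : _ = (f (t + h) - f t - h * df)%:C) ?cmod_real//.
by rewrite /GRing.scale /= !rmorphB rmorphM.
Qed.

Lemma real_continuous (f : R -> R) : continuous f -> continuous (fun s => (f s)%:C : C^o).
Proof.
move=> fc t; apply/cvg_rnormP => e e0; have /cvgrPdist_le/(_ e e0) := fc t.
by apply: filterS => s; rewrite -rmorphB cmod_real.
Qed.

Lemma fejer_primitive s : exists F : R -> C^o,
  [/\ continuous F, forall x, rderiv F x (fejer_weight s x) & F 1 - F 0 = (fejer s)%:C].
Proof.
have [->|s0] := eqVneq s 0.
  have d (x : R) : is_derive x 1 (fun x : R => 2 * x - x ^+ 2) (2 * (1 - x)).
    by apply: is_derive_eq; rewrite /GRing.scale /=; ring.
  exists (fun x => (2 * x - x ^+ 2)%:C); split.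
  - apply: real_continuous => x; apply: differentiable_continuous; apply/derivable1_diffP.
    by have [] := d x.
  - move=> x; have := rderiv_real (d x); rewrite /fejer_weight ecis_cos mulr0 cos0 mulr1.
    by rewrite mulrC rmorphM.
  - by rewrite -rmorphB /fejer eqxx; congr (_%:C); ring.
have d (x : R) : is_derive x 1
    (fun x : R => 2 * (s * (1 - x) * sin (x * s) - cos (x * s)) / s ^+ 2) (2 * (1 - x) * cos (x * s)).
  by apply: is_derive_eq; rewrite /GRing.scale /=; field.
exists (fun x => (2 * (s * (1 - x) * sin (x * s) - cos (x * s)) / s ^+ 2)%:C); split.
- apply: real_continuous => x; apply: differentiable_continuous; apply/derivable1_diffP.
  by have [] := d x.
- move=> x; have := rderiv_real (d x); rewrite /fejer_weight ecis_cos.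
  by rewrite -rmorphM mulrA [2 * _]mulrC.
- rewrite -rmorphB /fejer (negPf s0); congr (_%:C).
  by rewrite !mul0r !mul1r sin0 cos0 subrr; field.
Qed.

Lemma fejer_ge0 s : 0 <= fejer s.
Proof.
by rewrite /fejer; case: eqP => // _; rewrite divr_ge0 ?sqr_ge0// mulr_ge0// subr_ge0 cos_le1.
Qed.

Lemma fejer_le s : s != 0 -> fejer s <= 4 / s ^+ 2.
Proof.
move=> s0; rewrite /fejer (negPf s0) ler_wpM2r ?invr_ge0 ?sqr_ge0//.
have := cos_geN1 s; lra.
Qed.

Lemma fejer_weight_lip s s' x : 0 <= x <= 1 ->
  rnorm (fejer_weight s x - fejer_weight s' x) <= 2 * `|s - s'|.
Proof.
move=> /andP[x0 x1]; rewrite /fejer_weight -mulrBr cmodM cmod_real ger0_norm ?subr_ge0//.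
have A : rnorm (ecis (x * s) + ecis (- (x * s)) - (ecis (x * s') + ecis (- (x * s'))) : C^o)
    <= 2 * `|s - s'|.
  have -> : ecis (x * s) + ecis (- (x * s)) - (ecis (x * s') + ecis (- (x * s'))) =
    (ecis (x * s) - ecis (x * s')) + (ecis (- (x * s)) - ecis (- (x * s'))) by ring.
  apply: le_trans (rnormD (_ : C^o) _) _.
  have := ecis_lip (x * s) (x * s'); have := ecis_lip (- (x * s)) (- (x * s')).
  have -> : - (x * s) - - (x * s') = - (x * (s - s')) by ring.
  have -> : x * s - x * s' = x * (s - s') by ring.
  rewrite normrN normrM ger0_norm//.
  have : x * `|s - s'| <= `|s - s'| by rewrite ler_piMl.
  lra.
by apply: le_trans A; rewrite ler_piMl ?rnorm_ge0//; lra.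
Qed.

(** Read off from the integral representation, which avoids the removable singularity of the
    quotient at 0. *)
Lemma fejer_lip s s' : `|fejer s - fejer s'| <= 2 * `|s - s'|.
Proof.
have [F [Fc Fd FE]] := fejer_primitive s; have [G [Gc Gd GE]] := fejer_primitive s'.
have := @mean_value_const _ _ (fun x => F x - G x) (fun x => fejer_weight s x - fejer_weight s' x)
  (2 * `|s - s'|) 0 1 ler01.
rewrite subr0 mulr1 => H.
have -> : `|fejer s - fejer s'| = rnorm (F 1 - G 1 - (F 0 - G 0)).
  have id (p q k l : C) : p - q - (k - l) = (p - k) - (q - l) by ring.
  by rewrite [X in rnorm X]id FE GE -rmorphB cmod_real.
apply: H => [t _|t _|t /andP[t0 t1]].
- by apply: cvgB; [exact: Fc|exact: Gc].
- apply: rderivD; first exact: Fd.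
  rewrite -scaleN1r; apply: (rderiv_ext (u := fun s => -1 *: G s)) => [r|]; first by rewrite scaleN1r.
  by apply: rderivZl; exact: Gd.
- by apply: fejer_weight_lip; rewrite t0 ltW.
Qed.

Lemma fejer_continuous : continuous fejer.
Proof.
move=> t; apply/cvgrPdist_le => e e0; exists (e / 2) => /=; first by rewrite divr_gt0.
move=> s; rewrite /ball /= => ts; apply: le_trans (fejer_lip _ _) _; lra.
Qed.

Lemma fejer_half s : `|s| <= 4^-1 -> 2^-1 <= fejer s.
Proof.
move=> s4; have := fejer_lip s 0; rewrite subr0 {2}/fejer eqxx ler_norml => /andP[A _]; lra.
Qed.

End oscillation.

(** * The Riemann-Lebesgue lemma on the unit interval *)

Section riemann_lebesgue.
Variables (R : realType) (K : topologicalType) (cK : compact [set: K]).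
Local Notation C := R[i].
Local Notation CK := (Cspace R cK).
Implicit Types (u : R -> CK).

Lemma continuous_scale (c : R -> C^o) u : continuous c -> continuous u ->
  continuous (fun t => c t *: u t).
Proof. by move=> cc uc t; apply: cvgZ; [exact: cc|exact: uc]. Qed.

Lemma continuous_dilate u (k : R) : continuous u -> continuous (fun t => u (k * t)).
Proof.
move=> uc t; apply: (@cvg_comp _ _ _ (fun t => k * t) u _ (nbhs (k * t))); last exact: uc.
by apply: cvgM; [exact: cvg_cst|exact: cvg_id].
Qed.

Lemma continuous_translate u (k : R) : continuous u -> continuous (fun t => u (t + k)).
Proof.
move=> uc t; apply: (@cvg_comp _ _ _ (fun t => t + k) u _ (nbhs (t + k))); last exact: uc.
by apply: cvgD; [exact: cvg_id|exact: cvg_cst].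
Qed.

Lemma vintB (a b : R) u (v : R -> CK) : a <= b -> continuous u -> continuous v ->
  vint a b (fun t => u t - v t) = vint a b u - vint a b v.
Proof.
move=> ab uc vc; rewrite -scaleN1r -vintZ// -vintD//.
  by congr (vint _ _ _); apply/funext => t; rewrite scaleN1r.
by move=> t; apply: cvgZl_tmp; exact: vc.
Qed.

Lemma vint_scalar (c F : R -> C^o) (y : CK) : continuous c -> continuous F ->
  (forall x, rderiv F x (c x)) -> vint 0 1 (fun x => c x *: y) = (F 1 - F 0) *: y.
Proof.
move=> cc Fc Fd; rewrite (@vintE _ _ _ 0 1 _ (fun x => F x *: y)) ?scalerBl//.
- by apply: continuous_scale => // t; exact: cvg_cst.
- by move=> t _; apply: cvgZ; [exact: Fc|exact: cvg_cst].
- by move=> t _; have := rderivZ (Fd t) (rderiv_cst y t); rewrite scaler0 addr0.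
Qed.

Lemma translate_uniform u (e : R) : continuous u -> 0 < e ->
  exists2 d : R, 0 < d & forall h x, 0 < h < d -> 0 <= x <= 1 -> rnorm (u (x + h) - u x) <= e.
Proof.
move=> uc e0; have e2 : 0 < e / 2 by rewrite divr_gt0.
have := @segment_compact R 0 1; rewrite compact_near_coveringP => /(_ R 0^'+).
move=> /(_ (fun h x => rnorm (u (x + h) - u x) <= e) _) [].
- move=> x _; have [r r0 rP] := right_uniform x uc e2.
  exists (ball x (r / 2), [set h | 0 < h < r / 2]) => /=.
    split; first by exists (r / 2) => //=; rewrite divr_gt0.
    by apply/near_right0P; exists (r / 2); rewrite ?divr_gt0.
  move=> [y h] /= [xy /andP[h0 hr]].
  have A : rnorm (u (y + h) - u x) <= e / 2.
    apply: rP; move: xy; rewrite /ball /= distrC => xy.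
    have -> : y + h - x = (y - x) + h by ring.
    by apply: le_lt_trans (ler_normD _ _) _; rewrite (gtr0_norm h0); lra.
  have B : rnorm (u y - u x) <= e / 2.
    by apply: rP; move: xy; rewrite /ball /= distrC; lra.
  have := rnorm_triangle (u (y + h)) (u x) (u y).
  rewrite [rnorm (u x - _)]rnorm_distC; lra.
- move=> d /= d0 dP; exists d => // h x /andP[h0 hd] x01.
  have x01' : `[0, 1]%classic x by rewrite /= in_itv.
  by apply: (dP h _ h0 x x01') => /=; rewrite sub0r normrN gtr0_norm.
Qed.

(* Translating by half a period flips the sign of the oscillating factor. *)
Lemma riemann_lebesgue u (e : R) : continuous u -> 0 < e ->
  exists2 s0 : R, 0 < s0 & forall s, s0 <= `|s| ->
    rnorm (vint 0 1 (fun x => ecis (x * s) *: u x)) <= e.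
Proof.
move=> uc e0; have [d d0 dP] := translate_uniform uc e0.
have [b b0 bP] : exists2 b : R, 0 < b & forall x, 0 <= x <= 2 -> rnorm (u x) <= b.
  have nc : {within `[0, 2], continuous (fun x => rnorm (u x))}.
    by apply: continuous_subspaceT => x; apply: cvg_rnorm; exact: uc.
  have [c _ cP] := EVT_max (ler0n R 2) nc.
  exists (rnorm (u c) + 1); first by have := rnorm_ge0 (u c); lra.
  by move=> x x2; have := cP x; rewrite in_itv /= => /(_ x2); lra.
have pi0 : 0 < pi :> R by exact: pi_gt0.
(* The half period [h] will be at most [m]. This keeps the translation below [d], the integration
   inside [[0, 2]], and the two end pieces, of norm at most [b * h] each, below [e] in total. *)
pose m := Num.min (Num.min (d / 2) 1) (e / (2 * b)).
have m0 : 0 < m by rewrite !lt_min ltr01 !divr_gt0 ?mulr_gt0.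
exists (pi / m) => [|s sm]; first by rewrite divr_gt0.
have s0 : 0 < `|s| by apply: lt_le_trans sm; rewrite divr_gt0.
pose h := pi / `|s|; have h0 : 0 < h by rewrite divr_gt0.
have hm : h <= m by rewrite /h ler_pdivrMr// mulrC -ler_pdivrMr.
have hd : h < d.
  by apply: le_lt_trans hm _; rewrite !gt_min; apply/orP; left; apply/orP; left; lra.
have h1 : h <= 1 by apply: le_trans hm _; rewrite !ge_min lexx orbT.
have hb : h * (2 * b) <= e.
  by rewrite -ler_pdivlMr ?mulr_gt0//; apply: le_trans hm _; rewrite ge_min lexx orbT.
have flip x : ecis ((x + h) * s) = - ecis (x * s).
  rewrite mulrDl ecisD; suff -> : ecis (h * s) = -1 by rewrite mulrN1.
  rewrite /h; have [sp|sn] := ltP 0 s.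
    by rewrite gtr0_norm// divfK ?gt_eqF// ecis_pi.
  have sn' : s < 0 by rewrite lt_neqAle sn andbT -normr_gt0.
  rewrite ltr0_norm// invrN mulrN mulNr divfK ?lt_eqF//.
  by have := ecisNK (pi : R); rewrite ecis_pi mulN1r => /eqP; rewrite eqr_oppLR => /eqP.
pose v x := ecis (x * s) *: u x.
have vc : continuous v by apply: continuous_scale => //; exact: ecis_continuous.
pose J := vint 0 1 v; rewrite -/J.
have two : J + J = vint 0 1 (fun x => v x + v (x + h)) + vint 0 h v - vint 1 (1 + h) v.
  rewrite vintD//; last exact: continuous_translate.
  rewrite vint_shift// add0r -addrA -addrA; congr (_ + _).
  have A := @vint_cat _ _ _ 0 h (1 + h) v (ltW h0) _ vc; rewrite ler_wpDl// in A.
  have B := @vint_cat _ _ _ 0 1 (1 + h) v ler01 _ vc; rewrite lerDl (ltW h0) in B.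
  have := A isT; rewrite (B isT) => E.
  by rewrite addrA [X in X - _]addrC -E addrK.
have vb x : 0 <= x <= 2 -> rnorm (v x) <= b.
  by move=> x2; rewrite rnormZ cmod_ecis mul1r bP.
have J2 : rnorm (J + J) <= e + b * h + b * h.
  rewrite two; apply: le_trans (rnormB _ _) _; apply: lerD; last first.
    have -> : b * h = b * (1 + h - 1) by ring.
    apply: rnorm_vint => //; first by rewrite lerDl ltW.
    by move=> t /andP[t1 th]; apply: vb; apply/andP; split; lra.
  apply: le_trans (rnormD _ _) _; apply: lerD; last first.
    have {2}-> : h = h - 0 by rewrite subr0.
    apply: rnorm_vint => //; first exact: ltW.
    by move=> t /andP[t1 th]; apply: vb; apply/andP; split; lra.
  rewrite -[leRHS]mulr1 -[X in _ <= _ * X](subr0 1).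
  apply: rnorm_vint => //.
    move=> x; apply: cvgD; first exact: vc.
    by apply: continuous_translate vc x.
  move=> t /andP[t0 t1]; rewrite /v flip scaleNr -scalerBr rnormZ cmod_ecis mul1r.
  by rewrite rnorm_distC; apply: dP; rewrite ?h0 ?t0 ?ltW.
have : rnorm (J + J) = 2 * rnorm J.
  by have := rnormZR 2 J; rewrite gtr0_norm// rmorph_nat scaler_nat mulr2n.
move: J2 hb; lra.
Qed.

End riemann_lebesgue.

Section window.
Variables (R : realType) (V : normedModType R[i]).
Local Notation C := R[i].

(* [D 0 - D A] is the integral of [X] against an approximate identity around [t]
   of total mass of order [N^-1]: near [t] the kernel has mass at least
   [(4 * N)^-1], away from [t] it is at most [4 / (N * (t - a)) ^+ 2]. *)
Lemma fejer_window (D X : R -> V) (N B t d e0 e1 e2 A : R) :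
  0 < N -> 0 <= B -> 0 < d -> d <= t -> (4 * N)^-1 <= d -> t + d <= A ->
  continuous D ->
  (forall a, 0 <= a -> rderiv D a (- ((fejer (N * (t - a)))%:C *: X a))) ->
  (forall a, 0 <= a -> rnorm (X a) <= B) ->
  (forall a, t - d <= a <= t + d -> rnorm (X t - X a) <= e0) ->
  rnorm (D 0) <= e1 -> rnorm (D A) <= e2 ->
  rnorm (X t) <= e0 + 4 * N * (e1 + e2 + 3 * (4 * B / N ^+ 2) / d).
Proof.
move=> N0 B0 d0 dt Nd tA Dc Dd XB near_t D0 DA.
pose c : R := 4 * B / N ^+ 2.
have c_ge0 : 0 <= c.
{ by rewrite divr_ge0 ?sqr_ge0 ?mulr_ge0. }
have D_step a e : 0 <= a -> a != t -> 0 < e -> \forall h \near 0^'+,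
  rnorm (D (a + h) - D a) <= h * (c / (t - a) ^+ 2) + e * h.
{ move=> a0 at_ e_gt0; apply: filterS2 (nbhs_right_gt 0) (Dd a a0 e e_gt0) => h h0.
rewrite scalerN opprK => H.
have -> : D (a + h) - D a = (D (a + h) - D a +
    h%:C *: ((fejer (N * (t - a)))%:C *: X a)) - h%:C *: ((fejer (N * (t - a)))%:C *: X a).
  by rewrite addrK.
apply: le_trans (rnormB _ _) _; rewrite addrC; apply: lerD H.
rewrite !rnormZR (gtr0_norm h0) ler_wpM2l ?(ltW h0)// (ger0_norm (fejer_ge0 _)).
have s0 : N * (t - a) != 0 by rewrite mulf_neq0 ?(lt0r_neq0 N0)// subr_eq0 eq_sym.
apply: le_trans (ler_pM (fejer_ge0 _) (rnorm_ge0 _) (fejer_le s0) (XB a a0)) _.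
rewrite le_eqVlt; apply/orP; left; apply/eqP; rewrite /c; field.
by rewrite subr_eq0 eq_sym at_ gt_eqF. }
have inverse_continuous (k s : R) : s != t -> {for s, continuous (fun a => k / (t - a))}.
{ move=> st; apply: cvgM; first exact: cvg_cst.
apply: cvgV; first by rewrite subr_eq0 eq_sym.
by apply: cvgB; [exact: cvg_cst|exact: cvg_id]. }
(* [c / (t - a)] has derivative [c / (t - a) ^+ 2], the bound on the rate of change of [D], and
   therefore majorizes its increments. *)
have left_part : rnorm (D (t - d)) <= e1 + c / d.
{ have td : 0 <= t - d by rewrite subr_ge0.
have := rnorm_le_dist (D (t - d)) (D 0).
suff : rnorm (D (t - d) - D 0) <= c / (t - (t - d)) - c / (t - 0).
  have -> : t - (t - d) = d by ring.
  have : 0 <= c / (t - 0) by rewrite subr0 divr_ge0//; apply: le_trans dt; exact: ltW.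
  lra.
apply: (@mean_value_le _ _ D (fun a => c / (t - a))) => //.
- by move=> a _; exact: Dc.
- by move=> a /andP[_ ad]; apply: inverse_continuous; rewrite lt_eqF//; lra.
move=> a /andP[a0 ad] e e_gt0.
have at_ : a != t by rewrite lt_eqF//; lra.
have hd : \forall h \near 0^'+, h < d by apply: nbhs_right_lt.
apply: filterS3 (nbhs_right_gt 0) hd (D_step a e a0 at_ e_gt0) => h h0 hd' H.
apply: le_trans H _; rewrite lerD2r.
have ta : d < t - a by lra.
have -> : c / (t - (a + h)) - c / (t - a) = h * (c * ((t - a) * (t - a - h))^-1).
  by field; apply/andP; split; rewrite gt_eqF//; lra.
rewrite ler_wpM2l ?(ltW h0)// ler_wpM2l// lef_pV2 ?posrE ?mulr_gt0 ?exprn_gt0//; try lra.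
by rewrite expr2 ler_wpM2l//; lra. }
(* Beyond [t] the forward increment of [c / (t - a)] is [h * c / ((a - t) * (a - t + h))], slightly
   too small; the factor 2 makes up for it when [h < d]. *)
have right_part : rnorm (D (t + d)) <= e2 + 2 * c / d.
{ have A0 : 0 <= A by lra.
have := rnorm_le_dist (D (t + d)) (D A); rewrite rnorm_distC.
suff : rnorm (D A - D (t + d)) <= 2 * c / (t - A) - 2 * c / (t - (t + d)).
  have -> : t - (t + d) = - d by ring.
  have : 2 * c / (t - A) <= 0.
    by apply: mulr_ge0_le0; [exact: mulr_ge0|rewrite invr_le0; lra].
  rewrite invrN mulrN; lra.
apply: (@mean_value_le _ _ D (fun a => 2 * c / (t - a))) => //.
- by move=> a _; exact: Dc.
- by move=> a /andP[ad _]; apply: inverse_continuous; rewrite gt_eqF//; lra.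
move=> a /andP[ad _] e e_gt0.
have at_ : a != t by rewrite gt_eqF//; lra.
have a0 : 0 <= a by lra.
have hd : \forall h \near 0^'+, h < d by apply: nbhs_right_lt.
apply: filterS3 (nbhs_right_gt 0) hd (D_step a e a0 at_ e_gt0) => h h0 hd' H.
apply: le_trans H _; rewrite lerD2r.
have -> : 2 * c / (t - (a + h)) - 2 * c / (t - a) = h * (c * (2 / ((a - t) * (a - t + h)))).
  field; repeat (apply/andP; split); rewrite neq_lt; apply/orP; first [left; lra|right; lra].
rewrite ler_wpM2l ?(ltW h0)// ler_wpM2l//.
have p0 : 0 < (a - t) * (a - t + h) by rewrite mulr_gt0//; lra.
have q0 : 0 < (t - a) ^+ 2 by rewrite -sqrrN exprn_gt0//; lra.
rewrite ler_pdivlMr// mulrC ler_pdivrMr//.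
have : 0 <= (a - t) * (a - t - h) by rewrite mulr_ge0//; lra.
by rewrite !expr2; lra. }
pose f a := fejer (N * (t - a)).
have fc : continuous f.
  move=> a; apply: (@cvg_comp _ _ _ (fun a => N * (t - a)) _ _ (nbhs (N * (t - a)))); last exact: fejer_continuous.
  by apply: cvgM; [exact: cvg_cst|apply: cvgB; [exact: cvg_cst|exact: cvg_id]].
have [k [kc k0 kd]] := real_primitive (t - d) fc.
have mono b b' : t - d <= b -> b <= b' -> k b <= k b'.
  move=> db bb'; rewrite -lerN2; apply: (@dini_le _ (fun a => - k a)) => // [a _|a /andP[ba _] e e_gt0].
    by apply: cvgN; exact: kc.
  have := kd a (le_trans db ba) e e_gt0; apply: filterS2 (nbhs_right_gt 0) => h h0.
  rewrite ler_norml => /andP[fh _].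
  have : 0 <= h * f a by rewrite mulr_ge0 ?fejer_ge0 ?(ltW h0).
  clear -fh; lra.
(* [fejer_half] applies where [N * |t - a| <= 4^-1], that is on [[t - g, t + g]]: a kernel of at
   least 1/2 over a length [2 * g] has mass at least [g]. *)
pose g := (4 * N)^-1; have g0 : 0 < g by rewrite invr_gt0 mulr_gt0.
have gain : g <= k (t + d).
  have step : g / 2 - k (t + g) <= - g / 2 - k (t - g).
    have tgg : t - g <= t + g by lra.
    have := @dini_le _ (fun a => 2^-1 * (a - t) - k a) _ _ tgg.
    have -> : 2^-1 * (t + g - t) - k (t + g) = g / 2 - k (t + g) by field.
    have -> : 2^-1 * (t - g - t) - k (t - g) = - g / 2 - k (t - g) by field.
    apply=> [a _|a /andP[ga ag] e e_gt0].
      apply: cvgB; last exact: kc.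
      by apply: cvgM; [exact: cvg_cst|apply: cvgB; [exact: cvg_id|exact: cvg_cst]].
    have da : t - d <= a by rewrite -/g in Nd; lra.
    have := kd a da e e_gt0; apply: filterS2 (nbhs_right_gt 0) => h h0.
    rewrite ler_norml => /andP[fh _].
    have f2 : 2^-1 <= f a.
      apply: fejer_half; rewrite normrM (gtr0_norm N0).
      have : N * `|t - a| <= N * g.
        by rewrite ler_wpM2l ?(ltW N0)// ler_norml; apply/andP; split; lra.
      move=> /le_trans; apply; rewrite /g.
      by have -> : N / (4 * N) = 4^-1 by field; rewrite gt_eqF.
    have := ler_wpM2l (ltW h0) f2; lra.
  have tdg : t - d <= t - g by rewrite -/g in Nd; lra.
  have tdg2 : t - d <= t + g by lra.
  have tgd : t + g <= t + d by rewrite -/g in Nd; lra.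
  have := mono _ _ (lexx _) tdg; have := mono _ _ tdg2 tgd; rewrite k0; lra.
(* Adding the kernel mass times [X t] turns the derivative into [f a] times [X t - X a], which is
   small inside the window. *)
pose Y a := D a + (k a)%:C *: X t.
have e0_ge0 : 0 <= e0.
  by apply: le_trans (rnorm_ge0 _) (near_t t _); apply/andP; split; lra.
have tdd : t - d <= t + d by lra.
have YY : rnorm (Y (t + d) - Y (t - d)) <= e0 * k (t + d).
  have -> : e0 * k (t + d) = e0 * k (t + d) - e0 * k (t - d) by rewrite k0 mulr0 subr0.
  apply: (@mean_value_le _ _ Y (fun a => e0 * k a)) => //.
  - move=> a _; apply: cvgD; first exact: Dc.
    apply: (@cvgZr_tmp _ _ _ _ _ (fun a : R => ((k a)%:C : C)) (k a)%:C).
    exact: real_continuous.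
  - by move=> a _; apply: cvgM; [exact: cvg_cst|exact: kc].
  move=> a /andP[da ad] e e_gt0.
  have a0 : 0 <= a by lra.
  pose l := e0 + rnorm (X t) + 1.
  have l0 : 0 < l by rewrite ltr_wpDl// addr_ge0// rnorm_ge0.
  have eh0 : 0 < e / 2 by rewrite divr_gt0.
  have el : 0 < e / 2 / l by rewrite divr_gt0.
  apply: filterS3 (nbhs_right_gt 0) (Dd a a0 _ eh0) (kd a da _ el) => h h0.
  rewrite -/(f a) scalerN opprK => H1 H2.
  have -> : Y (a + h) - Y a = (D (a + h) - D a + h%:C *: ((f a)%:C *: X a)) +
      ((k (a + h) - k a - h * f a)%:C *: X t + (h * f a)%:C *: (X t - X a)).
    rewrite /Y !rmorphB !rmorphM /= !scalerBl scalerBr !scalerA.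
    by rewrite [X in _ = _ + X]addrA subrK [RHS]addrACA subrr addr0 opprD addrACA.
  apply: le_trans (rnormD _ _) _.
  have hf0 : 0 <= h * f a by rewrite mulr_ge0 ?fejer_ge0 ?(ltW h0).
  have P1 : rnorm ((k (a + h) - k a - h * f a)%:C *: X t) <= e / 2 / l * h * rnorm (X t).
    by rewrite rnormZR ler_wpM2r ?rnorm_ge0.
  have P2 : rnorm ((h * f a)%:C *: (X t - X a)) <= h * f a * e0.
    by rewrite rnormZR ger0_norm// ler_wpM2l// near_t// da ltW.
  have P3 : h * f a * e0 <= (k (a + h) - k a + e / 2 / l * h) * e0.
    by rewrite ler_wpM2r//; move: H2; rewrite ler_norml => /andP[]; lra.
  have P4 : e / 2 / l * h * (e0 + rnorm (X t)) <= e / 2 * h.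
    apply: (@le_trans _ _ (e / 2 / l * h * l)).
      by rewrite (ler_wpM2l (mulr_ge0 (ltW el) (ltW h0)))// /l lerDl.
    by rewrite mulrAC divfK ?gt_eqF.
  have := rnormD ((k (a + h) - k a - h * f a)%:C *: X t) ((h * f a)%:C *: (X t - X a)).
  clear -P1 P2 P3 P4 H1; lra.
have kW : k (t + d) * rnorm (X t) <= e0 * k (t + d) + (e1 + c / d + (e2 + 2 * c / d)).
  have kp0 : 0 <= k (t + d) by lra.
  have -> : k (t + d) * rnorm (X t) = rnorm ((k (t + d))%:C *: X t) by rewrite rnormZR ger0_norm.
  have -> : (k (t + d))%:C *: X t = Y (t + d) - Y (t - d) - (D (t + d) - D (t - d)).
    rewrite /Y k0 scale0r addr0 opprB addrA subrK addrC addKr//.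
  apply: le_trans (rnormB _ _) _; apply: lerD => //.
  by apply: le_trans (rnormB _ _) _; rewrite addrC; apply: lerD; [exact: left_part|exact: right_part].
have kp : 0 < k (t + d) by lra.
rewrite -(@ler_pM2l _ (k (t + d)))//; apply: le_trans kW _.
rewrite [leRHS]mulrDr [k _ * e0]mulrC lerD2l.
rewrite -/c; set S := e1 + e2 + 3 * c / d.
have -> : e1 + c / d + (e2 + 2 * c / d) = S by rewrite /S; ring.
have S0 : 0 <= S.
  have e1_ge0 : 0 <= e1 by exact: le_trans (rnorm_ge0 _) D0.
  have e2_ge0 : 0 <= e2 by exact: le_trans (rnorm_ge0 _) DA.
  by apply: addr_ge0; [exact: addr_ge0|apply: divr_ge0; [exact: mulr_ge0|exact: ltW]].
apply: (@le_trans _ _ (g * (4 * N * S))).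
  by rewrite /g mulrA mulVf ?mul1r// gt_eqF// mulr_gt0.
by rewrite ler_wpM2r// !mulr_ge0// ltW.
Qed.

End window.

(** * Fourier inversion of the tails of an orbit *)

Section tauberian.
Variables (R : realType) (K : topologicalType) (cK : compact [set: K]).
Local Notation C := R[i].
Local Notation CK := (Cspace R cK).
Variables (W : R -> boundedOp CK) (x : CK) (w : R -> CK) (M : R).
Hypotheses (hW : C0_semigroup W) (M0 : 0 < M) (WM : forall t, 0 <= t -> rnorm (W t) <= M).
Hypotheses (wc : continuous w)
  (wW : forall y, gen W (w y) ((0 +i* y) *: w y - x)).

(** Formally the integral of [ecis (- (r * y)) *: W r x] over [r >= a]: it is [w y] at [a = 0] and
    has the matching derivative in [a]. *)
Let Z y a := sgorbit (sgshift W (0 +i* y)) (w y) a.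

Let phase (a y : R) : sgshift W (0 +i* y) a = ecis (- (a * y)) *: W a.
Proof.
rewrite /sgshift; congr (_ *: _); rewrite /ecis; congr cexp; apply/eqP.
by rewrite eq_complex /= oppr0 mulr0 !mul0r subr0 addr0 mulrN !eqxx.
Qed.

Let ZE y a : Z y a = ecis (- (Num.max 0 a * y)) *: W (Num.max 0 a) (w y).
Proof. by rewrite /Z /sgorbit phase. Qed.

Let Z_continuous y : continuous (Z y).
Proof. by apply: sgorbit_continuous; exact: sgshift_sg. Qed.

Let Z_rderiv y a : 0 <= a -> rderiv (Z y) a (- (ecis (- (a * y)) *: W a x)).
Proof.
move=> a0.
have g : gen (sgshift W (0 +i* y)) (w y) (- x).
  by have := gen_shift (0 +i* y) hW (@wW y); rewrite addrAC subrr add0r.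
by have := gen_rderiv (sgshift_sg (0 +i* y) hW) a0 g; rewrite phase linearN.
Qed.

Let phase_bound y a : 0 <= a -> rnorm (ecis (- (a * y)) *: W a x) <= M * rnorm x.
Proof.
move=> a0; rewrite rnormZ cmod_ecis mul1r; apply: le_trans (rnorm_bop _ _) _.
by rewrite ler_wpM2r ?rnorm_ge0 ?WM.
Qed.

Let Z_lip y a b : rnorm (Z y b - Z y a) <= M * rnorm x * `|b - a|.
Proof.
wlog ab : a b / a <= b => [H|].
  by have [/H//|/ltW/H] := leP a b; rewrite distrC rnorm_distC.
have Zm s : Z y s = Z y (Num.max 0 s) by rewrite /Z /sgorbit maxA maxxx.
rewrite (Zm a) (Zm b).
have ab' : Num.max 0 a <= Num.max 0 b by rewrite ge_max !le_max lexx ab orbT.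
apply: le_trans (@mean_value_const _ _ (Z y) (fun s => - (ecis (- (s * y)) *: W s x))
  (M * rnorm x) _ _ ab' _ _ _) _.
- by move=> t _; exact: Z_continuous.
- by move=> t /andP[]; rewrite ge_max => /andP[t0 _] _; exact: Z_rderiv.
- by move=> t /andP[]; rewrite ge_max rnormN => /andP[t0 _] _; exact: phase_bound.
- rewrite ler_wpM2l ?mulr_ge0 ?rnorm_ge0 ?(ltW M0)// (ger0_norm (_ : 0 <= b - a)) ?subr_ge0//.
  by case: (leP 0 a); case: (leP 0 b); lra.
Qed.

(** The derivative of [Z y] at [a] is approached uniformly in [|y| <= B], so that it can be taken
    under the integral over frequencies. *)
Let Z_near (B a e : R) : 0 <= a -> 0 < e -> exists2 d : R, 0 < d &
  forall h y, 0 < h < d -> `|y| <= B ->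
  rnorm (Z y (a + h) - Z y a + h%:C *: (ecis (- (a * y)) *: W a x)) <= e * h.
Proof.
move=> a0 e0; have e2 : 0 < e / 2 by rewrite divr_gt0.
have oc : continuous (sgorbit W x) by exact: sgorbit_continuous.
have [d d0 dP] := right_uniform a oc e2.
pose k := `|B| * M * rnorm x + 1.
have k0 : 0 < k by rewrite ltr_wpDl// !mulr_ge0 ?rnorm_ge0 ?(ltW M0).
exists (Num.min d (e / 2 / k)); first by rewrite lt_min d0 !divr_gt0.
move=> h y /andP[h0]; rewrite lt_min => /andP[hd hk] yB.
have ah : a <= a + h by rewrite lerDl ltW.
have ahE : a + h - a = h by rewrite addrC addKr.
have := @mean_value_dist _ _ (Z y) (fun s => - (ecis (- (s * y)) *: W s x))
  (- (ecis (- (a * y)) *: W a x)) e a (a + h) ah.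
rewrite ahE scalerN !opprK; apply.
- by move=> t _; exact: Z_continuous.
- by move=> t /andP[at_ _]; apply: Z_rderiv; exact: le_trans at_.
move=> t /andP[at_ th]; have t0 : 0 <= t by exact: le_trans at_.
rewrite addrC rnorm_distC.
have -> : ecis (- (t * y)) *: W t x - ecis (- (a * y)) *: W a x =
    (ecis (- (t * y)) - ecis (- (a * y))) *: W t x + ecis (- (a * y)) *: (W t x - W a x).
  by rewrite scalerBl scalerBr addrA subrK.
apply: le_trans (rnormD _ _) _; rewrite (splitr e); apply: lerD.
  rewrite rnormZ; apply: le_trans (ler_pM (rnorm_ge0 _) (rnorm_ge0 _) (ecis_lip _ _)
    (rnorm_bop _ _)) _.
  have -> : - (t * y) - - (a * y) = - ((t - a) * y) by ring.
  rewrite normrN normrM ger0_norm ?subr_ge0//.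
  apply: (@le_trans _ _ (h * (`|B| * M * rnorm x))).
    rewrite -!mulrA; apply: ler_pM; rewrite ?subr_ge0 ?mulr_ge0 ?rnorm_ge0//; first lra.
    apply: ler_pM; rewrite ?mulr_ge0 ?rnorm_ge0//.
      by apply: le_trans yB _; exact: ler_norm.
    by rewrite ler_wpM2r ?rnorm_ge0 ?WM.
  apply: (@le_trans _ _ (h * k)); first by rewrite ler_wpM2l ?(ltW h0)// /k lerDl.
  by rewrite -ler_pdivlMr// ltW.
rewrite rnormZ cmod_ecis mul1r -!(sgorbitE W x)//; apply: dP.
by rewrite ger0_norm ?subr_ge0//; lra.
Qed.

Variable N : R.
Hypothesis N0 : 0 < N.

(* Fejer-weighted Fourier inversion of the transform of the tail of the orbit
   after time [a]; as a function of [a] its derivative is the Fejer kernel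
   around [t] times the orbit. *)
Let q (t a y : R) : CK := (1 - y)%:C *:
  (ecis (y * (N * t)) *: Z (N * y) a + ecis (- (y * (N * t))) *: Z (- (N * y)) a).
Let D t a := vint 0 1 (q t a).
Let p (s y : R) : CK := (1 - y)%:C *:
  (ecis (y * (N * s)) *: w (N * y) + ecis (- (y * (N * s))) *: w (- (N * y))).
Let v s := vint 0 1 (p s).

Let weight_continuous : continuous (fun y : R => (1 - y)%:C : C^o).
Proof. by apply: real_continuous => y; apply: cvgB; [exact: cvg_cst|exact: cvg_id]. Qed.

Let ecisN_continuous s : continuous (fun y : R => ecis (- (y * s)) : C^o).
Proof. by under eq_fun do rewrite -mulrN; exact: ecis_continuous. Qed.

Let wN_continuous : continuous (fun y => w (- (N * y))).
Proof. by under eq_fun do rewrite -mulNr; exact: continuous_dilate. Qed.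

Let wP_continuous : continuous (fun y => w (N * y)).
Proof. exact: continuous_dilate. Qed.

Let continuousD2 (u1 u2 : R -> CK) : continuous u1 -> continuous u2 ->
  continuous (fun y => u1 y + u2 y).
Proof. by move=> c1 c2 y; apply: cvgD; [exact: c1|exact: c2]. Qed.

Let ZP_continuous a : continuous (fun y => Z (N * y) a).
Proof.
set m := Num.max 0 a.
have -> : (fun y => Z (N * y) a) = (fun y => ecis (- (y * (N * m))) *: W m (w (N * y))).
  by apply/funext => y; rewrite ZE -/m; congr (ecis _ *: _); ring.
apply: continuous_scale => [|y]; first exact: ecisN_continuous.
by apply: bop_cvg; exact: wP_continuous.
Qed.

Let ZN_continuous a : continuous (fun y => Z (- (N * y)) a).
Proof.
set m := Num.max 0 a.
have -> : (fun y => Z (- (N * y)) a) = (fun y => ecis (y * (N * m)) *: W m (w (- (N * y)))).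
  by apply/funext => y; rewrite ZE -/m; congr (ecis _ *: _); ring.
apply: continuous_scale => [|y]; first exact: ecis_continuous.
by apply: bop_cvg; exact: wN_continuous.
Qed.

Let q_continuous t a : continuous (q t a).
Proof.
apply: continuous_scale; first exact: weight_continuous.
apply: continuousD2; apply: continuous_scale.
- exact: ecis_continuous.
- exact: ZP_continuous.
- exact: ecisN_continuous.
- exact: ZN_continuous.
Qed.

Let p_continuous s : continuous (p s).
Proof.
apply: continuous_scale; first exact: weight_continuous.
apply: continuousD2; apply: continuous_scale.
- exact: ecis_continuous.
- exact: wP_continuous.
- exact: ecisN_continuous.
- exact: wN_continuous.
Qed.

(** [D t a] depends on [t - a] up to the bounded operator [W a], so the Riemann-Lebesgue lemma for
    [v] makes it small at both ends, [a = 0] and [a] far beyond [t]. *)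
Let D_orbit t a : 0 <= a -> D t a = W a (v (t - a)).
Proof.
move=> a0; rewrite /v -vint_bop//; apply: eq_vint => //.
  by move=> y; apply: bop_cvg; exact: p_continuous.
move=> y _; rewrite /q /p (linearZ_LR (W a)) (linearD (W a)) !(linearZ_LR (W a)) !ZE (max_r a0).
by congr (_ *: (_ + _)); rewrite scalerA -ecisD; congr (ecis _ *: _); ring.
Qed.

Let D_lip t a b : rnorm (D t b - D t a) <= 2 * M * rnorm x * `|b - a|.
Proof.
rewrite -vintB//.
have := @rnorm_vint _ _ _ 0 1 (fun y => q t b y - q t a y) (2 * M * rnorm x * `|b - a|) ler01.
rewrite subr0 mulr1; apply; first by move=> y; apply: cvgB; exact: q_continuous.
move=> y /andP[y0 y1]; rewrite /q -scalerBr opprD addrACA -!scalerBr rnormZR.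
rewrite ger0_norm ?subr_ge0 ?(ltW y1)//.
apply: (@le_trans _ _ (1 * (M * rnorm x * `|b - a| + M * rnorm x * `|b - a|))); last first.
  by rewrite le_eqVlt; apply/orP; left; apply/eqP; ring.
apply: ler_pM; rewrite ?rnorm_ge0 ?subr_ge0 ?(ltW y1)//; first lra.
by apply: le_trans (rnormD _ _) _; apply: lerD; rewrite rnormZ cmod_ecis mul1r Z_lip.
Qed.

Let D_continuous t : continuous (D t).
Proof.
move=> a; apply/cvg_rnormP => e e0.
pose k := 2 * M * rnorm x + 1.
have k0 : 0 < k by rewrite ltr_wpDl// !mulr_ge0 ?rnorm_ge0 ?(ltW M0).
exists (e / k) => /=; first by rewrite divr_gt0.
move=> b; rewrite /ball /= ltr_pdivlMr// => ab; apply: le_trans (D_lip _ _ _) _.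
apply: le_trans (ltW ab); rewrite mulrC ler_wpM2l// /k lerDl//.
Qed.

Let fejer_weight_continuous (s : R) : continuous (fejer_weight s).
Proof.
move=> y; apply: (@cvgZ _ C^o _ _ _ (fun y : R => (1 - y)%:C) (fun y => ecis (y * s) + ecis (- (y * s)) : C^o)).
  exact: weight_continuous.
by apply: cvgD; [exact: ecis_continuous|exact: ecisN_continuous].
Qed.

Let D_rderiv t a : 0 <= a -> rderiv (D t) a (- ((fejer (N * (t - a)))%:C *: W a x)).
Proof.
move=> a0 e e0; have e2 : 0 < e / 2 by rewrite divr_gt0.
have [d d0 dP] := Z_near N a0 e2.
apply/near_right0P; exists d => // h hd; have h0 : 0 < h by case/andP: hd.
set s := N * (t - a).
have [F [Fc Fd FE]] := fejer_primitive s.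
rewrite scalerN opprK -FE -(vint_scalar (W a x) (@fejer_weight_continuous s) Fc Fd).
have fc : continuous (fun y => fejer_weight s y *: W a x).
  by apply: continuous_scale; [exact: fejer_weight_continuous|move=> y; exact: cvg_cst].
rewrite -vintZ// -vintB// -vintD//; first last.
- by move=> y; apply: cvgZl_tmp; exact: fc.
- by move=> y; apply: cvgB; exact: q_continuous.
have -> : e * h = e * h * (1 - 0) by rewrite subr0 mulr1.
apply: rnorm_vint => //.
  apply: continuousD2; first by move=> y; apply: cvgB; exact: q_continuous.
  by move=> y; apply: cvgZl_tmp; exact: fc.
move=> y /andP[y0 y1].
have NyN : `|N * y| <= N by rewrite ger0_norm ?mulr_ge0 ?(ltW N0)// ler_piMr// ltW.
have A1 := dP h (N * y) hd NyN; have A2 := dP h (- (N * y)) hd; rewrite normrN in A2.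
have {}A2 := A2 NyN.
(* The phase of the inversion at [t] and the phase of the orbit at [a] combine to a function of
   [t - a] alone. *)
have E1 : ecis (y * s) = ecis (y * (N * t)) * ecis (- (a * (N * y))).
  by rewrite -ecisD; congr ecis; rewrite /s; ring.
have E2 : ecis (- (y * s)) = ecis (- (y * (N * t))) * ecis (- (a * - (N * y))).
  by rewrite -ecisD; congr ecis; rewrite /s; ring.
rewrite /q /fejer_weight E1 E2.
set X1 := Z (N * y) (a + h) in A1 *; set X2 := Z (N * y) a in A1 *.
set Y1 := Z (- (N * y)) (a + h) in A2 *; set Y2 := Z (- (N * y)) a in A2 *.
set c1 := ecis (y * (N * t)); set c2 := ecis (- (y * (N * t))).
set b1 := ecis (- (a * (N * y))) in A1 *; set b2 := ecis (- (a * - (N * y))) in A2 *.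
have -> : (1 - y)%:C *: (c1 *: X1 + c2 *: Y1) - (1 - y)%:C *: (c1 *: X2 + c2 *: Y2) +
    h%:C *: (((1 - y)%:C * (c1 * b1 + c2 * b2)) *: W a x) =
    (1 - y)%:C *: (c1 *: (X1 - X2 + h%:C *: (b1 *: W a x)) + c2 *: (Y1 - Y2 + h%:C *: (b2 *: W a x))).
  apply: CvalP => z.
  have id (l0 k1 k2 r1 r2 s1 s2 l m1 m2 n : C) :
    l0 * (k1 * r1 + k2 * s1) - l0 * (k1 * r2 + k2 * s2) + l * ((l0 * (k1 * m1 + k2 * m2)) * n) =
    l0 * (k1 * (r1 - r2 + l * (m1 * n)) + k2 * (s1 - s2 + l * (m2 * n))) by ring.
  exact: id.
rewrite rnormZR ger0_norm ?subr_ge0 ?(ltW y1)//.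
apply: (@le_trans _ _ (1 * (e / 2 * h + e / 2 * h))); last first.
  by rewrite le_eqVlt; apply/orP; left; apply/eqP; field.
apply: ler_pM; rewrite ?rnorm_ge0 ?subr_ge0 ?(ltW y1)//; first lra.
by apply: le_trans (rnormD _ _) _; apply: lerD; rewrite rnormZ cmod_ecis mul1r.
Qed.

Let v_vanishes (e : R) : 0 < e -> exists2 s0 : R, 0 < s0 & forall s, s0 <= `|s| -> rnorm (v s) <= e.
Proof.
move=> e0; have e2 : 0 < e / 2 by rewrite divr_gt0.
have pc : continuous (fun y : R => (1 - y)%:C *: w (N * y)) by apply: continuous_scale; [exact: weight_continuous|exact: wP_continuous].
have nc : continuous (fun y : R => (1 - y)%:C *: w (- (N * y))) by apply: continuous_scale; [exact: weight_continuous|exact: wN_continuous].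
have [s1 s10 s1P] := riemann_lebesgue pc e2; have [s2 s20 s2P] := riemann_lebesgue nc e2.
exists (Num.max s1 s2 / N); first by rewrite divr_gt0// lt_max s10.
move=> s; rewrite ler_pdivrMr// ge_max => /andP[A1 A2].
have -> : v s = vint 0 1 (fun y => ecis (y * (N * s)) *: ((1 - y)%:C *: w (N * y))) +
    vint 0 1 (fun y => ecis (y * - (N * s)) *: ((1 - y)%:C *: w (- (N * y)))).
  rewrite -vintD//; first last.
  - by apply: continuous_scale; [exact: ecis_continuous|exact: nc].
  - by apply: continuous_scale; [exact: ecis_continuous|exact: pc].
  congr (vint _ _ _); apply/funext => y.
  by rewrite /p scalerDr !scalerA mulrN; congr (_ *: _ + _ *: _); exact: mulrC.
apply: le_trans (rnormD _ _) _; rewrite (splitr e); apply: lerD.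
  by apply: s1P; rewrite normrM (gtr0_norm N0) mulrC.
by apply: s2P; rewrite normrN normrM (gtr0_norm N0) mulrC.
Qed.

Lemma orbit_limsup (d e0 e : R) : 0 < d -> 0 < e -> (4 * N)^-1 <= d ->
  (forall t a, d <= t -> t - d <= a <= t + d -> rnorm (W t x - W a x) <= e0) ->
  exists t0 : R, forall t, t0 <= t -> rnorm (W t x) <= e0 + e + 48 * (M * rnorm x) / (N * d).
Proof.
move=> d0 e_gt0 Nd near_t.
have M1 : 0 < 1 + M by rewrite ltr_wpDl.
(* The two ends contribute [e1] and [M * e1], and [fejer_window] multiplies them by [4 * N]. The
   kernel tails give [4 * N * 3 * (4 * B / N ^+ 2) / d], whence the 48. *)
pose e1 := e / (4 * N * (1 + M)).
have e10 : 0 < e1 by rewrite divr_gt0// !mulr_gt0.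
have [s1 s10 v_small] := v_vanishes e10.
exists (Num.max d s1) => t; rewrite ge_max => /andP[dt s1t].
have tA : t + d <= t + d + s1 by rewrite lerDl ltW.
have t0 : 0 <= t by apply: le_trans dt; exact: ltW.
have B0 : 0 <= M * rnorm x by rewrite mulr_ge0 ?rnorm_ge0 ?(ltW M0).
have XB a : 0 <= a -> rnorm (W a x) <= M * rnorm x.
  by move=> a0; apply: le_trans (rnorm_bop _ _) _; rewrite ler_wpM2r ?rnorm_ge0 ?WM.
have D0 : rnorm (D t 0) <= e1.
  have [W0 _ _] := hW; rewrite D_orbit// subr0 W0; apply: v_small.
  by apply: le_trans s1t _; exact: ler_norm.
have DA : rnorm (D t (t + d + s1)) <= M * e1.
  have A0 : 0 <= t + d + s1 by rewrite !addr_ge0// ltW.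
  rewrite (D_orbit t A0); apply: le_trans (rnorm_bop _ _) _.
  apply: (ler_pM (rnorm_ge0 _) (rnorm_ge0 _) (WM A0)); apply: v_small.
  have -> : t - (t + d + s1) = - (d + s1) by ring.
  by rewrite normrN ger0_norm ?addr_ge0 ?ltW// ltrDr.
have := fejer_window N0 B0 d0 dt Nd tA (@D_continuous t) (@D_rderiv t) XB
  (fun a => @near_t t a dt) D0 DA.
move=> /le_trans; apply; rewrite le_eqVlt; apply/orP; left; apply/eqP.
rewrite /e1; field; rewrite !gt_eqF//.
Qed.

End tauberian.

(* Ingham's Tauberian argument: [w] plays the part of the Laplace transform of
   the orbit of [x] on the imaginary axis. *)
Lemma orbit_vanishes (R : realType) (K : topologicalType) (cK : compact [set: K])
    (W : R -> boundedOp (Cspace R cK)) (x : Cspace R cK) (w : R -> Cspace R cK) (M : R) :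
  C0_semigroup W -> 0 < M -> (forall t, 0 <= t -> rnorm (W t) <= M) ->
  continuous w -> (forall y, gen W (w y) ((0 +i* y) *: w y - x)) ->
  W t x @[t --> +oo] --> (0 : Cspace R cK).
Proof.
move=> hW M0 WM wc wW; apply/cvg_rnormP => e e0.
have [W0 WD _] := hW.
have e3 : 0 < e / 3 by rewrite divr_gt0.
have em : 0 < e / 3 / (2 * M) by rewrite divr_gt0// mulr_gt0.
have [d' d'0 d'P] := sg_orbit_right x hW em.
(* Window points are compared with [W (t - d) x]; they lie at most [2 * d < d'] after it, and [M]
   bounds the cost of restarting there. Each comparison costs half of [e / 3]. *)
pose d := d' / 4; have d0 : 0 < d by rewrite divr_gt0.
have near_t t a : d <= t -> t - d <= a <= t + d -> rnorm (W t x - W a x) <= e / 3.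
  move=> dt /andP[ta at_]; have td : 0 <= t - d by rewrite subr_ge0.
  have shiftx b : t - d <= b <= t + d -> rnorm (W b x - W (t - d) x) <= e / 3 / 2.
    move=> /andP[tb bt]; have := @sgorbit_modulus _ _ _ W x M (t - d) b hW.
    rewrite td tb => /(_ isT (WM _ td)) /le_trans; apply.
    apply: (@le_trans _ _ (M * (e / 3 / (2 * M)))).
      rewrite ler_wpM2l ?(ltW M0)//; apply: d'P; rewrite subr_ge0 tb /=.
      by rewrite /d in tb bt *; lra.
    by rewrite le_eqVlt; apply/orP; left; apply/eqP; field; rewrite gt_eqF.
  have A := shiftx t; have B := shiftx a.
  have := rnorm_triangle (W t x) (W (t - d) x) (W a x).
  rewrite [rnorm (W (t - d) x - W a x)]rnorm_distC => /le_trans; apply.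
  rewrite [leRHS](splitr (e / 3)); apply: lerD; [apply: A|apply: B]; apply/andP; split=> //; lra.
pose B := M * rnorm x; have B0 : 0 <= B by rewrite mulr_ge0 ?rnorm_ge0 ?(ltW M0).
(* The first summand makes the central window fit into [[t - d, t + d]], the second pushes the
   kernel tails below [e / 3]. *)
pose N := (4 * d)^-1 + 48 * B / (d * (e / 3)) + 1.
have q1 : 0 < (4 * d)^-1 by rewrite invr_gt0 mulr_gt0.
have q2 : 0 <= 48 * B / (d * (e / 3)) by apply: divr_ge0; apply: mulr_ge0; [exact: ler0n|exact: B0|exact: ltW|exact: ltW].
have N0 : 0 < N by rewrite /N ltr_wpDl// addr_ge0// ltW.
have Nd : (4 * N)^-1 <= d.
  have H : (4 * d)^-1 <= N by rewrite /N -addrA lerDl addr_ge0.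
  rewrite -[leLHS]div1r ler_pdivrMr ?mulr_gt0//; move: H.
  rewrite -[leLHS]div1r ler_pdivrMr ?mulr_gt0// => /le_trans; apply.
  by rewrite le_eqVlt; apply/orP; left; apply/eqP; ring.
have [t0 t0P] := @orbit_limsup _ _ _ W x w M hW M0 WM wc wW N N0 d (e / 3) (e / 3) d0 e3 Nd near_t.
exists t0; split; first exact: num_real.
move=> t t0t; rewrite sub0r rnormN; apply: le_trans (t0P t (ltW t0t)) _.
have : 48 * (M * rnorm x) / (N * d) <= e / 3.
  rewrite ler_pdivrMr ?mulr_gt0// -/B.
  have H : 48 * B / (d * (e / 3)) <= N by rewrite /N -addrA addrCA lerDl addr_ge0// ltW.
  by move: H; rewrite ler_pdivrMr ?mulr_gt0// mulrCA mulrA => /le_trans; apply; rewrite le_eqVlt; apply/orP; left; apply/eqP; ring.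
lra.
Qed.

(** * Convergence at a dominant pole *)

Section convergence.
Variables (R : realType) (K : topologicalType) (cK : compact [set: K]).
Local Notation C := R[i].
Local Notation CK := (Cspace R cK).
Implicit Types (T W : R -> boundedOp CK) (f g : CK) (z : C).

(** As [g] is fixed by the semigroup, the orbit of [f] is [f + t *: g], which is bounded only for
    [g = 0]. *)
Lemma gen_bounded_orbit W f g (M : R) : C0_semigroup W ->
  (forall t, 0 <= t -> rnorm (W t) <= M) -> gen W f g -> gen W g 0 -> g = 0.
Proof.
move=> hW WM fg g0; apply: rnorm_eq0 => e e0.
have M0 : 0 <= M by apply: le_trans (rnorm_ge0 _) (WM 0 (lexx 0)).
have lin t : 0 <= t -> rnorm (t%:C *: g) <= M * rnorm f + rnorm f.
  move=> t0; have H : rnorm (sgorbit W f t - sgorbit W f 0 - (t - 0)%:C *: g) <= 0 * (t - 0).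
    apply: (@mean_value_dist _ _ (sgorbit W f) (fun s => W s g)) => //.
    - by move=> s _; exact: sgorbit_continuous.
    - by move=> s /andP[s0 _]; exact: gen_rderiv.
    - by move=> s /andP[s0 _]; rewrite (gen_fixed hW g0 s0) subrr rnorm0.
  rewrite mul0r subr0 !sgorbitE// in H; have [W0 _ _] := hW; rewrite W0 in H.
  have := rnorm_le_dist (t%:C *: g) (W t f - f); rewrite rnorm_distC => /le_trans; apply.
  rewrite -[leRHS]addr0; apply: lerD H; apply: le_trans (rnormB _ _) _; apply: lerD => //.
  by apply: le_trans (rnorm_bop _ _) _; rewrite ler_wpM2r ?rnorm_ge0 ?WM.
pose B := M * rnorm f + rnorm f; have B0 : 0 <= B by rewrite addr_ge0 ?mulr_ge0 ?rnorm_ge0.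
have t0 : 0 < (B + 1) / e by rewrite divr_gt0// ltr_wpDl.
have := lin _ (ltW t0); rewrite rnormZR gtr0_norm// -/B mulrAC ler_pdivrMr// => H.
rewrite leNgt; apply/negP => eg.
have : (B + 1) * e <= B * e by apply: le_trans H; rewrite ler_pM2l ?ltW// ltr_wpDl.
by rewrite ler_pM2r// leNgt ltrDl ltr01.
Qed.

(** For [m > 1] the coefficients form a Jordan chain: [A - s] maps [c1 f] to [c0 f] and [c0 f] to
    0. *)
Lemma bounded_simple_pole T (s M : R) m c0 c1 r c : C0_semigroup T ->
  (forall t, 0 <= t -> rnorm (rescale T s t) <= M) ->
  (0 < m)%N -> c0 <> 0 -> pole_data T s%:C m c0 c1 r c -> m = 1%N.
Proof.
rewrite rescaleE => hT WM m0 c00 pd; apply/eqP; apply: contrapT => m1.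
apply: c00; apply: bopP => f; have [e0 e1] := pole_data_gen f m0 pd.
have hW := sgshift_sg s%:C hT.
apply: (gen_bounded_orbit hW WM (f := c1 f)).
  have := gen_shift s%:C hT e1; rewrite (negbTE (introN idP m1)) subr0.
  by rewrite addrAC subrr add0r.
by have := gen_shift s%:C hT e0; rewrite subrr.
Qed.

Lemma resolvent_dist T z (z' : C) (S S' : boundedOp CK) f :
  is_resolvent (generator T) z S -> is_resolvent (generator T) z' S' ->
  rnorm (z - z' : C^o) * rnorm S <= 2^-1 ->
  rnorm (S' f - S f) <= rnorm (z - z' : C^o) * (2 * rnorm S ^+ 2 * rnorm f).
Proof.
move=> SP S'P zz'; have [S'' [S''P S''b _]] := resolvent_perturb SP zz'.
have E := resolvent_unique S'P S''P; rewrite -E in S''b.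
have [S1 _] := (resolventP _ _ _).1 SP; have [_ S2] := (resolventP _ _ _).1 S'P.
have -> : S' f - S f = (z - z') *: S' (S f).
  have := S2 _ _ (S1 f) => H; rewrite -{1}H -linearB -(linearZ_LR S'); congr (S' _).
  apply: eq_Cval => x.
  have id (a b p q : C) : q - (b * p - (a * p - q)) = (a - b) * p by ring.
  exact: id.
rewrite rnormZ ler_wpM2l ?rnorm_ge0//; apply: le_trans (S''b _) _.
rewrite expr2 -!mulrA; apply: ler_wpM2l => //; apply: ler_wpM2l; first exact: rnorm_ge0.
exact: rnorm_bop.
Qed.

Let cmod_im (y : R) : rnorm (0 +i* y : C^o) = `|y|.
Proof.
rewrite -[RHS]cmod_real -[RHS]mulr1; have <- : rnorm ('i : C^o) = 1 :> R.
  by rewrite /rnorm normc_def /= expr0n add0r expr1n sqrtr1.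
rewrite -cmodM; congr (rnorm _); apply/eqP.
by rewrite eq_complex /= !mulr0 !mul0r !mulr1 subr0 addr0 !eqxx.
Qed.

Lemma simple_pole_convergence T (s M : R) (c0 c1 : boundedOp CK) r c f : C0_semigroup T ->
  0 < M -> (forall t, 0 <= t -> rnorm (rescale T s t) <= M) ->
  pole_data T s%:C 1 c0 c1 r c ->
  (forall y : R, y != 0 -> resolvent_set (generator T) (s%:C + (0 +i* y))) ->
  rescale T s t f @[t --> +oo] --> c0 f.
Proof.
rewrite rescaleE => hT M0 WM pd yR; have hW := sgshift_sg s%:C hT.
have [r0 c_ge0 H] := pd; have [g0 g1] := pole_data_gen f (ltn0Sn 0) pd.
pose S y := resolvent (generator T) (s%:C + (0 +i* y)).
have SP y : y != 0 -> is_resolvent (generator T) (s%:C + (0 +i* y)) (S y).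
  by move=> /yR; exact: resolventE.
pose x := f - c0 f.
(* [(0 +i* y) *: S y (c0 f) = c0 f], so in [S y x] the principal parts of [S y f] and [S y (c0 f)]
   cancel, and the limit at [y = 0] is the next coefficient. *)
pose w y := if y == 0 then c1 f else S y x.
have wW y : gen (sgshift T s%:C) (w y) ((0 +i* y) *: w y - x).
  rewrite /w; have [->|y0] := eqVneq y 0.
    have := gen_shift s%:C hT g1; rewrite eqxx; congr (gen _ _ _).
    apply: eq_Cval => k.
    have id (a p q l : C) : a * p + q - l - a * p = 0 * p - (l - q) by ring.
    exact: id.
  have [S1 _] := (resolventP _ _ _).1 (SP _ y0).
  have := gen_shift s%:C hT (S1 x); congr (gen _ _ _).
  apply: eq_Cval => k.
  have id (a b p q : C) : (a + b) * p - q - a * p = b * p - q by ring.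
  exact: id.
have Sc0 y : y != 0 -> (0 +i* y) *: S y (c0 f) = c0 f.
  move=> y0; have [_ S2] := (resolventP _ _ _).1 (SP _ y0).
  by have := S2 _ _ g0; rewrite -scalerBl addrC addKr linearZ_LR.
have wc : continuous w.
  move=> y; apply/cvg_rnormP => e e0; have [->|y0] := eqVneq y 0.
    pose k := c * rnorm f + 1.
    have k0 : 0 < k by rewrite ltr_wpDl// mulr_ge0 ?rnorm_ge0.
    exists (Num.min r (e / k)) => /=; first by rewrite lt_min r0 divr_gt0.
    move=> y'; rewrite /ball /= sub0r normrN lt_min => /andP[y'r].
    rewrite ltr_pdivlMr// /w eqxx; have [-> _|y'0 y'e] := eqVneq y' 0.
      by rewrite subrr rnorm0 ltW.
    have y'n : 0 < `|y'| by rewrite normr_gt0.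
    have [|_] := H (0 +i* y'); first by rewrite cmod_im y'n.
    rewrite cmod_im expr1 -/(S y') => B.
    rewrite rnorm_distC -(ler_pM2l y'n) -[in leLHS]cmod_im -rnormZ.
    have -> : (0 +i* y') *: (S y' x - c1 f) =
        ((0 +i* y') *: S y' - c0 - (0 +i* y') *: c1) f.
      rewrite !bopBE !bopZE -(Sc0 _ y'0) /x (linearB (S y')); apply: eq_Cval => t.
      have id (a p q l : C) : a * (p - q - l) = a * p - a * q - a * l by ring.
      exact: id.
    apply: le_trans (rnorm_bop _ _) _.
    apply: le_trans (ler_wpM2r (rnorm_ge0 _) B) _.
    apply: (@le_trans _ _ (`|y'| * (`|y'| * k))); last by rewrite ler_pM2l// ltW.
    have -> : c * `|y'| ^+ 2 * rnorm f = `|y'| * (`|y'| * (c * rnorm f)) by ring.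
    by rewrite !ler_pM2l// /k lerDl.
  pose k := 2 * rnorm (S y) ^+ 2 * rnorm x + 1.
  have k0 : 0 < k by rewrite ltr_wpDl// !mulr_ge0 ?rnorm_ge0.
  pose k' := 2 * (rnorm (S y) + 1).
  have k'0 : 0 < k' by rewrite mulr_gt0// ltr_wpDl// rnorm_ge0.
  exists (Num.min `|y| (Num.min (k'^-1) (e / k))) => /=.
    by rewrite !lt_min normr_gt0 y0 invr_gt0 k'0 divr_gt0.
  move=> y'; rewrite /ball /= !lt_min => /and3P[yy' yk' yk].
  have y'0 : y' != 0 by apply: contraTneq yy' => ->; rewrite subr0 ltxx.
  rewrite /w (negbTE y0) (negbTE y'0) rnorm_distC.
  have dE : rnorm ((s%:C + (0 +i* y)) - (s%:C + (0 +i* y')) : C^o) = `|y - y'|.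
    rewrite -cmod_im; congr (rnorm _); apply/eqP.
    by rewrite eq_complex /=; apply/andP; split; apply/eqP; ring.
  have := resolvent_dist x (SP _ y0) (SP _ y'0); rewrite dE => /(_ _)/le_trans; apply.
    apply: (@le_trans _ _ (k'^-1 * (rnorm (S y) + 1))).
      by apply: ler_pM; rewrite ?rnorm_ge0 ?(ltW yk')// lerDl.
    by rewrite /k' invfM mulfVK// gt_eqF// ltr_wpDl ?rnorm_ge0.
  apply: (@le_trans _ _ (`|y - y'| * k)); first by rewrite ler_wpM2l// /k lerDl.
  by rewrite -ler_pdivlMr// ltW.
have e0 : gen (sgshift T s%:C) (c0 f) 0.
  by have := gen_shift s%:C hT g0; rewrite subrr.
apply/cvg_rnormP => e e_gt0.
have /cvg_rnormP/(_ e e_gt0) := orbit_vanishes hW M0 WM wc wW.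
apply: filterS2 (nbhs_pinfty_gt (num_real (0 : R))) => t t0.
have fx := gen_fixed hW e0 (ltW t0).
rewrite sub0r rnormN /x linearB rnorm_distC => B; apply: le_trans B.
by rewrite le_eqVlt -{1}fx eqxx.
Qed.

End convergence.

(** * Strong limits and dominant spectral values *)

Section asymptotics.
Variables (R : realType) (K : topologicalType) (cK : compact [set: K]).
Local Notation C := R[i].
Local Notation CK := (Cspace R cK).
Implicit Types (T W : R -> boundedOp CK) (f g : CK) (z : C).

Lemma bounded_rnorm (T : R -> boundedOp CK) : bounded_semigroup T <->
  exists2 M : R, 0 < M & forall t, 0 <= t -> rnorm (T t) <= M.
Proof.
split=> [[M TM]|[M _ TM]]; last by exists M => t /TM; rewrite rnormE lecR.
exists (Num.max M 1) => [|t /TM]; first by rewrite lt_max ltr01 orbT.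
by rewrite rnormE lecR le_max => ->.
Qed.

Lemma dominant_convergence T :
  let A := generator T in let s := spectral_bound A in
  C0_semigroup T -> bounded_semigroup (rescale T s) -> dominant_spectral_bound A ->
  resolvent_pole A s%:C ->
  strongly_converges (rescale T s) (spectral_projection A s%:C).
Proof.
move=> A s hT /bounded_rnorm[M M0 WM] [_ per] /pole_dataP.
move=> [m [c0 [c1 [r [c [m0 c00 pd Pc0]]]]]] f.
have m1 := bounded_simple_pole hT WM m0 c00 pd.
rewrite (Pc0 m1) m1 in pd *; apply: (simple_pole_convergence hT M0 WM pd).
move=> y /eqP y0; apply: contrapT => yA; apply: y0.
have : peripheral_spectrum A (s +i* y).
  split; last by exists y.
  suff -> : s +i* y = s%:C + (0 +i* y) by [].
  by apply/eqP; rewrite eq_complex /= addr0 add0r !eqxx.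
by rewrite per => -[].
Qed.

(** Half a period: at this time an eigenvector of frequency [b] becomes its negative, which rules it
    out next to fixed limits or fixed functions. *)
Lemma ecis_antiperiod (b : R) : b != 0 -> exists2 t : R, 0 < t & ecis (t * b) = -1.
Proof.
move=> b0; exists (pi / `|b|); first by rewrite divr_gt0 ?pi_gt0 ?normr_gt0.
rewrite -mulrA; have [b_gt0|b_lt0] := ltP 0 b.
  by rewrite gtr0_norm// mulVf// mulr1 ecis_pi.
rewrite ler0_norm// invrN mulNr mulVf// mulrN1.
by have := ecisNK (pi : R); rewrite ecis_pi mulN1r => /eqP; rewrite eqr_oppLR => /eqP.
Qed.

Lemma peripheral_eigenvector T (s b : R) : C0_semigroup T ->
  resolvent_pole (generator T) (s +i* b) -> exists2 f, f <> 0 &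
    forall t, 0 <= t -> rescale T s t f = ecis (t * b) *: f.
Proof.
move=> hT /pole_dataP[m [c0 [c1 [r [c [m0 c00 pd _]]]]]].
have [f ff] : exists f, c0 f <> 0.
  by apply: contrapT => H; apply: c00; apply: bopP => f; apply: contrapT => ff; apply: H; exists f.
exists (c0 f) => // t t0; have [/(gen_shift s%:C hT) e0 _] := pole_data_gen f m0 pd.
rewrite rescaleE; rewrite -scalerBl in e0.
rewrite (gen_eigen (sgshift_sg s%:C hT) e0 t0); congr (cexp _ *: _).
by apply/eqP; rewrite eq_complex /=; apply/andP; split; apply/eqP; ring.
Qed.

Lemma fixed_spectrum T (s : R) f : C0_semigroup T -> f <> 0 ->
  (forall t, 0 <= t -> rescale T s t f = f) -> spectrum (generator T) s%:C.
Proof.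
rewrite rescaleE => hT f0 Wf [S /resolventP[_ S2]]; apply: f0.
have : gen (sgshift T s%:C) f 0.
  apply/gen0P; first exact: sgshift_sg.
  move=> e e0; apply/near_right0P; exists 1 => // h /andP[h0 _].
  rewrite add0r !Wf ?(ltW h0)// subrr scaler0 subr0 rnorm0.
  by rewrite mulr_ge0// ltW.
move=> /(gen_unshift hT); rewrite add0r => /S2.
by rewrite subrr linear0 => <-.
Qed.

Lemma limit_fixed T (s : R) (Q : boundedOp CK) f : C0_semigroup T ->
  strongly_converges (rescale T s) Q ->
  forall t, 0 <= t -> rescale T s t (Q f) = Q f.
Proof.
rewrite rescaleE => hT WQ t t0; have [_ WD _] := sgshift_sg s%:C hT.
apply: (@rnorm_cvg_unique _ _ _ (+oo : set_system R) (fun r => sgshift T s%:C (t + r) f)).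
  apply: cvg_near_eq (bop_cvg (sgshift T s%:C t) (WQ f)).
  by apply: filterS (nbhs_pinfty_ge (num_real (0 : R))) => r r0; rewrite WD.
have := WQ f; apply: cvg_comp; exact: cvg_addrl.
Qed.

Lemma convergence_dominant T (Q : boundedOp CK) :
  let A := generator T in let s := spectral_bound A in
  C0_semigroup T -> strongly_converges (rescale T s) Q -> Q <> 0 ->
  (forall z, peripheral_spectrum A z -> resolvent_pole A z) ->
  bounded_semigroup (rescale T s) /\ dominant_spectral_bound A.
Proof.
move=> A s hT WQ Q0 poles; split.
  apply/bounded_rnorm; apply: sg_uniformly_bounded => f.
  have /cvg_rnormP/(_ 1 ltr01)[t0 [_ t0P]] := WQ f.
  rewrite rescaleE; apply: (@orbit_bounded _ _ _ _ f (rnorm (Q f) + 1) (t0 + 1)).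
    exact: sgshift_sg.
  move=> t tt _; have := t0P t; rewrite rescaleE => H.
  have := rnorm_le_dist (sgshift T s%:C t f) (Q f); rewrite rnorm_distC => /le_trans; apply.
  by rewrite lerD2l; apply: H; apply: lt_le_trans tt; rewrite ltrDl.
have [f ff] : exists f, Q f <> 0.
  by apply: contrapT => H; apply: Q0; apply: bopP => f; apply: contrapT => ff; apply: H; exists f.
have sA : spectrum A s%:C by exact: fixed_spectrum hT ff (limit_fixed f hT WQ).
split=> //; apply/seteqP; split=> [z|z ->]; last by split=> //; exists 0.
move=> zp; have [_ [b _ zE]] := zp; have zpole := poles z zp; rewrite -zE /= in zpole *.
have [v v0 Wv] := peripheral_eigenvector (s := s) hT zpole.
suff -> : b = 0 by [].
apply: contrapT => /eqP /ecis_antiperiod[t t0 tb]; apply: v0.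
(* The orbit translated by the half period [t] has the same limit and is also the negated orbit.
   Thus [Q v = 0], although the orbit of [v] has constant norm. *)
have Qv : Q v = - Q v.
  apply: (@rnorm_cvg_unique _ _ _ (+oo : set_system R) (fun r => rescale T s (t + r) v)).
    by apply: cvg_comp (WQ v); exact: cvg_addrl.
  apply: cvg_near_eq (cvgN (WQ v)).
  apply: filterS (nbhs_pinfty_ge (num_real (0 : R))) => r r0.
  rewrite -[LHS]/(- (rescale T s r v)) !Wv ?addr_ge0 ?(ltW t0)//.
  by rewrite mulrDl ecisD tb mulN1r scaleNr.
have {}Qv : Q v = 0.
  have : 2%:R *: Q v = 0 by rewrite scaler_nat mulr2n {1}Qv addNr.
  by move=> /eqP; rewrite scaler_eq0 pnatr_eq0 /= => /eqP.
apply: rnorm_eq0 => e e0; have /cvg_rnormP/(_ e e0)[r0 [_ r0P]] := WQ v.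
have /r0P : r0 < Num.max 0 (r0 + 1) by rewrite lt_max ltrDl ltr01 orbT.
set r := Num.max 0 _; have r_ge0 : 0 <= r by rewrite le_max lexx.
by rewrite Qv sub0r rnormN Wv// rnormZ cmod_ecis mul1r.
Qed.

End asymptotics.

(** * Consequences of eventual strong positivity *)

Section strong_positivity.
Variables (R : realType) (K : topologicalType) (cK : compact [set: K]).
Local Notation C := R[i].
Local Notation CK := (Cspace R cK).
Implicit Types (T W : R -> boundedOp CK) (f g : CK) (z : C).

Lemma strongly_pos_domination f g : strongly_pos_fun f -> real_fun g ->
  exists2 d : R, 0 < d & nonneg_fun (f - d%:C *: g).
Proof.
move=> [b b0 fb] gr; exists (b / (rnorm g + 1)).
  by rewrite divr_gt0// ltr_wpDl ?rnorm_ge0.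
move=> x; rewrite CvalB CvalZ subr_ge0; apply: le_trans (fb x).
have := gr x; have := le_trans (Re_le_cmod _) (rnorm_Cval g x).
case: (Cval g x) => p q /= A ->; rewrite lecE /= !(mul0r, mulr0) subr0 addr0 eqxx /=.
rewrite mulrAC ler_pdivrMr ?ltr_wpDl ?rnorm_ge0//; apply: ler_wpM2l; first exact: ltW.
by apply: le_trans (ler_norm _) (le_trans A _); rewrite lerDl.
Qed.

(** Closeness to [Q f >= b] bounds only the real part from below; that the semigroup is real removes
    the imaginary part, which the order on [R[i]] does not tolerate. *)
Lemma pos_limit_strongly_pos T (Q : boundedOp CK) (s : R) f : real_semigroup T ->
  pos_fun f -> strongly_converges (rescale T s) Q -> strongly_pos_fun (Q f) ->
  exists2 t0 : R, 0 <= t0 & forall t, t0 <= t -> strongly_pos_fun (T t f).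
Proof.
move=> rT [f0 _] WQ [b b0 Qb]; have b2 : 0 < b / 2 by rewrite divr_gt0.
have /cvg_rnormP/(_ _ b2)[t0 [_ t0P]] := WQ f.
exists (Num.max 0 (t0 + 1)) => [|t]; first by rewrite le_max lexx.
rewrite ge_max => /andP[t_ge0 tt0].
have {}t0P : rnorm (Q f - rescale T s t f) <= b / 2.
  by apply: t0P; apply: lt_le_trans tt0; rewrite ltrDl.
have fr : real_fun f by move=> x; have := f0 x; rewrite lecE => /andP[/eqP].
exists (expR (t * s) * (b / 2)) => [|x]; first by rewrite mulr_gt0 ?expR_gt0.
have := Qb x; have := rT t t_ge0 f fr x.
have := le_trans (Re_le_cmod _) (le_trans (rnorm_Cval _ x) t0P).
rewrite CvalB -[Cval (rescale _ _ _ _) x]/((expR (- (t * s)))%:C * Cval (T t f) x).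
case: (Cval (Q f) x) => p q; case: (Cval (T t f) x) => k l /= + l0.
rewrite l0 !lecE /= eqxx /= mul0r subr0 => + /andP[_ bp].
rewrite expRN ler_norml => /andP[_ H].
have : b / 2 <= (expR (t * s))^-1 * k by lra.
by rewrite ler_pdivlMl ?expR_gt0.
Qed.

Lemma pole_leading_limit T (z0 : C) m c0 c1 r c f : pole_data T z0 m c0 c1 r c ->
  h%:C ^+ m *: resolvent (generator T) (z0 + h%:C) f @[h --> (0:R)^'+] --> c0 f.
Proof.
move=> [r0 c_ge0 H]; apply/cvg_rnormP => e e0.
pose k := (rnorm (c1 f) + c * rnorm f) + 1.
have k0 : 0 < k by rewrite ltr_wpDl// addr_ge0 ?mulr_ge0 ?rnorm_ge0.
apply/near_right0P; exists (Num.min (Num.min r 1) (e / k)).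
  by rewrite !lt_min r0 divr_gt0// ltr01.
move=> h /andP[h0]; rewrite !lt_min => /andP[/andP[hr /ltW h1]].
rewrite ltr_pdivlMr// => /ltW hk; apply: le_trans hk.
have [|_ B] := H h%:C; first by rewrite cmod_real gtr0_norm// h0.
set S := resolvent _ _ in B *.
have A := rnorm_bop (h%:C ^+ m *: S - c0 - h%:C *: c1) f; rewrite !bopBE !bopZE in A.
have := rnorm_le_dist (h%:C ^+ m *: S f - c0 f) (h%:C *: c1 f).
rewrite -[rnorm (c0 f - _)]rnorm_distC => /le_trans; apply.
rewrite rnormZR gtr0_norm// /k !mulrDr mulr1 -[leLHS]addr0 -addrA.
rewrite -[leRHS]addrA; apply: lerD => //; apply: lerD (ltW h0).
apply: le_trans A _; apply: le_trans (ler_wpM2r (rnorm_ge0 _) B) _.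
rewrite cmod_real gtr0_norm// mulrAC mulrC expr2 -mulrA ler_wpM2l ?(ltW h0)//.
by rewrite ler_piMl// mulr_ge0 ?rnorm_ge0.
Qed.

Lemma resolvent_commutes T z (S : boundedOp CK) t f : C0_semigroup T ->
  is_resolvent (generator T) z S -> 0 <= t -> S (T t f) = T t (S f).
Proof.
move=> hT /resolventP[S1 S2] t0; rewrite -[RHS](S2 _ _ (gen_orbit hT t0 (S1 f))).
by congr (S _); rewrite (linearB (T t)) (linearZ_LR (T t)) opprB addrC subrK.
Qed.

Lemma pole_leading_commutes T (z0 : C) m c0 c1 r c t f : C0_semigroup T ->
  pole_data T z0 m c0 c1 r c -> 0 <= t -> c0 (T t f) = T t (c0 f).
Proof.
move=> hT pd t0; have [r0 _ H] := pd.
have L := pole_leading_limit (f := T t f) pd; refine (rnorm_cvg_unique _ L _).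
apply: cvg_near_eq (bop_cvg (T t) (pole_leading_limit (f := f) pd)).
apply/near_right0P; exists r => // h /andP[h0 hr].
have [|SP _] := H h%:C; first by rewrite cmod_real gtr0_norm// h0.
by rewrite (linearZ_LR (T t)) (resolvent_commutes f hT SP t0).
Qed.

(* [c0] maps into the eigenspace of [s] and commutes with [T t], so [f] may be
   replaced by [T t f] with [t] large, on which the resolvent is positive. *)
Lemma pole_leading_nonneg T (s : R) m c0 c1 r c f : C0_semigroup T ->
  indiv_ev_strongly_pos T -> (0 < m)%N -> pole_data T s%:C m c0 c1 r c ->
  (forall l : R, s < l -> resolvent_set (generator T) l%:C) ->
  nonneg_fun f -> nonneg_fun (c0 f).
Proof.
move=> hT evp m0 pd sR f0.
have [->|/eqP fn0] := eqVneq f 0; first by rewrite linear0.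
have [t1 t10 t1P] := evp f (conj f0 fn0); have [T0 TD _] := hT.
have [r0 c_ge0 H] := pd; pose g := T t1 f.
have gc : poscone T g.
  move=> t t_ge0; rewrite /g -TD//; apply: strongly_pos_nonneg; apply: t1P.
  by rewrite lerDr.
have c0g : nonneg_fun (c0 g).
  apply: nonneg_approx => e e0.
  have /cvg_rnormP/(_ e e0)/near_right0P[d d0 dP] := pole_leading_limit (f := g) pd.
  pose h := Num.min (d / 2) (r / 2).
  have h0 : 0 < h by rewrite lt_min !divr_gt0.
  have hd : h < d by rewrite gt_min; apply/orP; left; lra.
  have hr : h < r by rewrite gt_min; apply/orP; right; lra.
  have [|SP _] := H h%:C; first by rewrite cmod_real gtr0_norm// h0.
  exists (h%:C ^+ m *: resolvent (generator T) (s%:C + h%:C) g); last by apply: dP; rewrite h0.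
  have [|S' S'P S'c] := @resolvent_poscone _ _ _ T (s + h) hT.
    by move=> l sl; apply: sR; apply: lt_le_trans sl; rewrite ltrDl.
  rewrite rmorphD in S'P; rewrite (resolvent_unique SP S'P).
  have := S'c _ gc 0 (lexx 0); rewrite T0 => Sg x.
  by rewrite CvalZ -rmorphXn mulr_ge0 ?Sg// ler0c exprn_ge0// ltW.
have [/(gen_eigen hT)/(_ t10) e0 _] := pole_data_gen f m0 pd.
rewrite /g (pole_leading_commutes f hT pd t10) e0 in c0g => x; have := c0g x.
rewrite CvalZ -rmorphM cexp_real; have p0 := expR_gt0 (t1 * s).
case: (Cval (c0 f) x) => a b; rewrite !lecE /= !mul0r subr0 addr0.
by rewrite mulf_eq0 pmulr_rge0// gt_eqF.
Qed.

End strong_positivity.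

(** * Peripheral eigenvectors under eventual strong positivity *)

Section peripheral_spectrum.
Variables (R : realType) (K : topologicalType) (cK : compact [set: K]).
Local Notation C := R[i].
Local Notation CK := (Cspace R cK).
Implicit Types (T W : R -> boundedOp CK) (f g : CK) (z : C).

(** A real function lies between two multiples of the constant 1, and [S] maps both to 0. *)
Lemma nonneg_op_eq0 (S : boundedOp CK) : (forall f, nonneg_fun f -> nonneg_fun (S f)) ->
  S (Cone_fun R cK) = 0 -> S = 0.
Proof.
move=> S0 S1; have real0 f : real_fun f -> S f = 0.
  move=> fr; have [|a a0 [ap am]] := @strongly_pos_cmp _ _ _ f (Cone_fun R cK) _ fr.
    by exists 1 => // x; rewrite Cone_funE.
  have := S0 _ (strongly_pos_nonneg ap); have := S0 _ (strongly_pos_nonneg am).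
  rewrite linearB linearD !linearZ_LR /= S1 => A B.
  apply: eq_Cval => x; apply: rnorm0_eq0; apply/eqP; rewrite eq_le rnorm_ge0 andbT.
  apply: le_trans (Cval_pm_le (B x) (A x)) _.
  by rewrite CvalZ Cval0 mulr0 rnorm0.
apply: bopP => f; have [g [h [gr hr ->]]] := real_part_ex f.
by rewrite linearD linearZ_LR /= !real0// scaler0 addr0.
Qed.

(* The least [c] with [g <= c *: u] leaves a nonnegative periodic function
   [c *: u - g], which would be strongly positive if it were not zero. *)
Lemma periodic_multiple W u (tau : R) g : [set: K] !=set0 -> C0_semigroup W ->
  indiv_ev_strongly_pos W -> strongly_pos_fun u -> (forall t, 0 <= t -> W t u = u) ->
  0 < tau -> real_fun g -> W tau g = g -> exists c : R, g = c%:C *: u.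
Proof.
move=> [x0 _] hW evp up Wu tau0 gr Wg; have [b b0 ub] := up; have [W0 WD _] := hW.
have ur : real_fun u by move=> x; have := ub x; rewrite lecE => /andP[/eqP].
have u0 x : b <= complex.Re (Cval u x) by have := ub x; rewrite lecE => /andP[].
have u_gt0 x : 0 < complex.Re (Cval u x) by exact: lt_le_trans (u0 x).
pose q x := complex.Re (Cval g x) / complex.Re (Cval u x).
have qub : has_ubound (range q).
  exists (rnorm g / b) => _ [x _ <-]; rewrite /q ler_pdivrMr//.
  apply: le_trans (ler_norm _) (le_trans (Re_le_cmod _) (le_trans (rnorm_Cval _ _) _)).
  rewrite mulrAC ler_pdivlMr// ler_wpM2l ?rnorm_ge0//.
pose c := sup (range q); exists c; pose h := c%:C *: u - g.
have hE x : Cval h x = (c * complex.Re (Cval u x) - complex.Re (Cval g x))%:C.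
  rewrite /h CvalB CvalZ; have := ur x; have := gr x.
  case: (Cval u x) => p q'; case: (Cval g x) => k l /= -> ->.
  by apply/eqP; rewrite eq_complex /= !(mul0r, mulr0) !subr0 addr0 !eqxx.
have h0 : nonneg_fun h.
  move=> x; rewrite hE ler0c subr_ge0 -ler_pdivrMr//; by apply: (ub_le_sup qub); exists x.
suff hh : h = 0 by apply/eqP; rewrite eq_sym -subr_eq0; exact/eqP.
apply: contrapT => hn0; have [t0 t00 t0P] := evp h (conj h0 hn0).
have Wh n : W (tau *+ n) h = h.
  elim: n => [|n IH]; first by rewrite mulr0n W0.
  rewrite mulrS WD ?mulrn_wge0 ?(ltW tau0)// IH /h.
  by rewrite linearB linearZ_LR /= Wg Wu ?(ltW tau0).
have hp : strongly_pos_fun h.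
  rewrite -(Wh (Num.truncn (t0 / tau)).+1); apply: t0P.
  by rewrite -mulr_natl -ler_pdivrMr// ltW// truncnS_gt.
(* If [h >= d *: u], then [g <= (c - d) *: u], so [c] was not the least constant. *)
have [d d0 dP] := strongly_pos_domination hp ur.
suff : c <= c - d by rewrite leNgt ltrBlDr ltrDl d0.
apply: ge_sup => [|_ [x _ <-]]; first by exists (q x0), x0.
have := dP x; rewrite CvalB CvalZ hE /q ler_pdivrMr//; have := ur x.
case: (Cval u x) => p q'; case: (Cval g x) => k l /= ->.
rewrite lecE /= => /andP[_]; rewrite mulr0 subr0; lra.
Qed.

Lemma rescale_real T (s t : R) f : real_semigroup T -> 0 <= t -> real_fun f ->
  real_fun (rescale T s t f).
Proof.
move=> rT t0 fr x; rewrite CvalZ; have := rT t t0 f fr x.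
by case: (Cval (T t f) x) => p q /= ->; rewrite mul0r mulr0 addr0.
Qed.

Lemma periodic_multiple_complex T (s : R) u (tau : R) f : [set: K] !=set0 ->
  C0_semigroup T -> real_semigroup T -> indiv_ev_strongly_pos T -> strongly_pos_fun u ->
  (forall t, 0 <= t -> rescale T s t u = u) -> 0 < tau -> rescale T s tau f = f ->
  exists z, f = z *: u.
Proof.
move=> K0 hT rT evp up Wu tau0; have [g [h [gr hr ->]]] := real_part_ex f => Wf.
have [Wg Wh] : rescale T s tau g = g /\ rescale T s tau h = h.
  have g'r := rescale_real s rT (ltW tau0) gr; have h'r := rescale_real s rT (ltW tau0) hr.
  move: Wf; rewrite linearD linearZ_LR /=.
  move: g'r h'r; set g' := rescale T s tau g; set h' := rescale T s tau h => g'r h'r E.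
  have Ex x : Cval g' x + 'i * Cval h' x = Cval g x + 'i * Cval h x.
    by have := congr1 (fun k => Cval k x) E; rewrite !CvalD !CvalZ.
  split; apply: eq_Cval => x; have := Ex x; have := g'r x; have := h'r x;
    have := gr x; have := hr x; case: (Cval g x) => a1 a2; case: (Cval h x) => b1 b2;
    case: (Cval g' x) => c1 c2; case: (Cval h' x) => d1 d2 /= -> -> -> -> [];
    by rewrite !mul0r !mulr0 !mul1r !subr0 !addr0 !add0r => E1 E2; rewrite ?E1 ?E2.
rewrite rescaleE in Wu Wg Wh.
have hW := sgshift_sg s%:C hT; have evW := ev_pos_shift s evp.
have [a ->] := periodic_multiple K0 hW evW up Wu tau0 gr Wg.
have [b ->] := periodic_multiple K0 hW evW up Wu tau0 hr Wh.
by exists (a%:C + 'i * b%:C); rewrite scalerDl scalerA.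
Qed.

Lemma ev_strongly_pos_dominant T :
  let A := generator T in let s := spectral_bound A in
  [set: K] !=set0 -> C0_semigroup T -> real_semigroup T -> indiv_ev_strongly_pos T ->
  spectrum A !=set0 -> (forall z, peripheral_spectrum A z -> resolvent_pole A z) ->
  [/\ bounded_semigroup (rescale T s), dominant_spectral_bound A &
      strongly_pos_op (spectral_projection A s%:C)].
Proof.
move=> A s K0 hT rT evp sp0 poles.
have sA : spectrum A s%:C by exact: spectral_bound_in_spectrum.
have sper : peripheral_spectrum A s%:C by split=> //; exists 0.
have [m [c0 [c1 [r [c [m0 c00 pd Pc0]]]]]] := pole_dataP (poles _ sper).
have sR (l : R) : s < l -> resolvent_set A l%:C by exact: right_half_line_resolvent.
have c0pos f : nonneg_fun f -> nonneg_fun (c0 f).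
  by exact: pole_leading_nonneg hT evp m0 pd sR.
have onep : strongly_pos_fun (Cone_fun R cK) by exists 1 => // x; rewrite Cone_funE.
pose u := c0 (Cone_fun R cK).
have u0 : pos_fun u.
  split; first exact/c0pos/strongly_pos_nonneg.
  by move=> uz; apply: c00; exact: nonneg_op_eq0 c0pos uz.
have Wc0 f t : 0 <= t -> rescale T s t (c0 f) = c0 f.
  move=> t0; rewrite rescaleE; have [/(gen_shift s%:C hT)] := pole_data_gen f m0 pd.
  by rewrite subrr => e0 _; exact: gen_fixed (sgshift_sg s%:C hT) e0 t0.
have evW := ev_pos_shift s evp; have hW := sgshift_sg s%:C hT.
have up : strongly_pos_fun u.
  have [t0 t00 /(_ t0 (lexx t0))] := evW u u0.
  by rewrite -rescaleE (Wc0 _ t0 t00).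
have Wb : exists2 M : R, 0 < M & forall t, 0 <= t -> rnorm (rescale T s t) <= M.
  rewrite rescaleE; apply: (dominated_bounded (c := rnorm u) K0 hW evW up) => t t0.
  by rewrite -rescaleE (Wc0 _ t t0).
have [M M0 WM] := Wb; have m1 := bounded_simple_pole hT WM m0 c00 pd.
split.
- exact/bounded_rnorm.
- split=> //; apply/seteqP; split=> [z zp|z ->//].
  have [_ [b _ zE]] := zp; have zpole := poles z zp; rewrite -zE /= in zpole *.
  have [v v0 Wv] := peripheral_eigenvector (s := s) hT zpole.
  suff -> : b = 0 by [].
  apply: contrapT => /eqP /ecis_antiperiod[t t0 tb]; apply: v0.
  (* Two half periods bring [v] back, so [v] is a multiple of [u]. But [u] is fixed at time [t],
     where [v] changes sign. *)
  have [|z' vz] := periodic_multiple_complex (tau := t + t) (f := v) K0 hT rT evp up (Wc0 _) (addr_gt0 t0 t0).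
    by rewrite Wv ?addr_ge0 ?(ltW t0)// mulrDl ecisD tb mulrNN mulr1 scale1r.
  have Wu : rescale T s t u = u by exact: Wc0 (ltW t0).
  have := Wv t (ltW t0); rewrite tb {1}vz linearZ_LR /=.
  rewrite -[_ *: T t u]/(rescale T s t u) Wu -vz scaleN1r => vN.
  have : 2%:R *: v = 0 by rewrite scaler_nat mulr2n {1}vN addNr.
  by move=> /eqP; rewrite scaler_eq0 pnatr_eq0 /= => /eqP.
rewrite (Pc0 m1) => f fp; have [t0 t00 /(_ t0 (lexx t0))] := evW f fp.
rewrite -rescaleE => Wf.
have oner : real_fun (Cone_fun R cK) by move=> x; rewrite Cone_funE.
(* [c0] is monotone and does not see the passage from [f] to [W t0 f >= d], so [c0 f >= d *: u]. *)
have [d d0 /c0pos dP] := strongly_pos_domination Wf oner.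
have c0W : c0 (rescale T s t0 f) = c0 f.
  rewrite -[RHS](Wc0 f t0 t00) linearZ_LR /= (pole_leading_commutes f hT pd t00) //.
have [b b0 ub] := up; exists (d * b) => [|x]; first exact: mulr_gt0.
move: c0W dP; move: (rescale T s t0 f) => k c0k /(_ x).
have -> : c0 (k - d%:C *: Cone_fun R cK) = c0 f - d%:C *: u.
  by rewrite linearB linearZ_LR /= c0k.
rewrite CvalB CvalZ subr_ge0; apply: le_trans.
by rewrite rmorphM ler_wpM2l// ler0c ltW.
Qed.

End peripheral_spectrum.

Theorem theorem5p4 (R : realType) (K : topologicalType)
    (K_nonempty : [set: K] !=set0) (cK : compact [set: K])
    (K_hausdorff : hausdorff_space K)
    (T : R -> boundedOp (Cspace R cK)) :
  C0_semigroup T ->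
  real_semigroup T ->
  let A := generator T in
  let s := spectral_bound A in
  spectrum A !=set0 ->
  finite_set (peripheral_spectrum A) ->
  (forall z, peripheral_spectrum A z -> resolvent_pole A z) ->
  let P := spectral_projection A s%:C in
  let i := indiv_ev_strongly_pos T in
  let ii := [/\ bounded_semigroup (rescale T s), dominant_spectral_bound A &
                strongly_pos_op P] in
  let limit Q := strongly_converges (rescale T s) Q /\ strongly_pos_op Q in
  let iii := exists Q, limit Q in
  [/\ i <-> ii, ii <-> iii & i -> forall Q, limit Q -> Q = P].
Proof.
move=> hT rT A s sp0 _ poles P i ii limit iii.
have i_ii : i -> ii by move=> evp; exact: ev_strongly_pos_dominant.
have conv : bounded_semigroup (rescale T s) -> dominant_spectral_bound A ->
    strongly_converges (rescale T s) P.
  move=> b dom; apply: dominant_convergence => //; apply: poles.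
  by rewrite dom.2.
have lim_unique Q Q' : strongly_converges (rescale T s) Q ->
    strongly_converges (rescale T s) Q' -> Q = Q'.
  by move=> WQ WQ'; apply: bopP => f; exact: rnorm_cvg_unique _ (WQ f) (WQ' f).
have ii_iii : ii -> iii by move=> [b dom PP]; exists P; split=> //; exact: conv.
have iii_ii : iii -> ii.
  move=> [Q [WQ QP]].
  have Q0 : Q <> 0.
    move=> Qz; have onep : strongly_pos_fun (Cone_fun R cK).
      by exists 1 => // x; rewrite Cone_funE.
    have := QP _ (strongly_pos_pos K_nonempty onep); rewrite Qz.
    by move=> /(strongly_pos_pos K_nonempty)[].
  have [b dom] := convergence_dominant hT WQ Q0 poles.
  (* Once boundedness and dominance are known, the limit is [P] as well, so [P] inherits the strong
     positivity of [Q]. *)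
  by split=> //; rewrite (lim_unique _ _ (conv b dom) WQ).
have iii_i : iii -> i.
  by move=> [Q [WQ QP]] f fp; exact: pos_limit_strongly_pos rT fp WQ (QP f fp).
split.
- by split=> [//|/ii_iii/iii_i].
- by split.
- by move=> /i_ii[b dom _] Q [WQ _]; exact: lim_unique WQ (conv b dom).
Qed.
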